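(* Let $K\ge1$ be an integer, $a\in(0,\infty]$, $\alpha\in(0,0.5]$, $\tau>0$, $\tilde V\ge V>0$, $R^2\in[0,1]$, $\tilde R^2=VR^2/\tilde V$, and let $\gamma\in(0,1)$ with $\gamma\ge\alpha$ be a desired level of power. Let $$N_{\mathrm{rr}}=\left\{\frac{\nu_{1-\alpha}(\tilde R^2)\tilde V^{1/2}-\nu_{1-\gamma}(R^2)V^{1/2}}{\tau}\right\}^2,\qquad N_{\mathrm{cr}}=\left\{\frac{z_{1-\alpha}\tilde V^{1/2}-z_{1-\gamma}V^{1/2}}{\tau}\right\}^2$$ be the sample sizes required to achieve power $\gamma$ under rerandomization and complete randomization, respectively, and assume $N_{\mathrm{cr}}>0$. Then: (1) If $\tilde V=V$, then $N_{\mathrm{rr}}/N_{\mathrm{cr}}\le1$. (2) If $\gamma\ge0.5$, then $N_{\mathrm{rr}}/N_{\mathrm{cr}}$ is (a) less than or equal to $1$, (b) increasing in the number of covariates $K$ and the rerandomization threshold $a$, and (c) decreasing in $R^2$. (3) Otherwise, if $\tilde V>V$ and $\gamma<0.5$, then $N_{\mathrm{rr}}/N_{\mathrm{cr}}$ may be greater than $1$ (that is, there are parameter values with $\tilde V>V$ and $\alpha\le\gamma<0.5$ for which $N_{\mathrm{rr}}/N_{\mathrm{cr}}>1$).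
   Context: Distribution. $\varepsilon_0\sim\mathcal N(0,1)$ is independent of $L_{K,a}$, where $L_{K,a}=\chi_{K,a}\,S\,\beta_K^{1/2}$ with $\chi_{K,a},S,\beta_K$ mutually independent, $\chi_{K,a}\ge0$, $\chi_{K,a}^2\sim(\chi_K^2\mid\chi_K^2\le a)$, $\chi^2_K$ a chi-squared random variable with $K$ degrees of freedom, $S$ uniform on $\{-1,1\}$, and $\beta_K\sim\mathrm{Beta}(1/2,(K-1)/2)$ ($\beta_1\equiv1$). Equivalently, $L_{K,a}\sim D_1\mid D^{T}D\le a$ for $D=(D_1,\dots,D_K)\sim\mathcal N(0,I_K)$; $L_{K,\infty}\sim\mathcal N(0,1)$. For $\rho^2\in[0,1]$ ($\rho\ge0$), $\nu_q(\rho^2)$ denotes the $q$-quantile of $(1-\rho^2)^{1/2}\varepsilon_0+\rho L_{K,a}$ (it depends on $K$ and $a$). $z_q$ denotes the $q$-quantile of $\mathcal N(0,1)$. ''Increasing'' and ''decreasing'' are understood in the weak (non-strict) sense. Interpretation. $\tau$ is the average treatment effect, $V$ is the scaled variance of the difference-in-means estimator under complete randomization, $\tilde V\ge V$ is the probability limit of its estimator, $R^2$ is the squared multiple correlation between the $K$ covariates and the potential outcomes, $\tilde R^2=VR^2/\tilde V$ is the probability limit of its estimator, $a$ is the threshold on the Mahalanobis distance between treatment and control covariate means used in rerandomization (a randomization is accepted when the distance is at most $a$), and $\alpha$ is the level of the one-sided test of $\tau=0$ against $\tau>0$. The quantities $V,\tilde V,R^2$ are treated as constants not varying with the sample size.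
   Formalization: In (2)(b), ''increasing in K'' is proved with the threshold a changed along with K so that P(chi^2_K <= a) stays the same; with a fixed and finite the claim is false (e.g. a=1, R^2=1, tilde V=V, alpha=0.25, gamma=0.75, K=1 versus K=2). *)

(* Defs.v *)
From HB Require Import structures.
From mathcomp Require Import all_boot all_order all_algebra.
From mathcomp Require Import all_classical all_reals all_analysis.
From mathcomp Require Import measurable_realfun.

Set Implicit Arguments.
Unset Strict Implicit.
Unset Printing Implicit Defensive.

Import Order.TTheory GRing.Theory Num.Theory.
Import numFieldNormedType.Exports.

Local Open Scope classical_set_scope.
Local Open Scope ring_scope.

Section quantile.
Context {R : realType}.

Definition quantile (P : probability (measurableTypeR R) R) (q : R) : R :=
  inf [set x : R | (q%:E <= P `]-oo, x]%classic)%E].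

Definition normal_quantile (q : R) : R := quantile (normal_prob 0 1) q.

End quantile.

(* The chi-squared and beta densities are given up to their normalising
   constants, which [mnormalize] supplies: 2^(K/2) Gamma(K/2) for the former and
   B(a, b) for the latter. The second argument of [mnormalize] (here a Dirac
   mass) is only a default for measures of total mass 0 or +oo. *)
Section chi_squared.
Context {R : realType}.
Variable K : nat.
Local Notation mu := (@lebesgue_measure R).

Definition chi2_weight (x : R) : R :=
  if 0 < x then x `^ (K%:R / 2 - 1) * expR (- x / 2) else 0.

Lemma chi2_weight_ge0 x : 0 <= chi2_weight x.
Proof.
by rewrite /chi2_weight; case: ifP => // _; rewrite mulr_ge0 ?powR_ge0 ?expR_ge0.
Qed.

Lemma measurable_chi2_weight : measurable_fun [set: R] chi2_weight.
Proof.
apply: measurable_fun_ifT => //=; first exact: measurable_fun_ltr.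
apply: measurable_funM; first exact: measurable_powR.
by apply: measurableT_comp => //; exact: measurable_funM.
Qed.

Definition chi2_measure (A : set (measurableTypeR R)) : \bar R :=
  (\int[mu]_(x in A) (chi2_weight x)%:E)%E.

Let chi2_measure0 : chi2_measure set0 = 0%E.
Proof. exact: integral_set0. Qed.

Let chi2_measure_ge0 A : (0 <= chi2_measure A)%E.
Proof. by apply: integral_ge0 => x _; rewrite lee_fin chi2_weight_ge0. Qed.

Let chi2_measure_sigma_additive : semi_sigma_additive chi2_measure.
Proof.
apply: semi_sigma_additive_nng_induced => [|x].
  by apply/measurable_EFinP; exact: measurable_chi2_weight.
by rewrite lee_fin chi2_weight_ge0.
Qed.

HB.instance Definition _ := isMeasure.Build _ _ _ chi2_measure
  chi2_measure0 chi2_measure_ge0 chi2_measure_sigma_additive.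

Definition chi2_prob : probability (measurableTypeR R) R :=
  mnormalize chi2_measure (dirac (0 : measurableTypeR R)).

Definition le_set (a : \bar R) : set (measurableTypeR R) :=
  [set x : R | (x%:E <= a)%E].

Lemma measurable_le_set a : measurable (le_set a).
Proof.
rewrite (_ : le_set a = [set: R] `&` [set x | (EFin x <= cst a x)%E]); last first.
  by rewrite setTI.
by apply: measurable_lee => //; exact/measurable_EFinP.
Qed.

Definition chi2_trunc (a : \bar R) : probability (measurableTypeR R) R :=
  mnormalize (mrestr chi2_prob (measurable_le_set a))
    (dirac (0 : measurableTypeR R)).

(* P(chi^2_K <= a) is the asymptotic probability that a randomization is
   accepted. Comparisons across different K are meaningful at equal acceptance
   probability, i.e. with the threshold recalibrated to K: for a fixed finite
   threshold a, the law of L_{K,a} concentrates at 0 as K grows. *)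
Definition accept_prob (a : \bar R) : \bar R := chi2_prob (le_set a).

End chi_squared.

Section beta.
Context {R : realType}.
Local Notation mu := (@lebesgue_measure R).

Section beta_measure.
Variables a b : R.

(* The library's [beta_prob] only has natural number parameters. *)
Definition beta_weight (x : R) : R :=
  if 0 < x < 1 then x `^ (a - 1) * (1 - x) `^ (b - 1) else 0.

Lemma beta_weight_ge0 x : 0 <= beta_weight x.
Proof.
by rewrite /beta_weight; case: ifP => // _; rewrite mulr_ge0 ?powR_ge0.
Qed.

Lemma measurable_beta_weight : measurable_fun [set: R] beta_weight.
Proof.
apply: measurable_fun_ifT => //=.
  by apply: measurable_and; exact: measurable_fun_ltr.
apply: measurable_funM; first exact: measurable_powR.
apply: (measurableT_comp (measurable_powR (b - 1))).
exact: measurable_funB.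
Qed.

Definition beta_measure (A : set (measurableTypeR R)) : \bar R :=
  (\int[mu]_(x in A) (beta_weight x)%:E)%E.

Let beta_measure0 : beta_measure set0 = 0%E.
Proof. exact: integral_set0. Qed.

Let beta_measure_ge0 A : (0 <= beta_measure A)%E.
Proof. by apply: integral_ge0 => x _; rewrite lee_fin beta_weight_ge0. Qed.

Let beta_measure_sigma_additive : semi_sigma_additive beta_measure.
Proof.
apply: semi_sigma_additive_nng_induced => [|x].
  by apply/measurable_EFinP; exact: measurable_beta_weight.
by rewrite lee_fin beta_weight_ge0.
Qed.

HB.instance Definition _ := isMeasure.Build _ _ _ beta_measure
  beta_measure0 beta_measure_ge0 beta_measure_sigma_additive.

Definition rbeta_prob : probability (measurableTypeR R) R :=
  mnormalize beta_measure (dirac (1 : measurableTypeR R)).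

End beta_measure.

Definition betaK_prob (K : nat) : probability (measurableTypeR R) R :=
  if K == 1%N then (dirac (1 : measurableTypeR R) : probability _ R)
  else rbeta_prob (1 / 2) ((K%:R - 1) / 2).

End beta.

Section rerandomization.
Context {R : realType}.

(* A point (e, (c, (s, b))) carries the values of epsilon_0, chi_{K,a}^2, the
   sign S (coded by a boolean) and beta_K; the product probability makes these
   four variables mutually independent. *)
Local Notation rr_space :=
  (measurableTypeR R * (measurableTypeR R * (bool * measurableTypeR R)))%type.

Definition rr_prob (K : nat) (a : \bar R) : probability rr_space R :=
  (normal_prob 0 1 \x
    (chi2_trunc K a \x (bernoulli_prob (1 / 2) \x betaK_prob K)))%E.

Definition eps0 (w : rr_space) : R := w.1.
Definition chiKa (w : rr_space) : R := Num.sqrt w.2.1.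
Definition sgnS (w : rr_space) : R := if w.2.2.1 then 1 else -1.
Definition betaK (w : rr_space) : R := w.2.2.2.

Definition LKa (w : rr_space) : R := chiKa w * sgnS w * Num.sqrt (betaK w).

Definition rr_mix (rho2 : R) (w : rr_space) : measurableTypeR R :=
  Num.sqrt (1 - rho2) * eps0 w + Num.sqrt rho2 * LKa w.

Lemma measurable_rr_mix rho2 : measurable_fun [set: rr_space] (rr_mix rho2).
Proof.
have m2 : measurable_fun [set: rr_space] snd by exact: measurable_snd.
have m21 : measurable_fun [set: rr_space] (fun w => w.2.1 : measurableTypeR R).
  by apply: (measurableT_comp measurable_fst m2).
have m22 : measurable_fun [set: rr_space] (fun w => w.2.2).
  by apply: (measurableT_comp measurable_snd m2).
have m221 : measurable_fun [set: rr_space] (fun w => w.2.2.1).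
  by apply: (measurableT_comp measurable_fst m22).
have m222 : measurable_fun [set: rr_space] (fun w => w.2.2.2 : measurableTypeR R).
  by apply: (measurableT_comp measurable_snd m22).
have ms : measurable_fun [set: R] (@Num.sqrt R).
  by apply: continuous_measurable_fun; exact: sqrt_continuous.
have mS : measurable_fun [set: rr_space] sgnS by apply: measurable_fun_ifT.
have mL : measurable_fun [set: rr_space] LKa.
  apply: measurable_funM; last exact: (measurableT_comp ms m222).
  by apply: measurable_funM => //; exact: (measurableT_comp ms m21).
apply: measurable_funD; apply: measurable_funM => //.
exact: measurable_fst.
Qed.

HB.instance Definition _ rho2 :=
  isMeasurableFun.Build _ _ _ _ (rr_mix rho2) (measurable_rr_mix rho2).

Definition nu (K : nat) (a : \bar R) (q rho2 : R) : R :=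
  quantile (distribution (rr_prob K a) (rr_mix rho2)) q.

Definition N_rr (K : nat) (a : \bar R) (alpha gamma tau Vt V R2 : R) : R :=
  ((nu K a (1 - alpha) (V * R2 / Vt) * Num.sqrt Vt
    - nu K a (1 - gamma) R2 * Num.sqrt V) / tau) ^+ 2.

Definition N_cr (alpha gamma tau Vt V : R) : R :=
  ((normal_quantile (1 - alpha) * Num.sqrt Vt
    - normal_quantile (1 - gamma) * Num.sqrt V) / tau) ^+ 2.

Definition size_ratio (K : nat) (a : \bar R) (alpha gamma tau Vt V R2 : R) : R :=
  N_rr K a alpha gamma tau Vt V R2 / N_cr alpha gamma tau Vt V.

(* a ranges over ]0, +oo]; [N_rr] uses tilde R^2 = V R^2 / tilde V. *)
Definition admissible (K : nat) (a : \bar R) (alpha gamma tau Vt V R2 : R) :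
    Prop :=
  [/\ (1 <= K)%N /\ (0 < a)%E,
      0 < alpha <= 1 / 2,
      0 < tau /\ 0 < V <= Vt,
      0 <= R2 <= 1 &
      [/\ 0 < gamma < 1, alpha <= gamma & 0 < N_cr alpha gamma tau Vt V]].

End rerandomization.

(* Main.v *)
(* Let W = (1 - rho^2)^(1/2) eps_0 + rho L, where L is a standard normal
   coordinate D_1 conditioned on |D|^2 <= a, with distribution function F, and let
   Phi be that of N(0, 1). The laws are symmetric, so when gamma >= 1/2 the
   numerator of N_rr^(1/2) is the sum
   nu_{1-alpha}(tilde R^2) tilde V^(1/2) + nu_gamma(R^2) V^(1/2) of nonnegative
   terms and part (2) reduces to the monotonicity of F(t), t >= 0, in a, K and
   rho. Conditionally on |D|^2 = s the probability of W <= t is nonincreasing in s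
   after symmetrization; raising a, or raising K at fixed acceptance probability,
   moves mass of s upwards, and a Neyman-Pearson comparison concludes. For rho, a
   rotation of the Gaussian plane moves the extra noise from W to the test
   function, and the Neyman-Pearson comparison applies to the density of W with
   respect to N(0, 1), which is even and nonincreasing on [0, +oo).

   Part (1) with gamma < 1/2 needs dispersion: nu_p - nu_q <= z_p - z_q for
   1/2 <= q <= p. This follows from a single crossing property: for d >= 0,
   Phi(t + d) <= F(t) persists when t increases. For L it holds because the
   density of L with respect to N(0, 1) is midpoint log-concave, so that the set
   where it dominates a given exponential tilt is an interval; convolution with the
   Gaussian noise preserves it by total positivity of the kernel. *)

From HB Require Import structures.
Require Import Defs.
From mathcomp Require Import all_boot all_order all_algebra.
From mathcomp Require Import all_classical all_reals all_analysis.
From mathcomp Require Import measurable_realfun ring lra.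

Set Implicit Arguments.
Unset Strict Implicit.
Unset Printing Implicit Defensive.

Import Order.TTheory GRing.Theory Num.Theory.
Import numFieldNormedType.Exports.

Local Open Scope classical_set_scope.
Local Open Scope ring_scope.
Local Open Scope ereal_scope.

(** * Integration *)

Section integration.
Context {R : realType}.

(** All integrands are nonnegative and extended-real, so Tonelli applies with no integrability
    condition, and conditioning on acceptance stays a factor [accept_prob] in front of each identity
    instead of becoming a quotient. The beta variable is eliminated by the gamma-beta algebra: (s b,
    s) has the law of (u, u + w), where u is the square of the first coordinate and w the sum of the
    other squares. Hence the density of L with respect to N(0, 1) is proportional to P(x^2 + w <=
    a). Its log-concavity comes from scaling: dilating the argument of a chi-squared distribution
    function amounts to an exponential tilt, so this function is log-concave along geometric means,
    and the arithmetic-geometric inequality does the rest. Quantiles are infima, and F might a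
    priori be flat somewhere: symmetry in the form F(-x) + F(x) = 1 yields F(Q(q)) = q, and the
    crossing property transfers to F what the strict increase of Phi provides. The values a = +oo,
    rho = 0 and rho = 1, where the truncation, the L part or the noise disappears, are separated off
    wherever a division or a kernel would degenerate. *)

Definition ind (b : bool) : \bar R := (b%:R)%:E.

Lemma ind_ge0 b : 0 <= ind b. Proof. by rewrite lee_fin ler0n. Qed.

Lemma ind_le1 b : ind b <= 1. Proof. by rewrite lee_fin lern1; case: b. Qed.

Lemma indT : ind true = 1. Proof. by []. Qed.

Lemma indF : ind false = 0. Proof. by []. Qed.

Lemma ind_le (b b' : bool) : (b -> b') -> ind b <= ind b'.
Proof. by case: b => [->//|_]; exact: ind_ge0. Qed.

Lemma indE T (A : set T) x : ind (x \in A) = (\1_A x)%:E.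
Proof. by rewrite indicE. Qed.

Lemma measurable_ind d (T : measurableType d) (b : T -> bool) :
  measurable_fun setT b -> measurable_fun setT (fun x => ind (b x)).
Proof. by move=> mb; exact: (measurableT_comp (f := ind)). Qed.

Lemma integral_ind d (T : measurableType d) (mu : {measure set T -> \bar R})
    (b : T -> bool) : measurable_fun setT b ->
  \int[mu]_x ind (b x) = mu [set x | b x].
Proof.
move=> mb; have mB : measurable [set x | b x].
  by rewrite -[X in measurable X]setTI; exact: mb.
rewrite -[[set x | b x]]setIT -integral_indic//; apply: eq_integral => x _.
by rewrite -indE; congr ind; apply/idP/idP; rewrite inE.
Qed.

Lemma measurable_integral d d' (T : measurableType d) (T' : measurableType d')
    (m : {sigma_finite_measure set T' -> \bar R}) (F : T -> T' -> \bar R) :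
  measurable_fun setT (fun z => F z.1 z.2) -> (forall x y, 0 <= F x y) ->
  measurable_fun setT (fun x => \int[m]_y F x y).
Proof.
move=> mF F0; exact: (measurable_fun_fubini_tonelli_F (fun z => F z.1 z.2)).
Qed.

Lemma tonelli d d' (T : measurableType d) (T' : measurableType d')
    (m1 : {sigma_finite_measure set T -> \bar R})
    (m2 : {sigma_finite_measure set T' -> \bar R}) (F : T -> T' -> \bar R) :
  measurable_fun setT (fun z => F z.1 z.2) -> (forall x y, 0 <= F x y) ->
  \int[m1]_x \int[m2]_y F x y = \int[m2]_y \int[m1]_x F x y.
Proof.
by move=> mF F0; exact: (fubini_tonelli (fun z => F z.1 z.2)).
Qed.

Import HBNNSimple.

(** Approximation by increasing simple functions, with monotone convergence on both sides, reduces
    the claim to indicators, where it is the hypothesis on [nu]. It applies to every measure of the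
    development that is defined by integrating a weight. *)
Lemma ge0_integral_density d (T : measurableType d)
    (mu nu : {measure set T -> \bar R}) (w : T -> R) :
  measurable_fun setT w -> (forall x, 0 <= w x)%R ->
  (forall A, measurable A -> nu A = \int[mu]_(x in A) (w x)%:E) ->
  forall f : T -> \bar R, measurable_fun setT f -> (forall x, 0 <= f x) ->
  \int[nu]_x f x = \int[mu]_x (f x * (w x)%:E).
Proof.
move=> mw w0 nuE f mf f0.
have mw' : measurable_fun setT (EFin \o w) by exact/measurable_EFinP.
pose h := nnsfun_approx measurableT mf.
have -> : \int[nu]_x f x = lim (\int[nu]_x (EFin \o h n) x @[n --> \oo]).
  have fE x : f x = lim ((EFin \o h n) x @[n --> \oo]).
    by apply/esym/cvg_lim => //; exact: cvg_nnsfun_approx.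
  under eq_integral do rewrite fE.
  apply: monotone_convergence => //.
  - by move=> n; apply/measurable_EFinP.
  - by move=> n x _ //=; rewrite lee_fin.
  - by move=> x _ a b ab; rewrite lee_fin; exact/lefP/nd_nnsfun_approx.
have -> : \int[mu]_x (f x * (w x)%:E) =
    lim (\int[mu]_x ((EFin \o h n) \* (EFin \o w)) x @[n --> \oo]).
  have fE x : f x * (w x)%:E = lim (((EFin \o h n) \* (EFin \o w)) x @[n --> \oo]).
    apply/esym/cvg_lim => //=.
    by apply: cvgeZr => //; exact: cvg_nnsfun_approx.
  under eq_integral do rewrite fE.
  apply: monotone_convergence => //.
  - by move=> n; apply: emeasurable_funM => //; apply/measurable_EFinP.
  - by move=> n x _ /=; rewrite mule_ge0 ?lee_fin.
  - move=> x _ a b ab/=; rewrite lee_wpmul2r ?lee_fin//.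
    exact/lefP/nd_nnsfun_approx.
suff suf n : \int[mu]_x ((EFin \o h n) x * (w x)%:E) = \int[nu]_x (EFin \o h n) x.
  by congr (lim (_ @ \oo)); apply/funext => n; rewrite suf.
transitivity (\int[nu]_x
   (\sum_(y \in range (h n)) (y * \1_(h n @^-1` [set y]) x)%:E)); last first.
  by apply: eq_integral => t tE; rewrite /= fimfunE -fsumEFin.
have indich m r : measurable_fun setT (fun x => (r * \1_(h m @^-1` [set r]) x)%:E).
  by apply: (measurable_comp measurableT) => //; exact: measurable_funM.
rewrite ge0_integral_fsum//; last by move=> m y Ey; exact: nnfun_muleindic_ge0.
transitivity (\int[mu]_x (\sum_(y \in range (h n))
    (y * \1_(h n @^-1` [set y]) x)%:E * (w x)%:E)).
  under [RHS]eq_integral => x xE.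
    rewrite -ge0_mule_fsuml => [|y]; last exact: nnfun_muleindic_ge0.
    rewrite fsumEFin // -(fimfunE _ x); over.
  by [].
rewrite ge0_integral_fsum//; last 2 first.
  - by move=> y; exact: emeasurable_funM.
  - by move=> m y Ey; rewrite mule_ge0 ?nnfun_muleindic_ge0// lee_fin.
apply: eq_fsbigr => r rhn.
under [RHS]eq_integral do rewrite EFinM.
rewrite integralZl_indic_nnsfun => //.
under eq_integral do rewrite EFinM -muleA.
rewrite ge0_integralZl//.
- under eq_integral do rewrite muleC.
  rewrite (eq_integral ((EFin \o w) \_ (h n @^-1` [set r]))); last first.
    by move=> x xE; rewrite epatch_indic.
  by rewrite -integral_mkcondr setTI -nuE// integral_indic// setIT.
- by apply: emeasurable_funM => //; exact/measurable_EFinP.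
- by move=> t Et; rewrite mule_ge0 ?lee_fin.
- by move: rhn; rewrite inE => -[t _ <-]; rewrite lee_fin.
Qed.

End integration.

Section ge0_integral.
Context d (T : measurableType d) {R : realType}.
Variable m : {measure set T -> \bar R}.
Implicit Types f g : T -> \bar R.

Lemma ge0_integralTZl (k : \bar R) f : measurable_fun setT f ->
  (forall x, 0 <= f x) -> 0 <= k -> \int[m]_x (k * f x) = k * \int[m]_x f x.
Proof. by move=> mf f0 k0; rewrite ge0_integralZl. Qed.

Lemma ge0_integralTZr (k : \bar R) f : measurable_fun setT f ->
  (forall x, 0 <= f x) -> 0 <= k -> \int[m]_x (f x * k) = \int[m]_x f x * k.
Proof. by move=> mf f0 k0; rewrite ge0_integralZr. Qed.

Lemma ge0_integralTD f g : measurable_fun setT f -> measurable_fun setT g ->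
  (forall x, 0 <= f x) -> (forall x, 0 <= g x) ->
  \int[m]_x (f x + g x) = \int[m]_x f x + \int[m]_x g x.
Proof. by move=> mf mg f0 g0; rewrite ge0_integralD. Qed.

Lemma ge0_le_integralT f g : measurable_fun setT f -> measurable_fun setT g ->
  (forall x, 0 <= f x) -> (forall x, f x <= g x) ->
  \int[m]_x f x <= \int[m]_x g x.
Proof. by move=> mf mg f0 fg; apply: ge0_le_integral. Qed.

End ge0_integral.

Lemma ge0_integral_mrestr d (T : measurableType d) {R : realType}
    (m : {measure set T -> \bar R}) (D : set T) (mD : measurable D)
    (f : T -> \bar R) : measurable_fun setT f -> (forall x, 0 <= f x) ->
  \int[mrestr m mD]_x f x = \int[m]_x (f x * (\1_D x)%:E).
Proof.
move=> mf f0.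
apply: (@ge0_integral_density _ _ _ m (mrestr m mD) (\1_D)) => //.
by move=> A mA; rewrite integral_indic// /mrestr setIC.
Qed.

Lemma integral_cstP d (T : measurableType d) {R : realType}
  (P : probability T R) (r : \bar R) : \int[P]_x r = r.
Proof. by rewrite integral_cst// [X in _ * X]probability_setT mule1. Qed.

(** * Affine substitution and the Neyman-Pearson comparison *)

Section comparison.
Context {R : realType}.
Notation mu := (@lebesgue_measure R).

(** Uniqueness of Lebesgue measure: its image under x -> a x + b, scaled by |a|, gives half-open
    intervals their length. For a < 0 the preimage of such an interval is half-open on the other
    side, which does not change the length. *)
Lemma integral_affine (a b : R) (f : R -> \bar R) : a != 0%R ->
  measurable_fun setT f -> (forall x, 0 <= f x) ->
  \int[mu]_x f (a * x + b)%R * `|a|%:E = \int[mu]_x f x.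
Proof.
move=> a0 mf f0.
pose phi : R -> measurableTypeR R := fun x => (a * x + b)%R.
have mphi : measurable_fun setT phi.
  by apply: measurable_funD => //; exact: measurable_funM.
have na : (0 < `|a|)%R by rewrite normr_gt0.
pose k := NngNum (ltW na).
have E A : measurable A -> mu A = mscale k (pushforward mu phi) A.
  apply: lebesgue_measure_unique => _ [[u v]] /= uv <-.
  rewrite /mscale/= /pushforward.
  have [ap|an|] := ltgtP a 0%R; last by move/eqP; rewrite (negbTE a0).
    rewrite (_ : phi @^-1` `]u, v] =
      `[((v - b) / a)%R, ((u - b) / a)%R[%classic); last first.
      apply/seteqP; split=> x /=; rewrite !in_itv/= /phi => /andP[h1 h2].
        by rewrite ler_ndivrMr// ltr_ndivlMr//; apply/andP; split; lra.
      by move: h1 h2; rewrite ler_ndivrMr// ltr_ndivlMr// => h1 h2; apply/andP; split; lra.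
    rewrite !lebesgue_measure_itv/= !lte_fin ltr_nM2r ?invr_lt0// ltrD2r.
    case: ltP => uv'; last by rewrite mule0.
    rewrite -!EFinB -EFinM ltr0_norm//; congr EFin; field.
    by rewrite lt_eqF.
  rewrite (_ : phi @^-1` `]u, v] =
    `]((u - b) / a)%R, ((v - b) / a)%R]%classic); last first.
    apply/seteqP; split=> x /=; rewrite !in_itv/= /phi => /andP[h1 h2].
      by rewrite ler_pdivlMr// ltr_pdivrMr//; apply/andP; split; lra.
    by move: h1 h2; rewrite ler_pdivlMr// ltr_pdivrMr// => h1 h2; apply/andP; split; lra.
  rewrite !lebesgue_measure_itv/= !lte_fin ltr_pM2r ?invr_gt0// ltrD2r.
  case: ltP => uv'; last by rewrite mule0.
  rewrite -!EFinB -EFinM gtr0_norm//; congr EFin; field.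
  by rewrite gt_eqF.
rewrite [RHS](eq_measure_integral (mscale k (pushforward mu phi))); last first.
  by move=> A mA _; exact: E.
rewrite ge0_integral_mscale// muleC; congr (_ * _).
by rewrite ge0_integral_pushforward.
Qed.

(** This is (h - c)(k1 - k2) >= 0, expanded so that no subtraction of infinite values occurs. *)
Lemma rearrangement (h c k1 k2 : \bar R) : 0 <= h -> 0 <= c -> 0 <= k1 -> 0 <= k2 ->
  (c <= h /\ k2 <= k1) \/ (h <= c /\ k1 <= k2) ->
  h * k2 + c * k1 <= h * k1 + c * k2.
Proof.
suff H (h' c' l1 l2 : \bar R) : 0 <= h' -> 0 <= c' -> 0 <= l1 -> 0 <= l2 ->
    c' <= h' -> l2 <= l1 -> h' * l2 + c' * l1 <= h' * l1 + c' * l2.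
  move=> h0 c0 k10 k20 [[ch k21]|[hc k12]]; first exact: H.
  by rewrite addeC [leRHS]addeC; exact: H.
move=> h0 c0 k10 k20 ch k21.
(* If [l2] is infinite then so is [l1], and the increment 0 will do. *)
have [d d0 ->] : exists2 d, 0 <= d & l1 = l2 + d.
  have [l2fin|] := boolP (l2 \is a fin_num).
    exists (l1 - l2); first by rewrite sube_ge0// l2fin.
    by rewrite addeC subeK.
  rewrite ge0_fin_numE// -leNgt leye_eq => /eqP l2y.
  by exists 0 => //; move: k21; rewrite l2y leye_eq => /eqP ->.
rewrite !ge0_muleDr// -addeA; apply: leeD2l; rewrite addeC; apply: leeD => //.
exact: lee_wpmul2r.
Qed.

(** Integrating [rearrangement] gives the inequality with c times the mass of [k1] added on the left
    and c times the mass of [k2] on the right. The mass of [k2] is the smaller one and, like c, is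
    finite, so the two terms cancel. Depending on the use, [h] is a conditional probability, a
    density or a likelihood ratio. *)
Lemma neyman_pearson d (T : measurableType d) (m : {measure set T -> \bar R})
    (h k1 k2 : T -> \bar R) (c : \bar R) :
  measurable_fun setT h -> measurable_fun setT k1 -> measurable_fun setT k2 ->
  (forall x, 0 <= h x) -> (forall x, 0 <= k1 x) -> (forall x, 0 <= k2 x) ->
  0 <= c < +oo -> \int[m]_x k2 x < +oo -> \int[m]_x k2 x <= \int[m]_x k1 x ->
  (forall x, (c <= h x /\ k2 x <= k1 x) \/ (h x <= c /\ k1 x <= k2 x)) ->
  \int[m]_x (h x * k2 x) <= \int[m]_x (h x * k1 x).
Proof.
move=> mh mk1 mk2 h0 k10 k20 /andP[c0 cy] k2y k21 H.
have I20 : 0 <= \int[m]_x k2 x by exact: integral_ge0.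
have cI : c * \int[m]_x k2 x \is a fin_num.
  by rewrite fin_numM// ge0_fin_numE.
rewrite -(leeD2rE _ _ cI).
apply: (@le_trans _ _ (\int[m]_x (h x * k2 x) + c * \int[m]_x k1 x)).
  by apply: leeD => //; exact: lee_wpmul2l.
rewrite -!ge0_integralTZl// -!ge0_integralTD//.
- apply: ge0_le_integralT => //.
  + by apply: emeasurable_funD; exact: emeasurable_funM.
  + by apply: emeasurable_funD; exact: emeasurable_funM.
  + by move=> x; rewrite adde_ge0// mule_ge0.
  + by move=> x; exact: rearrangement.
all: try exact: emeasurable_funM.
all: by move=> x; exact: mule_ge0.
Qed.

Lemma integral_gt0 (x y : R) (f : R -> \bar R) : (x < y)%R ->
  measurable_fun setT f -> (forall z, 0 <= f z) ->
  (forall z, (x < z < y)%R -> 0 < f z) -> 0 < \int[mu]_z f z.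
Proof.
move=> xy mf f0 fp; rewrite lt0e integral_ge0// andbT; apply/eqP => I0.
have : \int[mu]_z `|f z| = 0.
  by rewrite -I0; apply: eq_integral => z _; rewrite gee0_abs.
move/ae_eq_integral_abs => /(_ measurableT mf) [N [mN N0 sub]].
have : mu `]x, y[ <= mu N.
  apply: le_measure; rewrite ?inE//.
  apply: (subset_trans _ sub) => z /=; rewrite in_itv/= => zxy /(_ I).
  by move/eqP; rewrite gt_eqF// fp.
rewrite N0 lebesgue_measure_itv/= lte_fin xy -EFinB lee_fin.
by rewrite leNgt subr_gt0 xy.
Qed.

End comparison.

(** * Gaussian smoothing *)

Lemma measurable_sqrt {R : realType} : measurable_fun setT (@Num.sqrt R).
Proof. by apply: continuous_measurable_fun; exact: sqrt_continuous. Qed.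

Definition gauss {R : realType} : probability (measurableTypeR R) R :=
  normal_prob 0 1.

Definition phi {R : realType} (x : R) : R := normal_pdf 0 1 x.

Ltac nneg := intros; cbn beta; repeat lazymatch goal with
  | |- is_true (@Order.le _ _ _ ?a) => lazymatch a with
    | ind _ => exact: ind_ge0
    | (_ * _)%E => apply: mule_ge0
    | GRing.add _ _ => first [apply: addr_ge0 | apply: adde_ge0]
    | (\int[_]_x _)%E => apply: integral_ge0 => ? _ /=
    | (_)%:E => rewrite lee_fin
    | normal_pdf _ _ _ => exact: normal_pdf_ge0
    | phi _ => exact: normal_pdf_ge0
    | expR _ => exact: expR_ge0
    | (_ `^ _)%R => exact: powR_ge0
    | (_ / _)%R => apply: divr_ge0
    | (_ * _)%R => apply: mulr_ge0
    | _ => done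
    end
  end.

(** Functions of two variables are curried, with joint measurability assumed on pairs; the clauses
    on [mF] pull it back along a pair of measurable maps. The clauses on partial applications such
    as [GRing.mul _] catch eta-reduced functions. *)
Ltac mstep := lazymatch goal with
  | |- measurable_fun _ (fun x => ind _) => apply: measurable_ind
  | |- measurable_fun _ (fun x => (_)%:E) => apply/measurable_EFinP
  | |- measurable_fun _ (fun x => _ * _)%E => apply: emeasurable_funM
  | |- measurable_fun _ (fun x => _ * _)%R => apply: measurable_funM
  | |- measurable_fun _ (fun x => GRing.add _ _) =>
    first [apply: measurable_funD | apply: emeasurable_funD]
  | |- measurable_fun _ (fun x => - _)%R =>
    apply: measurableT_comp; [exact: oppr_measurable|]
  | |- measurable_fun _ (fun x => _ ^+ _)%R => apply: measurable_funX
  | |- measurable_fun _ (fun x => expR _) =>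
    apply: measurableT_comp; [exact: measurable_expR|]
  | |- measurable_fun _ (fun x => (_ <= _)%R) => apply: measurable_fun_ler
  | |- measurable_fun _ (fun x => _ == _) => apply: measurable_fun_eqr
  | |- measurable_fun _ (fun x => (_ < _)%R) => apply: measurable_fun_ltr
  | |- measurable_fun _ (fun x => (_ <= _)%E) => apply: measurable_fun_lee
  | |- measurable_fun _ (fun x => normal_pdf _ _ _) =>
    apply: measurableT_comp; [exact: measurable_normal_pdf|]
  | |- measurable_fun _ (fun x => Num.sqrt _) =>
    apply: measurableT_comp; [exact: measurable_sqrt|]
  | |- measurable_fun _ (fun x => `|_|)%R =>
    apply: measurableT_comp; [exact: normr_measurable|]
  | |- measurable_fun _ (fun x => (_, _)) => apply: measurable_fun_pair
  | |- measurable_fun _ (fun x => (_).1) =>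
    apply: measurableT_comp; [exact: measurable_fst|]
  | |- measurable_fun _ (fun x => (_).2) =>
    apply: measurableT_comp; [exact: measurable_snd|]
  | |- measurable_fun _ (fun x => \int[_]_y _) =>
    apply: measurable_integral; [|by nneg]
  | mF : measurable_fun setT (fun z => ?F z.1 z.2) |- measurable_fun _ (fun x => ?F (@?a x) (@?b x)) =>
      let g := eval cbn beta in (fun x => (a x, b x)) in
      apply: (measurableT_comp (g := g) mF)
  | mF : measurable_fun setT (fun z => ?F z.1 z.2) |- measurable_fun _ (?F ?a) =>
      apply: (measurableT_comp (g := fun x => (a, x)) mF)
  | mf : measurable_fun setT ?f |- measurable_fun _ (fun x => ?f _) =>
    apply: (measurableT_comp mf)
  | |- measurable_fun _ (@Order.lt _ _ ?c) =>
    apply: (measurable_fun_ltr (f := fun=> c) (g := id));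
      [exact: measurable_cst|exact: measurable_id]
  | |- measurable_fun _ (@Order.le _ _ ?c) =>
    apply: (measurable_fun_ler (f := fun=> c) (g := id));
      [exact: measurable_cst|exact: measurable_id]
  | |- measurable_fun _ (GRing.mul _) => exact: mulrl_measurable
  | |- measurable_fun _ (GRing.add ?c) =>
    apply: (measurable_funD (f := fun=> c) (g := id));
      [exact: measurable_cst|exact: measurable_id]
  | |- measurable_fun _ (beta_weight _ _) => exact: measurable_beta_weight
  | |- measurable_fun _ _ =>
    first [assumption | exact: measurable_sqrt | exact: measurable_expR
      | exact: oppr_measurable | exact: normr_measurable | exact: measurable_id
      | exact: measurable_cst]
  end.
Ltac meas := cbn beta; repeat (mstep; cbn beta; cbn [fst snd]).

Section gaussian.
Context {R : realType}.
Notation mu := (@lebesgue_measure R).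

Lemma measurable_phi : measurable_fun setT (@phi R).
Proof. exact: measurable_normal_pdf. Qed.

Lemma phiE (x : R) : phi x = (normal_peak 1 * expR (- x ^+ 2 / 2))%R.
Proof. by rewrite /phi normal_pdfE ?oner_neq0//= /normal_fun subr0 expr1n. Qed.

Lemma phi_gt0 (x : R) : (0 < phi x)%R.
Proof. by rewrite phiE mulr_gt0 ?expR_gt0// normal_peak_gt0// oner_neq0. Qed.

Lemma phi_ge0 (x : R) : (0 <= phi x)%R. Proof. exact: ltW (phi_gt0 x). Qed.

Lemma phiN (x : R) : phi (- x) = phi x.
Proof. by rewrite !phiE sqrrN. Qed.

Lemma phiD (x h : R) : phi (x + h) = (phi x * expR (- h * x - h ^+ 2 / 2))%R.
Proof.
by rewrite !phiE -mulrA -expRD; congr (_ * expR _)%R; field.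
Qed.

Lemma integral_gauss (f : R -> \bar R) : measurable_fun setT f ->
  (forall x, 0 <= f x) -> \int[gauss]_x f x = \int[mu]_x (f x * (phi x)%:E).
Proof.
move=> mf f0.
exact: (@ge0_integral_density _ _ _ mu gauss phi measurable_phi phi_ge0).
Qed.

Lemma gaussN (f : R -> \bar R) : measurable_fun setT f ->
  (forall x, 0 <= f x) -> \int[gauss]_x f (- x)%R = \int[gauss]_x f x.
Proof.
move=> mf f0; have mp := measurable_phi.
rewrite !integral_gauss//; last by meas.
rewrite -[RHS](@integral_affine _ (-1) 0)//; [|by meas|by nneg].
rewrite normrN1 mule1; apply: eq_integral => x _.
by rewrite addr0 mulN1r phiN.
Qed.

(** The Cameron-Martin formula in dimension one. *)
Lemma gauss_shift (h : R) (f : R -> \bar R) : measurable_fun setT f ->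
  (forall x, 0 <= f x) -> \int[gauss]_x f x =
  \int[gauss]_x (f (x + h)%R * (expR (- h * x - h ^+ 2 / 2))%:E).
Proof.
move=> mf f0; have mp := measurable_phi.
rewrite !integral_gauss//; [|by meas|by nneg].
rewrite -[LHS](@integral_affine _ 1 h)//; [|by meas|by nneg].
rewrite normr1 mule1; apply: eq_integral => x _.
by rewrite mul1r phiD -muleA EFinM (muleC (phi x)%:E).
Qed.

(* Both sides are integrals against the density of a pair of standard normal
   variables with correlation [r], which is symmetric. *)
Lemma gauss_reversible (r c : R) (F : R -> R -> \bar R) :
  (0 <= c)%R -> (0 <= r)%R -> (r ^+ 2 + c ^+ 2 = 1)%R ->
  measurable_fun setT (fun z => F z.1 z.2) -> (forall x y, 0 <= F x y) ->
  \int[gauss]_x \int[gauss]_e F x (r * x + c * e)%R =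
  \int[gauss]_y \int[gauss]_e F (r * y + c * e)%R y.
Proof.
move=> c0 r0 rc mF F0; have mp := measurable_phi.
have [c0'|cn0] := eqVneq c 0%R.
  have -> : r = 1%R.
    by move: rc; rewrite c0' expr0n/= addr0 => /eqP; rewrite sqrp_eq1// => /eqP.
  apply: eq_integral => x _; apply: eq_integral => e _.
  by rewrite c0' mul0r addr0 mul1r.
have cp : (0 < c)%R by rewrite lt0r cn0.
have inner (f : R -> \bar R) (x : R) : measurable_fun setT f ->
    (forall x, 0 <= f x) -> \int[gauss]_e f (r * x + c * e)%R =
    \int[mu]_y (f y * (phi ((y - r * x) / c) / c)%:E).
  move=> mf f0; rewrite integral_gauss//; last by meas.
  rewrite -[RHS](@integral_affine _ c (r * x))//.
  - rewrite -ge0_integralTZr//; [|by meas|].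
      apply: eq_integral => e _; rewrite -muleA -EFinM addrK gtr0_norm//.
      by rewrite divfK// [(c * e)%R]mulrC mulfK// mulrC addrC.
    by move=> e; rewrite mule_ge0// lee_fin divr_ge0// phi_ge0.
  - by meas.
  - by move=> e; rewrite mule_ge0// lee_fin divr_ge0// phi_ge0.
have -> : \int[gauss]_x \int[gauss]_e F x (r * x + c * e)%R =
    \int[mu]_x \int[mu]_y
      (F x y * (phi ((y - r * x) / c) / c * phi x)%:E).
  rewrite integral_gauss; [|by meas|by nneg].
  apply: eq_integral => x _; rewrite (inner (F x))//; last by meas.
  rewrite -ge0_integralTZr; [|by meas| |by nneg].
  - by apply: eq_integral => y _; rewrite -muleA -EFinM.
  - by move=> y; rewrite mule_ge0// lee_fin divr_ge0// phi_ge0.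
have -> : \int[gauss]_y \int[gauss]_e F (r * y + c * e)%R y =
    \int[mu]_y \int[mu]_x
      (F x y * (phi ((x - r * y) / c) / c * phi y)%:E).
  rewrite integral_gauss; [|by meas|by nneg].
  apply: eq_integral => y _; rewrite (inner (F ^~ y))//; last by meas.
  rewrite -ge0_integralTZr; [|by meas| |by nneg].
  - by apply: eq_integral => x _; rewrite -muleA -EFinM.
  - by move=> x; rewrite mule_ge0// lee_fin divr_ge0// phi_ge0.
rewrite tonelli; [|by meas|]; last first.
  by move=> x y; rewrite mule_ge0// lee_fin mulr_ge0 ?divr_ge0 ?phi_ge0.
apply: eq_integral => y _; apply: eq_integral => x _; congr (_ * _%:E).
rewrite !phiE [LHS]mulrAC [RHS]mulrAC -[(_ * _ * (_ * _))%R]mulrACA -expRD.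
rewrite -[(_ * _ * (_ * _))%R in RHS]mulrACA -expRD; congr (_ * expR _ / _)%R.
apply/eqP; rewrite -subr_eq0; apply/eqP.
(* The difference of the two exponents is a multiple of r^2 + c^2 - 1, which is where the relation
   between r and c enters. *)
transitivity ((y ^+ 2 - x ^+ 2) * (r ^+ 2 + c ^+ 2 - 1) / (2 * c ^+ 2))%R.
  by field.
by rewrite rc subrr mulr0 mul0r.
Qed.

(** Reversibility implies stationarity: when the test function ignores the first variable, the
    right-hand side no longer involves the noise. *)
Lemma gauss_rotation (r c : R) (f : R -> \bar R) :
  (0 <= c)%R -> (0 <= r)%R -> (r ^+ 2 + c ^+ 2 = 1)%R ->
  measurable_fun setT f -> (forall x, 0 <= f x) ->
  \int[gauss]_x \int[gauss]_e f (r * x + c * e)%R = \int[gauss]_x f x.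
Proof.
move=> c0 r0 rc mf f0.
rewrite (@gauss_reversible r c (fun=> f))//; last by meas.
by apply: eq_integral => y _; exact: integral_cstP.
Qed.

End gaussian.

Section smoothing.
Context {R : realType}.
Notation mu := (@lebesgue_measure R).
Implicit Types (r s c x y : R) (g : R -> \bar R).

(** A single condition carries both evenness (apply it to x and -x both ways) and monotonicity on
    [0, +oo). *)
Definition even_antitone (g : R -> \bar R) :=
  forall x y : R, (`|x| <= `|y|)%R -> g y <= g x.

Lemma even_antitoneN g x : even_antitone g -> g (- x)%R = g x.
Proof. by move=> eg; apply/eqP; rewrite eq_le !eg// normrN. Qed.

(** For r^2 + c^2 = 1 this is the Mehler, or Ornstein-Uhlenbeck, operator; [gauss_reversible] is its
    self-adjointness with respect to N(0, 1). *)
Definition smooth (r c : R) (g : R -> \bar R) (y : R) : \bar R :=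
  \int[gauss]_e g (r * y + c * e)%R.

Lemma smooth_ge0 r c g y : (forall x, 0 <= g x) -> 0 <= smooth r c g y.
Proof. by move=> g0; apply: integral_ge0. Qed.

Lemma measurable_smooth r c g : measurable_fun setT g -> (forall x, 0 <= g x) ->
  measurable_fun setT (smooth r c g).
Proof. by move=> mg g0; rewrite /smooth; meas. Qed.

Lemma smoothN r c g y : measurable_fun setT g -> (forall x, 0 <= g x) ->
  (forall x, g (- x)%R = g x) -> smooth r c g (- y) = smooth r c g y.
Proof.
move=> mg g0 gN; rewrite /smooth -gaussN//; last by meas.
by apply: eq_integral => e _; rewrite !mulrN -opprD gN.
Qed.

(* The kernels centred at [r * y] and [r * z] are exchanged by the reflection
   about their midpoint, hence a rearrangement inequality. *)
Lemma smooth_even_antitone r c g : (0 <= r)%R -> (0 <= c)%R ->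
  measurable_fun setT g -> (forall x, 0 <= g x) -> even_antitone g ->
  even_antitone (smooth r c g).
Proof.
move=> r0 c0 mg g0 eg; have mp := @measurable_phi R.
have gN x : g (- x)%R = g x by exact: even_antitoneN.
suff H y z : (0 <= y <= z)%R -> smooth r c g z <= smooth r c g y.
  have E x : smooth r c g x = smooth r c g `|x|.
    by have [x0|x0] := leP 0%R x; [rewrite ger0_norm|rewrite ltr0_norm// smoothN].
  by move=> x y xy; rewrite (E x) (E y); apply: H; rewrite normr_ge0.
move=> /andP[y0 yz].
have [->|cn0] := eqVneq c 0%R.
  apply: ge0_le_integralT; [by meas|by meas|by move=> *|] => e /=.
  rewrite !mul0r !addr0; apply: eg; rewrite !ger0_norm ?mulr_ge0//.
    exact: ler_wpM2l.
  exact: le_trans yz.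
have cp : (0 < c)%R by rewrite lt0r cn0.
(* Chosen so that e -> d - e exchanges r y + c e and r z - c e. *)
pose d := (r * (z - y) / c)%R.
have d0 : (0 <= d)%R by rewrite divr_ge0// mulr_ge0// subr_ge0.
have cd : (c * d = r * z - r * y)%R by rewrite /d; field.
pose g1 e := g (r * y + c * e)%R; pose g2 e := g (r * z - c * e)%R.
have mg1 : measurable_fun setT g1 by rewrite /g1; meas.
have mg2 : measurable_fun setT g2 by rewrite /g2; meas.
have g10 e : 0 <= g1 e by exact: g0.
have g20 e : 0 <= g2 e by exact: g0.
have mpd : measurable_fun setT (fun e : R => phi (d - e)) by meas.
have E1 : smooth r c g y = \int[mu]_e (g1 e * (phi e)%:E).
  by rewrite /smooth integral_gauss.
have E2 : smooth r c g z = \int[mu]_e (g2 e * (phi e)%:E).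
  rewrite /smooth -gaussN//; last by meas.
  rewrite integral_gauss//; last by meas.
  by apply: eq_integral => e _; rewrite /g2 mulrN.
have refl (f : R -> \bar R) : measurable_fun setT f -> (forall x, 0 <= f x) ->
    \int[mu]_e f e = \int[mu]_e f (d - e)%R.
  move=> mf f0; rewrite -(@integral_affine _ (-1) d)// normrN1 mule1.
  by apply: eq_integral => e _; rewrite mulN1r addrC.
have E1' : smooth r c g y = \int[mu]_e (g2 e * (phi (d - e))%:E).
  rewrite E1 refl; [|by meas|by nneg].
  apply: eq_integral => e _; rewrite /g1 /g2; congr (g _ * _)%E; lra.
have E2' : smooth r c g z = \int[mu]_e (g1 e * (phi (d - e))%:E).
  rewrite E2 refl; [|by meas|by nneg].
  apply: eq_integral => e _; rewrite /g1 /g2; congr (g _ * _)%E; lra.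
(* Each smoothed value is written twice, with the kernel at e and at d - e. Only the sum of the two
   forms compares pointwise, so the doubled inequality is proved, and the contradiction replaces a
   halving in the extended reals. *)
rewrite leNgt; apply/negP => lt.
have := lteD lt lt; apply/negP; rewrite -leNgt.
have -> : smooth r c g z + smooth r c g z =
    \int[mu]_e (g1 e * (phi (d - e))%:E + g2 e * (phi e)%:E).
  by rewrite ge0_integralTD -?E2 -?E2'//; by [meas|nneg].
have -> : smooth r c g y + smooth r c g y =
    \int[mu]_e (g1 e * (phi e)%:E + g2 e * (phi (d - e))%:E).
  by rewrite ge0_integralTD -?E1 -?E1'//; by [meas|nneg].
apply: ge0_le_integralT; [by meas|by meas|by nneg|] => e.
have phi_le (u v : R) : (u ^+ 2 <= v ^+ 2)%R -> (phi v)%:E <= (phi u)%:E.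
  move=> uv; rewrite lee_fin !phiE ler_pM2l ?normal_peak_gt0 ?oner_neq0//.
  by rewrite ler_expR ler_pM2r// lerN2.
have norm_le (u v : R) : (0 <= u + v)%R -> (u <= v)%R -> (`|u| <= `|v|)%R.
  by move=> uv1 uv2; rewrite [leRHS]ger0_norm ?ler_norml; [apply/andP; split|]; lra.
have rs : (0 <= r * y + r * z)%R by rewrite addr_ge0// mulr_ge0//; lra.
rewrite ![_ * (phi _)%:E]muleC [leRHS]addeC [leLHS]addeC.
rewrite addeC [leRHS]addeC ![(phi _)%:E * _]muleC.
apply: rearrangement; [by []|by []|by nneg|by nneg|].
have [ed|de] := leP (e : R) (d / 2)%R; [left|right]; split.
- apply: eg; apply: norm_le; first lra.
  suff : (c * e <= c * (d / 2))%R by lra.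
  by rewrite ler_pM2l.
- apply: phi_le; suff : (0 <= d * (d - 2 * e))%R by nra.
  by rewrite mulr_ge0//; lra.
- apply: eg; apply: norm_le; first lra.
  suff : (c * (d / 2) <= c * e)%R by lra.
  by rewrite ler_pM2l// ltW.
- apply: phi_le; suff : (0 <= d * (2 * e - d))%R by nra.
  by rewrite mulr_ge0//; lra.
Qed.

(** The semigroup property: the composed kernel adds the noise s c e + c' e' with e, e' independent,
    and [gauss_rotation] merges it into one normal variable of variance c1^2. *)
Lemma smooth_rotation s r c c' c1 g x : (0 <= s)%R -> (0 <= r)%R ->
  (0 <= c)%R -> (0 <= c')%R -> (0 <= c1)%R ->
  (c1 ^+ 2 = s ^+ 2 * c ^+ 2 + c' ^+ 2)%R ->
  measurable_fun setT g -> (forall x, 0 <= g x) ->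
  smooth (s * r) c1 g x = smooth r c (smooth s c' g) x.
Proof.
move=> s0 r0 c0 c'0 c10 cE mg g0; rewrite /smooth.
have [c1z|c1n] := eqVneq c1 0%R.
  have sc : (s * c = 0)%R.
    by apply/eqP; rewrite -sqrf_eq0; apply/eqP; nra.
  have c'z : (c' = 0)%R by apply/eqP; rewrite -sqrf_eq0; apply/eqP; nra.
  rewrite c1z c'z; apply: eq_integral => e _.
  rewrite -[LHS](integral_cstP gauss); apply: eq_integral => e' _.
  by rewrite !mul0r !addr0 mulrDr !mulrA sc mul0r addr0.
have c1p : (0 < c1)%R by rewrite lt0r c1n.
rewrite -(@gauss_rotation R (s * c / c1)%R (c' / c1)%R (fun e : R => g (s * r * x + c1 * e)%R)).
- apply: eq_integral => e _; apply: eq_integral => e' _; congr g.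
  by field.
- by rewrite divr_ge0.
- by rewrite divr_ge0// mulr_ge0.
- by rewrite !exprMn exprVn -mulrDl -cE divff// sqrf_eq0.
- by meas.
- by [].
Qed.

End smoothing.

(** * Gamma, beta and chi-squared laws *)

Section gamma_beta.
Context {R : realType}.
Notation mu := (@lebesgue_measure R).
Implicit Types (p q x u s : R).

(** Unnormalised gamma density of shape p and rate 1/2; for p = K / 2 it is convertible to
    [chi2_weight K]. *)
Definition gamma_weight p x : R :=
  if (0 < x)%R then (x `^ (p - 1) * expR (- x / 2))%R else 0%R.

Lemma gamma_weight_ge0 p x : (0 <= gamma_weight p x)%R.
Proof. by rewrite /gamma_weight; case: ifP => // _; rewrite mulr_ge0 ?powR_ge0 ?expR_ge0. Qed.

Lemma gamma_weight_gt0 p x : (0 < x)%R -> (0 < gamma_weight p x)%R.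
Proof. by move=> x0; rewrite /gamma_weight x0 mulr_gt0 ?powR_gt0 ?expR_gt0. Qed.

Lemma gamma_weight0 p x : (x <= 0)%R -> gamma_weight p x = 0%R.
Proof. by rewrite /gamma_weight ltNge => ->. Qed.

Lemma measurable_gamma_weight p : measurable_fun setT (gamma_weight p).
Proof.
apply: measurable_fun_ifT => //=; first exact: measurable_fun_ltr.
apply: measurable_funM; first exact: measurable_powR.
by apply: measurableT_comp => //; exact: measurable_funM.
Qed.

(** The change of variables (s, x) -> (s x, s - s x), whose Jacobian is s, at the level of
    densities. *)
Lemma gamma_weightM p q s x : (0 < s)%R ->
  (gamma_weight p (s * x) * gamma_weight q (s - s * x) * s =
   gamma_weight (p + q) s * beta_weight p q x)%R.
Proof.
move=> s0; rewrite {3}/gamma_weight s0 /beta_weight.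
have [x0|x0] := leP x 0%R.
  by rewrite gamma_weight0 ?mul0r ?mulr0// pmulr_rle0.
have [x1|x1] := ltP x 1%R; last first.
  by rewrite [gamma_weight q _]gamma_weight0 ?mulr0 ?mul0r// subr_le0 ler_peMr// ltW.
rewrite (_ : s - s * x = s * (1 - x))%R; last by ring.
have x1' : (0 < 1 - x)%R by rewrite subr_gt0.
rewrite /gamma_weight !mulr_gt0// !powRM// ?ltW//.
have -> : (s `^ (p + q - 1) = s `^ (p - 1) * s `^ (q - 1) * s)%R.
  rewrite -{4}(powRr1 (ltW s0)) -!powRD; try by rewrite (gt_eqF s0) implybT.
  by congr (_ `^ _)%R; ring.
have -> : (expR (- s / 2) = expR (- (s * x) / 2) * expR (- (s * (1 - x)) / 2))%R.
  by rewrite -expRD; congr expR; field.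
by rewrite /=; ring.
Qed.

(* If [s] and [b] have a gamma and a beta distribution, then [s b] and
   [s (1 - b)] are independent gamma variables. *)
Lemma integral_gamma_beta p q (F : R -> R -> \bar R) :
  measurable_fun setT (fun z => F z.1 z.2) -> (forall x y, 0 <= F x y) ->
  \int[mu]_s \int[mu]_b
    (F (s * b)%R s * (gamma_weight (p + q) s * beta_weight p q b)%:E) =
  \int[mu]_u \int[mu]_w
    (F u (u + w)%R * (gamma_weight p u * gamma_weight q w)%:E).
Proof.
move=> mF F0.
have mp := measurable_gamma_weight p; have mq := measurable_gamma_weight q.
have mpq := measurable_gamma_weight (p + q).
have mb := @measurable_beta_weight _ p q.
have g0 := gamma_weight_ge0.
(* Substitute u = s b at fixed s; once the integrals are exchanged, substitute w = s - u at fixed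
   u. *)
transitivity (\int[mu]_s \int[mu]_u
    (F u s * (gamma_weight p u * gamma_weight q (s - u))%:E)).
  apply: eq_integral => s _; have [s0|s0] := leP s 0%R.
    rewrite (gamma_weight0 _ s0); apply: eq_integral => u _.
    rewrite mul0r mule0; have [u0|u0] := leP u 0%R.
      by rewrite (gamma_weight0 _ u0) mul0r mule0.
    by rewrite [gamma_weight q _]gamma_weight0 ?mulr0 ?mule0//; lra.
  rewrite -[RHS](@integral_affine _ s 0)%R//; last 3 first.
  - by rewrite gt_eqF.
  - by meas.
  - by move=> u; rewrite mule_ge0// lee_fin mulr_ge0.
  rewrite -ge0_integralTZr; [|by meas| |by rewrite lee_fin]; last first.
    by move=> u; rewrite mule_ge0// lee_fin mulr_ge0.
  apply: eq_integral => b _; rewrite addr0 -muleA -EFinM gtr0_norm//.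
  by rewrite gamma_weightM.
transitivity (\int[mu]_u \int[mu]_s
    (F u s * (gamma_weight p u * gamma_weight q (s - u))%:E)).
  apply: tonelli.
    by meas.
  by move=> s u; rewrite mule_ge0// lee_fin mulr_ge0.
apply: eq_integral => u _; rewrite -(@integral_affine _ 1 u)%R//; last 2 first.
- by meas.
- by move=> s; rewrite mule_ge0// lee_fin mulr_ge0.
rewrite normr1 mule1; apply: eq_integral => w _.
by rewrite mul1r addrK addrC.
Qed.

Definition gamma_mass p := \int[mu]_x (gamma_weight p x)%:E.
Definition beta_mass p q := \int[mu]_x (beta_weight p q x)%:E.

Lemma gamma_mass_gt0 p : 0 < gamma_mass p.
Proof.
apply: (@integral_gt0 _ 0 1)%R => //.
- by have mp := measurable_gamma_weight p; meas.
- by move=> x; rewrite lee_fin gamma_weight_ge0.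
- by move=> x /andP[x0 _]; rewrite lte_fin gamma_weight_gt0.
Qed.

Lemma beta_mass_gt0 p q : 0 < beta_mass p q.
Proof.
apply: (@integral_gt0 _ 0 1)%R => //.
- by meas.
- by move=> x; rewrite lee_fin beta_weight_ge0.
- move=> x x01; rewrite lte_fin /beta_weight x01.
  by case/andP: x01 => x0 x1; rewrite mulr_gt0 ?powR_gt0// subr_gt0.
Qed.

(** Euler's relation between the gamma and beta functions, as the case F = 1 of
    [integral_gamma_beta]. It holds in [0, +oo] before any mass is known to be finite, and
    finiteness is then deduced from it. *)
Lemma gamma_beta_mass p q :
  gamma_mass (p + q) * beta_mass p q = gamma_mass p * gamma_mass q.
Proof.
have mp := measurable_gamma_weight p; have mq := measurable_gamma_weight q.
have mpq := measurable_gamma_weight (p + q).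
have mb := @measurable_beta_weight _ p q.
have g0 r x : 0 <= (gamma_weight r x)%:E by rewrite lee_fin gamma_weight_ge0.
have b0 x : 0 <= (beta_weight p q x)%:E by rewrite lee_fin beta_weight_ge0.
have := @integral_gamma_beta p q (fun _ _ => 1) _ (fun _ _ => lee01).
under eq_integral => s _.
  under eq_integral do rewrite mul1e EFinM.
  rewrite ge0_integralTZl//; last by meas.
  over.
under [RHS]eq_integral => s _.
  under eq_integral do rewrite mul1e EFinM.
  rewrite ge0_integralTZl//; last by meas.
  over.
rewrite !ge0_integralTZr//; try by meas.
- by apply; meas.
- exact: ltW (gamma_mass_gt0 q).
- exact: ltW (beta_mass_gt0 p q).
Qed.

End gamma_beta.

(** * The substitution u = x^2 *)

Section square.
Context {R : realType}.
Notation mu := (@lebesgue_measure R).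

Lemma integral_ind_eq (f : R -> \bar R) (r : R) : measurable_fun setT f ->
  \int[mu]_x (f x * ind (x == r)) = 0.
Proof.
move=> mf; rewrite -[RHS](integral_set1 f r) [RHS]integral_mkcond.
apply: eq_integral => x _; rewrite patchE.
have [->|xr] := eqVneq x r; first by rewrite mem_set// mule1.
by rewrite memNset ?mule0// => /= /eqP; rewrite (negbTE xr).
Qed.

(** Jacobian of x -> x^2 on (0, +oo): squaring carries the measure with this density to Lebesgue
    measure on the positive half-line. *)
Definition square_weight (x : R) : R := if (0 < x)%R then (2 * x)%R else 0%R.

Lemma square_weight_ge0 x : (0 <= square_weight x)%R.
Proof. by rewrite /square_weight; case: ltP => // x0; rewrite mulr_ge0// ltW. Qed.

Lemma measurable_square_weight : measurable_fun setT square_weight.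
Proof.
by apply: measurable_fun_ifT => //=; exact: measurable_fun_ltr.
Qed.

Definition square_measure (A : set (measurableTypeR R)) : \bar R :=
  \int[mu]_(x in A) (square_weight x)%:E.

Let square_measure0 : square_measure set0 = 0.
Proof. exact: integral_set0. Qed.

Let square_measure_ge0 A : 0 <= square_measure A.
Proof. by apply: integral_ge0 => x _; rewrite lee_fin square_weight_ge0. Qed.

Let square_measure_sigma_additive : semi_sigma_additive square_measure.
Proof.
apply: semi_sigma_additive_nng_induced => [|x].
  by apply/measurable_EFinP; exact: measurable_square_weight.
by rewrite lee_fin square_weight_ge0.
Qed.

HB.instance Definition _ := isMeasure.Build _ _ _ square_measure
  square_measure0 square_measure_ge0 square_measure_sigma_additive.

(** Fundamental theorem of calculus with primitive x^2 between the square roots of a and b;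
    [Num.sqrt] vanishes on negative numbers, which produces the maxima. *)
Lemma square_measure_itv (a b : R) : (a < b)%R ->
  square_measure [set x | (a < x ^+ 2 <= b)%R] =
  (Num.max b 0 - Num.max a 0)%:E.
Proof.
move=> ab.
have sqrtE (x : R) : (Num.sqrt x ^+ 2 = Num.max x 0)%R.
  have [x0|x0] := ltP x 0%R; first by rewrite ltr0_sqrtr// expr0n.
  by rewrite sqr_sqrtr.
rewrite -!sqrtE.
have -> : square_measure [set x | (a < x ^+ 2 <= b)%R] =
    \int[mu]_(x in `](Num.sqrt a), (Num.sqrt b)]) (2 * x)%:E.
  rewrite /square_measure [LHS]integral_mkcond [RHS]integral_mkcond.
  apply: eq_integral => x _; rewrite !patchE /square_weight.
  have sa : (0 <= Num.sqrt a)%R by exact: sqrtr_ge0.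
  have [x0|x0] := ltP 0%R x; last first.
    by rewrite if_same memNset//= in_itv/=; apply/negP; rewrite negb_and -leNgt (le_trans x0).
  congr (if _ then _ else _); apply/idP/idP; rewrite !inE/= in_itv/=.
    move=> /andP[h1 h2]; apply/andP; split.
      by rewrite -(ger0_norm (ltW x0)) -sqrtr_sqr ltr_sqrt// exprn_gt0.
    rewrite -(ger0_norm (ltW x0)) -sqrtr_sqr ler_sqrt//.
    by rewrite (le_trans _ h2)// sqr_ge0.
  move=> /andP[h1 h2]; apply/andP; split.
    rewrite ltNge; apply: contraTN h1 => h1; rewrite -leNgt.
    by rewrite -(ger0_norm (ltW x0)) -sqrtr_sqr ler_wsqrtr.
  rewrite leNgt; apply: contraTN h2 => h2; rewrite -ltNge.
  rewrite -(ger0_norm (ltW x0)) -sqrtr_sqr ltr_sqrt//.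
  by rewrite exprn_gt0.
have [sab|] := ltP (Num.sqrt a) (Num.sqrt b); last first.
  move=> sba; rewrite set_itv_ge ?integral_set0; last by rewrite bnd_simp -leNgt.
  have -> : Num.sqrt b = Num.sqrt a by apply/eqP; rewrite eq_le sba ler_wsqrtr// ltW.
  by rewrite subrr.
rewrite integral_itv_obnd_cbnd; last by apply: measurable_funTS; meas.
rewrite (@continuous_FTC2 _ _ (fun x => x ^+ 2)%R)//.
- by apply: continuous_subspaceT => x; exact: mulrl_continuous.
- split.
  + by move=> x _; exact: exprn_derivable.
  + by apply: cvg_at_right_filter; exact: exprn_continuous.
  + by apply: cvg_at_left_filter; exact: exprn_continuous.
- by move=> x _; rewrite derive1E exp_derive /GRing.scale/= mulr1.
Qed.

(** Uniqueness of Lebesgue measure concerns the whole line, so the image of [square_measure] is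
    completed by the restriction of [mu] to the nonpositive half-line, on which the integrand
    vanishes. *)
Lemma integral_square (f : R -> \bar R) : measurable_fun setT f ->
  (forall x, 0 <= f x) -> \int[mu]_u (f u * ind (0 < u)%R) =
  \int[mu]_x (f (x ^+ 2)%R * (square_weight x)%:E).
Proof.
move=> mf f0.
pose sq : R -> measurableTypeR R := fun x => (x ^+ 2)%R.
have msq : measurable_fun setT sq by exact: measurable_funX.
have mN : measurable (`]-oo, 0%R] : set (measurableTypeR R)) by [].
have E A : measurable A -> mu A =
    (measure_add (pushforward square_measure sq) (mrestr mu mN)) A.
  apply: lebesgue_measure_unique => _ [[a b]] /= ab <-.
  rewrite /= /msum 2!big_ord_recl big_ord0 adde0 /= /pushforward /mrestr.
  have -> : sq @^-1` `]a, b] = [set x | (a < x ^+ 2 <= b)%R].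
    by apply/seteqP; split => x /=; rewrite in_itv.
  have -> : `]a, b] `&` `]-oo, 0%R] = `]a, (Num.min b 0%R)]%classic.
    apply/seteqP; split => x /=; rewrite !in_itv/= le_min.
      by move=> [/andP[-> ->] ->].
    by move=> /and3P[-> -> ->].
  have [ab'|ba] := ltP a b.
    rewrite square_measure_itv// !lebesgue_measure_itv/= !lte_fin lt_min ab'.
    have [a0|a0] := ltP a 0%R; have [b0|b0] := ltP b 0%R => /=.
    - by rewrite -!EFinB -EFinD; congr EFin; lra.
    - by rewrite -!EFinB -EFinD; congr EFin; lra.
    - by have := lt_trans ab' b0; rewrite ltNge a0.
    - by rewrite -!EFinB adde0.
  rewrite [X in square_measure X](_ : _ = set0) ?measure0; last first.
    by apply/seteqP; split => x //= /andP[h1 h2]; have := le_trans h2 ba; rewrite leNgt h1.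
  rewrite !set_itv_ge ?measure0 ?adde0// bnd_simp -leNgt// ge_min.
  by rewrite ba.
rewrite (eq_measure_integral (measure_add (pushforward square_measure sq) (mrestr mu mN)));
  last first.
  by move=> A mA _; exact: E.
have mg : measurable_fun setT (fun u : R => f u * ind (0 < u)%R) by meas.
have g0 (u : R) : 0 <= f u * ind (0 < u)%R by nneg.
rewrite ge0_integral_measure_add//.
have -> : \int[mrestr mu mN]_u (f u * ind (0 < u)%R) = 0.
  rewrite ge0_integral_mrestr//; apply: integral0_eq => u _.
  rewrite -indE; have [u0|u0] := ltP 0%R u; last by rewrite mule0 mul0e.
  have /negbTE -> : u \notin `]-oo, 0%R]%classic.
    by apply/negP; rewrite inE/= in_itv/= leNgt u0.
  by rewrite mule0.
rewrite adde0 ge0_integral_pushforward//.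
rewrite (@ge0_integral_density _ _ _ mu square_measure square_weight
  measurable_square_weight square_weight_ge0 (fun A _ => erefl));
    [|exact: measurableT_comp mg msq|by move=> x; exact: g0].
apply: eq_integral => x _ /=; rewrite /square_weight /sq.
have [x0|x0] := ltP 0%R x; last by rewrite !mule0.
by rewrite exprn_gt0// mule1.
Qed.

(** With u = x^2 the factor u^(-1/2) reduces the Jacobian 2 x to the constant 2, and evenness turns
    twice the positive half-line into the whole line. *)
Lemma integral_gamma_half (f : R -> \bar R) : measurable_fun setT f ->
  (forall x, 0 <= f x) -> \int[mu]_u (f u * (gamma_weight (1 / 2) u)%:E) =
  ((normal_peak 1)^-1)%:E * \int[gauss]_x f (x ^+ 2)%R.
Proof.
move=> mf f0; have mg := @measurable_gamma_weight R (1 / 2).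
have mp := @measurable_phi R; have ms := measurable_square_weight.
have g0 := @gamma_weight_ge0 R (1 / 2).
pose k : R := ((normal_peak 1)^-1)%R.
have kp : (0 < normal_peak 1 :> R)%R by rewrite normal_peak_gt0// oner_neq0.
have k0 : (0 <= k)%R by rewrite invr_ge0 ltW.
transitivity (\int[mu]_u (f u * (gamma_weight (1 / 2) u)%:E * ind (0 < u)%R)).
  apply: eq_integral => u _; have [u0|u0] := ltP 0%R u; first by rewrite mule1.
  by rewrite gamma_weight0// !mule0.
rewrite integral_square; [|by meas|by move=> u; rewrite mule_ge0// lee_fin].
pose h (x : R) := f (x ^+ 2)%R * (k * phi x)%:E.
have mh : measurable_fun setT h by rewrite /h; meas.
have h0 x : 0 <= h x by rewrite mule_ge0// lee_fin mulr_ge0 ?phi_ge0.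
have -> : \int[mu]_x
    (f (x ^+ 2)%R * (gamma_weight (1 / 2) (x ^+ 2))%:E * (square_weight x)%:E) =
    \int[mu]_x (h x * ind (0 < x)%R + h x * ind (0 < x)%R).
  apply: eq_integral => x _; rewrite /square_weight.
  have [x0|x0] := ltP 0%R x; last by rewrite !mule0 adde0.
  rewrite !mule1 /gamma_weight exprn_gt0// -muleA -EFinM.
  rewrite -ge0_muleDr; [|by rewrite lee_fin mulr_ge0 ?phi_ge0..].
  rewrite -EFinD; congr (_ * _%:E).
  rewrite (_ : 1 / 2 - 1 = - 2^-1)%R; last by field.
  rewrite powRN powR12_sqrt ?sqr_ge0// sqrtr_sqr ger0_norm ?ltW//.
  rewrite phiE /k mulKf ?gt_eqF//.
  by field; rewrite gt_eqF.
have -> : \int[gauss]_x f (x ^+ 2)%R = (normal_peak 1)%:E * \int[mu]_x h x.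
  rewrite -ge0_integralTZl//; last by rewrite lee_fin ltW.
  rewrite integral_gauss//; last by meas.
  apply: eq_integral => x _; rewrite /h muleCA -EFinM; congr (_ * _%:E).
  by rewrite mulrA divff ?gt_eqF// mul1r.
rewrite muleA -EFinM mulVf ?gt_eqF// mul1e.
rewrite ge0_integralTD//; [|by meas|by meas|by nneg|by nneg].
have -> : \int[mu]_x h x = \int[mu]_x (h x * ind (0 < x)%R) +
    (\int[mu]_x (h x * ind (x < 0)%R) + \int[mu]_x (h x * ind (x == 0%R))).
  have mi : measurable_fun setT (fun x => h x * ind (x == 0%R)).
    apply: emeasurable_funM => //; apply: measurable_ind.
    exact: measurable_fun_eqr.
  rewrite -!ge0_integralTD//; try by [meas|nneg].
  - apply: eq_integral => x _.
    by case: ltgtP => x0; rewrite !mule1 ?mule0 ?adde0 ?add0e.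
rewrite integral_ind_eq// adde0; congr (_ + _).
rewrite -[RHS](@integral_affine _ (-1) 0)//; [|by meas|by nneg].
rewrite normrN1 mule1; apply: eq_integral => x _.
by rewrite addr0 mulN1r /h sqrrN phiN oppr_lt0.
Qed.

End square.

(** * Normalised chi-squared and beta laws *)

Section laws.
Context {R : realType}.
Notation mu := (@lebesgue_measure R).
Implicit Types (F : R -> R -> \bar R) (f : R -> \bar R) (a : \bar R).

Lemma ge0_integral_mnormalize d (T : measurableType d)
    (m : {measure set T -> \bar R}) (P : probability T R) (f : T -> \bar R) :
  0 < m [set: T] < +oo -> measurable_fun setT f -> (forall x, 0 <= f x) ->
  \int[mnormalize m P]_x f x = ((fine (m [set: T]))^-1)%:E * \int[m]_x f x.
Proof.
move=> /andP[m0 my] mf f0.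
have i0 : (0 <= (fine (m [set: T]))^-1)%R by rewrite invr_ge0 fine_ge0 ?ltW.
rewrite [LHS](eq_measure_integral (mscale (NngNum i0) m)).
  by rewrite ge0_integral_mscale.
move=> A mA _; have E : mnormalize m P A = m A * ((fine (m [set: T]))^-1)%:E.
  by rewrite /mnormalize (gt_eqF m0) (lt_eqF my).
by apply: (etrans E); rewrite /mscale/= muleC.
Qed.

Lemma gamma_mass_half_lty : gamma_mass (1 / 2 : R) < +oo.
Proof.
have := @integral_gamma_half R (fun=> 1) _ (fun=> lee01).
under eq_integral do rewrite mul1e.
rewrite -/(gamma_mass _) => ->; last exact: measurable_cst.
by rewrite integral_cstP mule1 ltry.
Qed.

(** Induction in steps of 1/2: were the next mass infinite, its product with the positive beta mass
    would be infinite, whereas [gamma_beta_mass] equates that product with one of two finite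
    masses. *)
Lemma gamma_mass_lty k : gamma_mass (k.+1%:R / 2 : R) < +oo.
Proof.
elim: k => [|k IH]; first exact: gamma_mass_half_lty.
have := gamma_beta_mass (k.+1%:R / 2 : R) (1 / 2).
rewrite -mulrDl natr1 => E; rewrite ltNge leye_eq; apply/negP => /eqP I.
move: E; rewrite I gt0_mulye ?beta_mass_gt0// => /esym/eqP.
apply/negP/negbT/lt_eqF/lte_mul_pinfty.
- exact: ltW (gamma_mass_gt0 _).
- by rewrite ge0_fin_numE ?ltW ?gamma_mass_gt0.
- exact: gamma_mass_half_lty.
Qed.

Lemma beta_mass_lty j k : beta_mass (j.+1%:R / 2 : R) (k.+1%:R / 2) < +oo.
Proof.
have := gamma_beta_mass (j.+1%:R / 2 : R) (k.+1%:R / 2).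
move=> E; rewrite ltNge leye_eq; apply/negP => /eqP I.
move: E; rewrite I gt0_muley ?gamma_mass_gt0// => /esym/eqP.
apply/negP; rewrite lt_eqF// lte_mul_pinfty ?gamma_mass_lty//.
- exact: ltW (gamma_mass_gt0 _).
- by rewrite ge0_fin_numE ?gamma_mass_lty// ltW ?gamma_mass_gt0.
Qed.

Lemma integral_chi2 k f : measurable_fun setT f -> (forall x, 0 <= f x) ->
  \int[chi2_prob k.+1]_x f x = ((fine (gamma_mass (k.+1%:R / 2 : R)))^-1)%:E *
    \int[mu]_x (f x * (gamma_weight (k.+1%:R / 2) x)%:E).
Proof.
move=> mf f0; rewrite ge0_integral_mnormalize//; last first.
  by apply/andP; split; [exact: gamma_mass_gt0|exact: gamma_mass_lty].
congr (_ * _).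
exact: (@ge0_integral_density _ _ _ mu (chi2_measure k.+1) _
  (measurable_gamma_weight _) (gamma_weight_ge0 _) (fun A _ => erefl)).
Qed.

Lemma integral_rbeta j k f : measurable_fun setT f -> (forall x, 0 <= f x) ->
  \int[rbeta_prob (j.+1%:R / 2) (k.+1%:R / 2)]_x f x =
    ((fine (beta_mass (j.+1%:R / 2 : R) (k.+1%:R / 2)))^-1)%:E *
    \int[mu]_x (f x * (beta_weight (j.+1%:R / 2) (k.+1%:R / 2) x)%:E).
Proof.
move=> mf f0; rewrite ge0_integral_mnormalize//; last first.
  by apply/andP; split; [exact: beta_mass_gt0|exact: beta_mass_lty].
congr (_ * _).
exact: (@ge0_integral_density _ _ _ mu (beta_measure _ _) _
  (measurable_beta_weight _ _) (beta_weight_ge0 _ _) (fun A _ => erefl)).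
Qed.

Lemma chi2_gamma_beta j k F :
  measurable_fun setT (fun z => F z.1 z.2) -> (forall x y, 0 <= F x y) ->
  \int[chi2_prob (j.+1 + k.+1)]_s
     \int[rbeta_prob (j.+1%:R / 2) (k.+1%:R / 2)]_b F (s * b)%R s =
  \int[chi2_prob j.+1]_u \int[chi2_prob k.+1]_w F u (u + w)%R.
Proof.
move=> mF F0.
set p : R := (j.+1%:R / 2)%R; set q : R := (k.+1%:R / 2)%R.
have pq : ((j + k.+1).+1%:R / 2 = p + q :> R)%R.
  by rewrite -addSn natrD mulrDl.
have mp := measurable_gamma_weight p; have mq := measurable_gamma_weight q.
have mpq := measurable_gamma_weight (p + q); have mb := @measurable_beta_weight R p q.
have g0 (r x : R) : (0 <= gamma_weight r x)%R by exact: gamma_weight_ge0.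
have b0 (x : R) : (0 <= beta_weight p q x)%R by exact: beta_weight_ge0.
have Gp : (0 < fine (gamma_mass p))%R.
  by rewrite fine_gt0// gamma_mass_gt0 gamma_mass_lty.
have Gq : (0 < fine (gamma_mass q))%R.
  by rewrite fine_gt0// gamma_mass_gt0 gamma_mass_lty.
have Gpq : (0 < fine (gamma_mass (p + q)))%R.
  by rewrite fine_gt0// gamma_mass_gt0 -pq gamma_mass_lty.
have Bpq : (0 < fine (beta_mass p q))%R.
  by rewrite fine_gt0// beta_mass_gt0 beta_mass_lty.
have fin (x : \bar R) : 0 < x -> x < +oo -> x \is a fin_num.
  by move=> h1 h2; rewrite ge0_fin_numE// ltW.
have mass : (fine (gamma_mass (p + q)) * fine (beta_mass p q) =
    fine (gamma_mass p) * fine (gamma_mass q))%R.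
  have fp := fin _ (gamma_mass_gt0 p) (gamma_mass_lty _).
  have fq := fin _ (gamma_mass_gt0 q) (gamma_mass_lty _).
  have fb := fin _ (beta_mass_gt0 p q) (beta_mass_lty _ _).
  have fpq : gamma_mass (p + q) \is a fin_num.
    by apply: fin (gamma_mass_gt0 _) _; rewrite -pq; exact: gamma_mass_lty.
  exact: etrans (esym (fineM fpq fb))
    (etrans (congr1 fine (gamma_beta_mass p q)) (fineM fp fq)).
transitivity (((fine (gamma_mass (p + q)))^-1)%:E *
    (((fine (beta_mass p q))^-1)%:E * \int[mu]_s \int[mu]_b
     (F (s * b)%R s * (gamma_weight (p + q) s * beta_weight p q b)%:E))).
  rewrite [(j.+1 + k.+1)%N]addSn integral_chi2; [|by meas|by nneg].
  rewrite -/p -/q pq; congr (_ * _).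
  rewrite -ge0_integralTZl; last 3 first.
  - by meas.
  - by move=> s; apply: integral_ge0 => b _; rewrite mule_ge0// lee_fin mulr_ge0.
  - by rewrite lee_fin invr_ge0; exact: ltW Bpq.
  apply: eq_integral => s _.
  rewrite integral_rbeta; [|by meas|by nneg].
  rewrite -/p -/q -muleA; congr (_ * _).
  rewrite -ge0_integralTZr;
    [|by meas|by move=> b; rewrite mule_ge0// lee_fin|by rewrite lee_fin].
  by apply: eq_integral => b _; rewrite -muleA -EFinM [(_ * gamma_weight _ _)%R]mulrC.
rewrite integral_gamma_beta// muleA -EFinM -invfM mass.
rewrite integral_chi2; [|by meas|by nneg].
rewrite invfM EFinM -muleA -/p; congr (_ * _).
rewrite -ge0_integralTZl; last 3 first.
- by meas.
- by move=> s; apply: integral_ge0 => b _; rewrite mule_ge0// lee_fin mulr_ge0.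
- by rewrite lee_fin invr_ge0; exact: ltW Gq.
apply: eq_integral => u _.
rewrite integral_chi2; [|by meas|by nneg].
rewrite -/q -muleA; congr (_ * _).
rewrite -ge0_integralTZr;
  [|by meas|by move=> w; rewrite mule_ge0// lee_fin|by rewrite lee_fin].
by apply: eq_integral => w _; rewrite -muleA -EFinM [(_ * gamma_weight p _)%R]mulrC.
Qed.

(* [chi2_prob] with [0] degrees of freedom replaced by its natural meaning. *)
Definition chi2_prob0 k : probability (measurableTypeR R) R :=
  if k is k'.+1 then chi2_prob k'.+1
  else (dirac ((0%R : R) : measurableTypeR R) : probability _ R).

Lemma integral_diracT (x : R) f : measurable_fun setT f ->
  \int[dirac (x : measurableTypeR R)]_y f y = f x.
Proof. by move=> mf; rewrite integral_dirac// diracT mul1e. Qed.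

(** When F ignores its first argument, the beta integral in [chi2_gamma_beta] is that of a constant;
    zero degrees of freedom are Dirac masses at 0. *)
Lemma chi2_convolution j k f : measurable_fun setT f -> (forall x, 0 <= f x) ->
  \int[chi2_prob0 (j + k)]_s f s =
  \int[chi2_prob0 j]_u \int[chi2_prob0 k]_w f (u + w)%R.
Proof.
move=> mf f0; case: j => [|j].
  rewrite add0n /= integral_diracT; last by meas.
  by apply: eq_integral => w _; rewrite add0r.
case: k => [|k].
  rewrite addn0 /=; apply: eq_integral => u _.
  by rewrite integral_diracT ?addr0//; meas.
have mF : measurable_fun setT (fun z : R * R => f z.2) by meas.
apply: etrans (@chi2_gamma_beta j k (fun _ s => f s) mF (fun _ s => f0 s)).
by apply: eq_integral => s _; rewrite integral_cstP.
Qed.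

(** This is the passage between the two descriptions of L: u is D_1^2 and w is the sum of the k
    other squares. With one degree of freedom b = 1 and w = 0. *)
Lemma chi2_betaK k F :
  measurable_fun setT (fun z => F z.1 z.2) -> (forall x y, 0 <= F x y) ->
  \int[chi2_prob k.+1]_s \int[betaK_prob k.+1]_b F (s * b)%R s =
  \int[chi2_prob 1]_u \int[chi2_prob0 k]_w F u (u + w)%R.
Proof.
move=> mF F0; case: k => [|k].
  apply: eq_integral => s _; rewrite /betaK_prob/= !integral_diracT; last 2 first.
  - by meas.
  - by meas.
  by rewrite mulr1 addr0.
apply: etrans (@chi2_gamma_beta 0 k F mF F0).
by rewrite /betaK_prob/= -[k.+2%:R]natr1 addrK.
Qed.

Lemma eq_integral_chi2 k f g : measurable_fun setT f -> measurable_fun setT g ->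
  (forall x, 0 <= f x) -> (forall x, 0 <= g x) ->
  (forall x, (0 < x)%R -> f x = g x) ->
  \int[chi2_prob k.+1]_x f x = \int[chi2_prob k.+1]_x g x.
Proof.
move=> mf mg f0 g0 fg; rewrite !integral_chi2//; congr (_ * _).
apply: eq_integral => x _; have [x0|x0] := ltP 0%R x; first by rewrite fg.
by rewrite gamma_weight0// !mule0.
Qed.

(** The normalising constant need not be evaluated: the case f = 1 of the same identity shows that
    it is 1. *)
Lemma integral_chi2_1 f : measurable_fun setT f -> (forall x, 0 <= f x) ->
  \int[chi2_prob 1]_x f x = \int[gauss]_x f (x ^+ 2)%R.
Proof.
have kp : (0 < normal_peak 1 :> R)%R by rewrite normal_peak_gt0// oner_neq0.
have E g : measurable_fun setT g -> (forall x, 0 <= g x) ->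
    \int[chi2_prob 1]_x g x = ((fine (gamma_mass (1 / 2 : R)))^-1)%:E *
      (((normal_peak 1)^-1)%:E * \int[gauss]_x g (x ^+ 2)%R).
  by move=> mg g0; rewrite integral_chi2// integral_gamma_half.
move=> mf f0; rewrite E// muleA.
have := E _ (measurable_cst 1) (fun=> lee01).
by rewrite !integral_cstP mule1 => <-; rewrite mul1e.
Qed.

End laws.

(** * The law of the mixture *)

Section mixture.
Context {R : realType}.
Notation mu := (@lebesgue_measure R).
Implicit Types (k : nat) (a : \bar R) (f g : R -> \bar R).

Lemma accept_probE k a : accept_prob k a = \int[@chi2_prob R k]_s ind (s%:E <= a).
Proof.
rewrite integral_ind//.
by apply: measurable_fun_lee => //; exact/measurable_EFinP.
Qed.

Lemma measurable_ind_le a : measurable_fun setT (fun s : R => ind (s%:E <= a) : \bar R).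
Proof. by meas. Qed.

Lemma accept_prob_gt0 k a : 0 < a -> 0 < @accept_prob R k.+1 a.
Proof.
move=> a0; have ml := measurable_ind_le a.
have mg := @measurable_gamma_weight R (k.+1%:R / 2).
rewrite accept_probE integral_chi2//; last by nneg.
rewrite mule_gt0//.
  by rewrite lte_fin invr_gt0 fine_gt0// gamma_mass_gt0 gamma_mass_lty.
have [b b0 ba] : exists2 b : R, (0 < b)%R & b%:E <= a.
  case: a a0 {ml} => [r r0|_|//]; last by exists 1%R; rewrite ?leey.
  by exists r.
apply: (@integral_gt0 _ 0 b)%R => //.
- by meas.
- by move=> x; rewrite mule_ge0 ?ind_ge0// lee_fin gamma_weight_ge0.
- move=> x /andP[x0 xb]; rewrite mule_gt0 ?lte_fin ?gamma_weight_gt0//.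
  by rewrite (le_trans _ ba) ?indT// lee_fin ltW.
Qed.

Lemma accept_prob_le1 k a : accept_prob k.+1 a <= 1.
Proof. by apply: probability_le1; exact: measurable_le_set. Qed.

Lemma accept_prob_fin_num k a : accept_prob k a \is a fin_num.
Proof. by apply: fin_num_measure; exact: measurable_le_set. Qed.

(** Conditioning on acceptance in multiplicative form; the factor is positive and finite, hence
    cancellable in later comparisons. *)
Lemma integral_chi2_trunc k a f : 0 < a -> measurable_fun setT f ->
  (forall x, 0 <= f x) ->
  accept_prob k.+1 a * \int[chi2_trunc k.+1 a]_s f s =
  \int[chi2_prob k.+1]_s (f s * ind (s%:E <= a)).
Proof.
move=> a0 mf f0.
pose m := mrestr (@chi2_prob R k.+1) (measurable_le_set a).
have E : m [set: R] = accept_prob k.+1 a by rewrite /m /mrestr setTI.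
have mp : 0 < m [set: R] < +oo.
  by rewrite E accept_prob_gt0//= (le_lt_trans (accept_prob_le1 _ _))// ltry.
rewrite (ge0_integral_mnormalize _ mp)// [X in (fine X)^-1%:E]E.
rewrite -[X in X * _](fineK (accept_prob_fin_num _ _)) muleA -EFinM divff ?mul1e.
  rewrite ge0_integral_mrestr//; apply: eq_integral => s _; rewrite -indE.
  by congr (_ * ind _); apply/idP/idP; rewrite inE.
by rewrite gt_eqF// fine_gt0// accept_prob_gt0//= (le_lt_trans (accept_prob_le1 _ _))// ltry.
Qed.

(** The even part of f, which is what integrating out the fair sign S leaves. *)
Definition sym f (x : R) : \bar R := (1 / 2)%:E * f x + (1 / 2)%:E * f (- x)%R.

Lemma sym_ge0 f x : (forall x, 0 <= f x) -> 0 <= sym f x.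
Proof. by move=> f0; rewrite adde_ge0// mule_ge0. Qed.

Lemma symN f x : sym f (- x) = sym f x.
Proof. by rewrite /sym opprK addeC. Qed.

Lemma sym_norm f (x : R) : sym f `|x|%R = sym f x.
Proof. by case: (ger0P x) => // _; rewrite symN. Qed.

Lemma measurable_sym f : measurable_fun setT f -> measurable_fun setT (sym f).
Proof. by move=> mf; rewrite /sym; meas. Qed.

Lemma sym_even_antitone f x : (forall x, 0 <= f x) -> even_antitone f -> sym f x = f x.
Proof.
move=> f0 ef; rewrite /sym even_antitoneN// -ge0_muleDl// -EFinD.
by rewrite -splitr mul1e.
Qed.

Definition mixture_prob k a (rho2 : R) : probability (measurableTypeR R) R :=
  distribution (rr_prob k a) (rr_mix rho2).

Lemma integral_mixture k a (rho2 : R) f :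
  measurable_fun setT f -> (forall x, 0 <= f x) ->
  \int[mixture_prob k a rho2]_x f x =
  \int[chi2_trunc k a]_s \int[betaK_prob k]_b
    sym (smooth (Num.sqrt rho2) (Num.sqrt (1 - rho2)) f)
        (Num.sqrt s * Num.sqrt b)%R.
Proof.
move=> mf f0; set Pf := smooth _ _ f.
have mPf : measurable_fun setT Pf by exact: measurable_smooth.
have Pf0 x : 0 <= Pf x by exact: smooth_ge0.
rewrite ge0_integral_distribution//.
pose m3 : probability (bool * measurableTypeR R)%type R :=
  (bernoulli_prob (1 / 2) \x betaK_prob k)%E.
pose m2 : probability (measurableTypeR R * (bool * measurableTypeR R))%type R :=
  (chi2_trunc k a \x m3)%E.
pose g (z : measurableTypeR R * (measurableTypeR R * (bool * measurableTypeR R))) :=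
  f (rr_mix rho2 z).
have mg : measurable_fun setT g by apply: measurableT_comp => //; exact: measurable_rr_mix.
have g0 z : 0 <= g z by exact: f0.
transitivity (\int[m2]_z
    \int[gauss]_e g (e, z)).
  exact: (@fubini_tonelli2 _ _ _ _ R gauss m2 g mg g0).
pose h (z : measurableTypeR R * (bool * measurableTypeR R)) := \int[gauss]_e g (e, z).
have hE s S b : h (s, (S, b)) =
    Pf (Num.sqrt s * (if S then 1 else -1) * Num.sqrt b)%R.
  apply: eq_integral => e _; rewrite /g /rr_mix /eps0 /LKa /chiKa /sgnS /betaK/=.
  by rewrite addrC.
have mh : measurable_fun setT h by exact: (measurable_fun_fubini_tonelli_G g).
have h0 z : 0 <= h z by exact: integral_ge0.
apply: etrans (@fubini_tonelli1 _ _ _ _ R (chi2_trunc k a) m3 h mh h0) _.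
apply: eq_integral => s _ /=.
have mhs : measurable_fun setT (fun z => h (s, z)).
  by apply: measurableT_comp => //; exact: measurable_pair1.
apply: etrans (@fubini_tonelli1 _ _ _ _ R (bernoulli_prob (1 / 2)) (betaK_prob k)
  (fun z => h (s, z)) mhs (fun=> h0 _)) _.
rewrite /fubini_F integral_bernoulli_prob; last 2 first.
- by apply/andP; split; lra.
- by move=> S; apply: integral_ge0.
rewrite /unstable.onem (_ : (1 - 1 / 2 = 1 / 2 :> R)%R); last by field.
under eq_integral do rewrite hE mulr1.
under [X in _ + _ * X]eq_integral do rewrite hE mulrN1 mulNr.
rewrite /sym -!ge0_integralTZl//; [|by meas|by meas].
by rewrite -ge0_integralTD//; [by meas|by meas|by nneg|by nneg].
Qed.

Lemma mixture_chi2 k a (rho2 : R) f : 0 < a ->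
  measurable_fun setT f -> (forall x, 0 <= f x) ->
  accept_prob k.+1 a * \int[mixture_prob k.+1 a rho2]_x f x =
  \int[chi2_prob k.+1]_s
    (\int[betaK_prob k.+1]_b
       sym (smooth (Num.sqrt rho2) (Num.sqrt (1 - rho2)) f)
           (Num.sqrt s * Num.sqrt b)%R * ind (s%:E <= a)).
Proof.
move=> a0 mf f0; set Pf := smooth _ _ f.
have mPf : measurable_fun setT Pf by exact: measurable_smooth.
have Pf0 x : 0 <= Pf x by exact: smooth_ge0.
have ms := measurable_sym mPf.
have s0 x : 0 <= sym Pf x by exact: sym_ge0.
by rewrite integral_mixture// integral_chi2_trunc//; [meas|nneg].
Qed.

(* The density of [L_{K,a}] with respect to the standard normal law, up to the
   factor [accept_prob K a], for [K = k + 1]. *)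
Definition section_prob k a (x : R) : \bar R :=
  \int[chi2_prob0 k]_w ind ((x ^+ 2 + w)%:E <= a).

Lemma section_prob_ge0 k a x : 0 <= section_prob k a x.
Proof. by apply: integral_ge0 => w _; exact: ind_ge0. Qed.

Lemma section_prob_le1 k a x : section_prob k a x <= 1.
Proof.
rewrite -[leRHS](integral_cstP (chi2_prob0 k)); apply: ge0_le_integralT => //.
- by meas.
- by move=> w; exact: ind_ge0.
- by move=> w; exact: ind_le1.
Qed.

Lemma measurable_section_prob k a : measurable_fun setT (section_prob k a).
Proof. by rewrite /section_prob; meas. Qed.

Lemma section_prob_even_antitone k a : even_antitone (section_prob k a).
Proof.
move=> x y xy; apply: ge0_le_integralT.
- by meas.
- by meas.
- by move=> w; exact: ind_ge0.
- move=> w; apply: ind_le; apply: le_trans; rewrite lee_fin lerD2r.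
  rewrite -(real_normK (num_real x)) -(real_normK (num_real y)).
  by rewrite lerXn2r ?nnegrE.
Qed.

(** After [chi2_betaK] the test function depends on u alone and acceptance on u + w, so w can be
    integrated out of the acceptance event. *)
Lemma mixture_sections k a (rho2 : R) f : 0 < a ->
  measurable_fun setT f -> (forall x, 0 <= f x) ->
  accept_prob k.+1 a * \int[mixture_prob k.+1 a rho2]_x f x =
  \int[chi2_prob 1]_u
    (sym (smooth (Num.sqrt rho2) (Num.sqrt (1 - rho2)) f) (Num.sqrt u) *
     \int[chi2_prob0 k]_w ind ((u + w)%:E <= a)).
Proof.
move=> a0 mf f0; rewrite (mixture_chi2 _ _ a0 mf f0); set Pf := smooth _ _ f.
have mPf : measurable_fun setT Pf by exact: measurable_smooth.
have Pf0 x : 0 <= Pf x by exact: smooth_ge0.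
have ms := measurable_sym mPf.
have s0 x : 0 <= sym Pf x by exact: sym_ge0.
pose F (u s : R) := sym Pf (Num.sqrt u) * ind (s%:E <= a).
have mF : measurable_fun setT (fun z => F z.1 z.2) by rewrite /F; meas.
have F0 u s : 0 <= F u s by rewrite /F; nneg.
transitivity (\int[chi2_prob k.+1]_s \int[betaK_prob k.+1]_b F (s * b)%R s).
  apply: eq_integral_chi2; [by meas|by meas|by nneg|by nneg|] => s sp.
  rewrite -ge0_integralTZr; [|by meas|by nneg|exact: ind_ge0].
  by apply: eq_integral => b _; rewrite /F sqrtrM ?(ltW sp).
apply: etrans (@chi2_betaK R k F mF F0) _.
apply: eq_integral => u _; rewrite -ge0_integralTZl; [by []|by meas|by nneg|by nneg].
Qed.

Lemma gauss_sym f g : measurable_fun setT f -> measurable_fun setT g ->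
  (forall x, 0 <= f x) -> (forall x, 0 <= g x) -> (forall x, g (- x)%R = g x) ->
  \int[gauss]_x (sym f x * g x) = \int[gauss]_x (f x * g x).
Proof.
move=> mf mg f0 g0 gN.
under eq_integral => x _.
  rewrite /sym ge0_muleDl; [|by nneg|by nneg].
  rewrite -!muleA -[X in _ * (f (- x)%R * X)]gN; over.
rewrite ge0_integralTD; [|by meas|by meas|by nneg|by nneg].
rewrite !ge0_integralTZl//; try by [meas|nneg].
rewrite (@gaussN _ (fun x => f x * g x)); [|by meas|by nneg].
by rewrite -ge0_muleDl// -EFinD -splitr mul1e.
Qed.

(** Writing u as the square of a normal variable exhibits the density of L; this density is even, so
    it absorbs the symmetrization. *)
Lemma mixture_density k a (rho2 : R) f : 0 < a ->
  measurable_fun setT f -> (forall x, 0 <= f x) ->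
  accept_prob k.+1 a * \int[mixture_prob k.+1 a rho2]_x f x =
  \int[gauss]_x (smooth (Num.sqrt rho2) (Num.sqrt (1 - rho2)) f x *
                 section_prob k a x).
Proof.
move=> a0 mf f0; rewrite (mixture_sections _ _ a0 mf f0); set Pf := smooth _ _ f.
have mPf : measurable_fun setT Pf by exact: measurable_smooth.
have Pf0 x : 0 <= Pf x by exact: smooth_ge0.
have ms := measurable_sym mPf.
have s0 x : 0 <= sym Pf x by exact: sym_ge0.
rewrite integral_chi2_1; [|by meas|by nneg].
transitivity (\int[gauss]_x (sym Pf x * section_prob k a x)).
  by apply: eq_integral => x _; rewrite sqrtr_sqr sym_norm.
apply: gauss_sym => //.
- exact: measurable_section_prob.
- exact: section_prob_ge0.
- by move=> x; exact: even_antitoneN (@section_prob_even_antitone k a).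
Qed.

Lemma integral_section_prob k a : 0 < a ->
  \int[gauss]_x section_prob k a x = accept_prob k.+1 a.
Proof.
move=> a0; have := @mixture_density k a 0%R (fun=> 1) a0 (measurable_cst _) (fun=> lee01).
rewrite integral_cstP mule1 => ->; apply: eq_integral => x _.
by rewrite /smooth integral_cstP mul1e.
Qed.

End mixture.

(** * Symmetry of the mixture and its conditional form *)

Section monotonicity.
Context {R : realType}.
Implicit Types (k m : nat) (a : \bar R) (f g : R -> \bar R) (t x : R).

Lemma cdf_integral (P : probability (measurableTypeR R) R) t :
  P `]-oo, t]%classic = \int[P]_x ind (x <= t)%R.
Proof.
rewrite integral_ind; last by meas.
by congr (P _); apply/seteqP; split => x /=; rewrite in_itv.
Qed.

Definition below t x : \bar R := ind (x <= t)%R.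

Lemma measurable_below t : measurable_fun setT (below t).
Proof. by rewrite /below; meas. Qed.

Lemma below_ge0 t x : 0 <= below t x.
Proof. exact: ind_ge0. Qed.

(** For t >= 0 the events x <= t and -x <= t cannot both fail. The even part of the half-line
    indicator is thus 1 on [-t, t] and 1/2 outside, an even antitone function. *)
Lemma sym_below t x : (0 <= t)%R ->
  sym (below t) x = if (`|x| <= t)%R then 1 else (1 / 2)%:E.
Proof.
move=> t0; rewrite /sym /below ler_norml [(- t <= x)%R]lerNl.
have [xt|xt] := leP x t; have [nxt|nxt] := leP (- x)%R t => /=.
- by rewrite indT !mule1 -EFinD -splitr.
- by rewrite indT indF mule1 mule0 adde0.
- by rewrite indT indF mule1 mule0 add0e.
- by exfalso; lra.
Qed.

Lemma sym_below_even_antitone t : (0 <= t)%R -> even_antitone (sym (below t)).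
Proof.
move=> t0 x y xy; rewrite !sym_below//.
case: (leP `|y|%R t) => yt; first by rewrite (le_trans xy yt).
by case: ifP => // _; rewrite lee_fin; lra.
Qed.

(** Self-adjointness of [smooth] moves the noise from the test function to the density of L: the
    smoothed [section_prob] is the density of W with respect to N(0, 1), up to the acceptance
    probability. *)
Lemma mixture_ac k a (rho2 : R) f : 0 < a -> (0 <= rho2 <= 1)%R ->
  measurable_fun setT f -> (forall x, 0 <= f x) ->
  accept_prob k.+1 a * \int[mixture_prob k.+1 a rho2]_x f x =
  \int[gauss]_x (f x *
    smooth (Num.sqrt rho2) (Num.sqrt (1 - rho2)) (section_prob k a) x).
Proof.
move=> a0 /andP[r0 r1] mf f0; rewrite mixture_density//.
have mG := @measurable_section_prob R k a.
have G0 := section_prob_ge0 k a.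
transitivity (\int[gauss]_x \int[gauss]_e
  (f (Num.sqrt rho2 * x + Num.sqrt (1 - rho2) * e)%R * section_prob k a x)).
  by apply: eq_integral => x _; rewrite ge0_integralTZr//; meas.
pose F (x y : R) := f y * section_prob k a x.
have mF : measurable_fun setT (fun z => F z.1 z.2) by rewrite /F; meas.
rewrite (@gauss_reversible _ _ _ F)//.
- by apply: eq_integral => x _; rewrite /F ge0_integralTZl//; meas.
- by rewrite !sqr_sqrtr// ?subr_ge0//; ring.
- by move=> x y; rewrite /F mule_ge0.
Qed.

Lemma mixture_sym k a (rho2 : R) f : 0 < a -> (0 <= rho2 <= 1)%R ->
  measurable_fun setT f -> (forall x, 0 <= f x) ->
  \int[mixture_prob k.+1 a rho2]_x sym f x = \int[mixture_prob k.+1 a rho2]_x f x.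
Proof.
move=> a0 r01 mf f0.
have mG := @measurable_section_prob R k a.
have G0 := section_prob_ge0 k a.
have ms := measurable_sym mf; have s0 x : 0 <= sym f x by exact: sym_ge0.
have : accept_prob k.+1 a * \int[mixture_prob k.+1 a rho2]_x sym f x =
    accept_prob k.+1 a * \int[mixture_prob k.+1 a rho2]_x f x.
  rewrite (mixture_ac _ a0 r01 ms s0) (mixture_ac _ a0 r01 mf f0).
  set g := smooth _ _ (section_prob k a).
  apply: (@gauss_sym R f g mf) => [|//|x|x].
  - exact: measurable_smooth.
  - exact: smooth_ge0.
  - apply: smoothN => // y.
    exact: even_antitoneN (@section_prob_even_antitone _ k a).
have p0 := @accept_prob_gt0 R k a a0; have pf := @accept_prob_fin_num R k.+1 a.
by move=> /eqP; rewrite eq_le !lee_pmul2l// -eq_le => /eqP.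
Qed.

(** Symmetry of the law gives the total 1 + P(W = t); the density from [mixture_ac] makes the atom
    null. *)
Lemma mixture_symmetric k a (rho2 t : R) : 0 < a -> (0 <= rho2 <= 1)%R ->
  mixture_prob k.+1 a rho2 `]-oo, (- t)%R]%classic +
  mixture_prob k.+1 a rho2 `]-oo, t]%classic = 1.
Proof.
move=> a0 r01; set P := mixture_prob _ _ _.
have mG := @measurable_section_prob R k a.
have G0 := section_prob_ge0 k a.
have mp := @measurable_phi R.
set g := smooth (Num.sqrt rho2) (Num.sqrt (1 - rho2)) (section_prob k a).
have mg : measurable_fun setT g by exact: measurable_smooth.
have g0 x : 0 <= g x by exact: smooth_ge0.
have gN x : g (- x)%R = g x.
  by apply: smoothN => // y; exact: even_antitoneN (@section_prob_even_antitone _ k a).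
have p0 := @accept_prob_gt0 R k a a0; have pf := @accept_prob_fin_num R k.+1 a.
suff : accept_prob k.+1 a * (P `]-oo, (- t)%R]%classic + P `]-oo, t]%classic) =
    accept_prob k.+1 a * 1.
  by move=> /eqP; rewrite eq_le !lee_pmul2l// -eq_le => /eqP.
have E1 : accept_prob k.+1 a * 1 = \int[gauss]_x g x.
  rewrite -[X in _ * X](integral_cstP P).
  rewrite (mixture_ac _ a0 r01 (measurable_cst 1) (fun=> lee01)).
  by apply: eq_integral => x _; rewrite mul1e.
have E2 u : accept_prob k.+1 a * P `]-oo, u]%classic =
    \int[gauss]_x (ind (x <= u)%R * g x).
  rewrite cdf_integral.
  by rewrite (mixture_ac _ a0 r01 (measurable_below u) (below_ge0 u)).
rewrite E1 ge0_muleDr; [|exact: measure_ge0|exact: measure_ge0].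
have mb u : measurable_fun setT (fun x => ind (x <= u)%R * g x) by meas.
have b0 u x : 0 <= ind (x <= u)%R * g x by nneg.
have sumE (x y x' y' : \bar R) : x = x' -> y = y' -> x + y = x' + y' by move=> -> ->.
rewrite (sumE _ _ _ _ (E2 (- t)%R) (E2 t)).
rewrite -[X in X + _](gaussN (mb (- t)%R) (b0 (- t)%R)).
have mi : measurable_fun setT (fun x => ind (x == t) : \bar R).
  by apply: measurable_ind; exact: measurable_fun_eqr.
have Z : \int[gauss]_x (g x * ind (x == t)) = 0.
  rewrite integral_gauss; [|by meas|by nneg].
  rewrite -[RHS](@integral_ind_eq _ (fun x => g x * (phi x)%:E) t); last by meas.
  by apply: eq_integral => x _; rewrite muleAC.
rewrite -ge0_integralTD; [|by meas|by meas|by nneg|by nneg].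
rewrite -[RHS]adde0 -Z -ge0_integralTD; [|by []|by meas|by []|by nneg].
apply: eq_integral => x _; rewrite gN lerN2.
by case: ltgtP => _; rewrite ?indT ?indF ?mul0e ?mul1e ?mule0 ?mule1 ?adde0 ?add0e.
Qed.

Lemma mixture_below k a (rho2 t : R) : 0 < a -> (0 <= rho2 <= 1)%R ->
  mixture_prob k.+1 a rho2 `]-oo, t]%classic =
  \int[mixture_prob k.+1 a rho2]_x sym (below t) x.
Proof.
move=> a0 r01; rewrite cdf_integral.
by rewrite (mixture_sym _ a0 r01 (measurable_below t) (below_ge0 t)).
Qed.

(* [E[f(L) | chi_K^2 = s]] for an even function [f]. *)
Definition radial_mean k f (s : R) : \bar R :=
  \int[betaK_prob k]_b f (Num.sqrt s * Num.sqrt b)%R.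

Lemma radial_mean_antitone k f : measurable_fun setT f -> (forall x, 0 <= f x) ->
  even_antitone f ->
  forall s s' : R, (s <= s')%R -> radial_mean k f s' <= radial_mean k f s.
Proof.
move=> mf f0 ef s s' ss'; apply: ge0_le_integralT => //; [by meas|by meas|] => b.
apply: ef; rewrite !ger0_norm ?mulr_ge0 ?sqrtr_ge0//.
by rewrite ler_wpM2r ?sqrtr_ge0// ler_wsqrtr.
Qed.

(* [chi_{K+m}^2] is the sum of [chi_K^2] and of an independent [chi_m^2], and
   [L] depends on it through the former only. *)
Lemma mixture_radial k m a (rho2 : R) f : 0 < a ->
  measurable_fun setT f -> (forall x, 0 <= f x) ->
  accept_prob (k + m).+1 a * \int[mixture_prob (k + m).+1 a rho2]_x f x =
  \int[chi2_prob k.+1]_s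
    (radial_mean k.+1 (sym (smooth (Num.sqrt rho2) (Num.sqrt (1 - rho2)) f)) s *
     \int[chi2_prob0 m]_w ind ((s + w)%:E <= a)).
Proof.
move=> a0 mf f0; rewrite (mixture_sections _ _ a0 mf f0); set Pf := smooth _ _ f.
have mPf : measurable_fun setT Pf by exact: measurable_smooth.
have Pf0 x : 0 <= Pf x by exact: smooth_ge0.
have ms := measurable_sym mPf.
have s0 x : 0 <= sym Pf x by exact: sym_ge0.
pose kap (s : R) : \bar R := \int[chi2_prob0 m]_w ind ((s + w)%:E <= a).
have mk : measurable_fun setT kap by rewrite /kap; meas.
have k0 s : 0 <= kap s by apply: integral_ge0 => w _; exact: ind_ge0.
pose F (u s : R) := sym Pf (Num.sqrt u) * kap s.
have mF : measurable_fun setT (fun z => F z.1 z.2) by rewrite /F; meas.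
have F0 u s : 0 <= F u s by rewrite /F; nneg.
(* The chi-squared variable with k + m degrees of freedom is split, and [chi2_betaK] read backwards
   reassembles the first k + 1 squares into s. *)
transitivity (\int[chi2_prob 1]_u \int[chi2_prob0 k]_w F u (u + w)%R).
  apply: eq_integral => u _; rewrite /F ge0_integralTZl//; last by meas.
  congr (_ * _); rewrite chi2_convolution; [|by meas|by nneg].
  apply: eq_integral => w _; apply: eq_integral => w' _.
  by rewrite addrA.
apply: etrans (esym (@chi2_betaK R k F mF F0)) _; rewrite /radial_mean; apply: eq_integral_chi2.
- by meas.
- by meas.
- by nneg.
- by nneg.
move=> s sp; rewrite -ge0_integralTZr; [|by meas|by nneg|exact: k0].
by apply: eq_integral => b _; rewrite /F sqrtrM ?(ltW sp).
Qed.

End monotonicity.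

(** * Monotonicity of the distribution function *)

Section cdf_monotone.
Context {R : realType}.
Implicit Types (k m : nat) (a : \bar R) (f g : R -> \bar R) (t x : R).

Lemma smooth_bounds (r c : R) f (l u : \bar R) x : measurable_fun setT f ->
  0 <= l -> (forall x, l <= f x <= u) -> l <= smooth r c f x <= u.
Proof.
move=> mf l0 fb; have f0 y : 0 <= f y by case/andP: (fb y) => + _; exact: le_trans.
apply/andP; split.
  rewrite -[leLHS](integral_cstP gauss).
  apply: ge0_le_integralT; [exact: measurable_cst|by meas|by []|].
  by move=> y; case/andP: (fb (r * x + c * y)%R).
rewrite -[leRHS](integral_cstP gauss).
apply: ge0_le_integralT; [by meas|exact: measurable_cst|by move=> y; exact: f0|].
by move=> y; case/andP: (fb (r * x + c * y)%R).
Qed.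

Lemma lee_accept_prob k a (x y : \bar R) : 0 < a ->
  (accept_prob k.+1 a * x <= accept_prob k.+1 a * y) = (x <= y).
Proof.
by move=> a0; rewrite lee_pmul2l ?accept_prob_fin_num ?accept_prob_gt0.
Qed.

Lemma accept_prob_le k a a' : a <= a' -> accept_prob k a <= accept_prob k a'.
Proof.
move=> aa'; rewrite !accept_probE; apply: ge0_le_integralT; [by meas|by meas|by nneg|].
by move=> s; apply: ind_le => /le_trans; exact.
Qed.

Lemma eq_lee (x y x' y' : \bar R) : x = x' -> y = y' -> x' <= y' -> x <= y.
Proof. by move=> -> ->. Qed.

Variables (rho2 t : R).
Hypotheses (r01 : (0 <= rho2 <= 1)%R) (t0 : (0 <= t)%R).

Let f := sym (below t).
Let g := sym (smooth (Num.sqrt rho2) (Num.sqrt (1 - rho2)) f).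

Let mf : measurable_fun setT f.
Proof. by apply: measurable_sym; exact: measurable_below. Qed.

Let f0 x : 0 <= f x. Proof. by apply: sym_ge0 => y; exact: below_ge0. Qed.

Let f1 x : (1 / 2)%:E <= f x <= 1.
Proof. by rewrite /f sym_below//; case: ifP => _; rewrite !lee_fin; apply/andP; split; lra. Qed.

Let ms : measurable_fun setT (smooth (Num.sqrt rho2) (Num.sqrt (1 - rho2)) f).
Proof. exact: measurable_smooth. Qed.

Let s0 x : 0 <= smooth (Num.sqrt rho2) (Num.sqrt (1 - rho2)) f x.
Proof. exact: smooth_ge0. Qed.

Let es : even_antitone (smooth (Num.sqrt rho2) (Num.sqrt (1 - rho2)) f).
Proof.
apply: smooth_even_antitone => //; rewrite ?sqrtr_ge0//.
exact: sym_below_even_antitone.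
Qed.

Let gE : g = smooth (Num.sqrt rho2) (Num.sqrt (1 - rho2)) f.
Proof. by apply/funext => x; exact: sym_even_antitone. Qed.

Let mg : measurable_fun setT g. Proof. by rewrite gE. Qed.

Let g0 x : 0 <= g x. Proof. by rewrite gE. Qed.

Let g1 x : g x <= 1.
Proof.
rewrite gE; apply: (proj2 (andP (@smooth_bounds _ _ f (1 / 2)%:E 1 x mf _ f1))).
by rewrite lee_fin; lra.
Qed.

Let eg : even_antitone g. Proof. by rewrite gE. Qed.

Let h k := radial_mean k.+1 g.

Let mh k : measurable_fun setT (h k).
Proof. by rewrite /h /radial_mean; meas. Qed.

Let h0 k s : 0 <= h k s. Proof. by rewrite /h /radial_mean; nneg. Qed.

Let h1 k s : h k s <= 1.
Proof.
rewrite -[leRHS](integral_cstP (betaK_prob k.+1)).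
by apply: ge0_le_integralT => //; meas.
Qed.

Let hy k s : 0 <= h k s < +oo.
Proof. by rewrite h0 (le_lt_trans (h1 k s))// ltry. Qed.

Let cdfE k a : 0 < a ->
  accept_prob k.+1 a * mixture_prob k.+1 a rho2 `]-oo, t]%classic =
  \int[chi2_prob k.+1]_s (h k s * ind (s%:E <= a)).
Proof.
move=> a0; rewrite (mixture_below _ _ a0 r01).
exact: mixture_chi2 a0 mf f0.
Qed.

(** Cross-multiplying by the acceptance probabilities p and p' gives the weights p' 1{s <= a} and p
    1{s <= a'} the same mass p p'. As p <= p', the first is the larger exactly on the side s <= a,
    where the conditional probability [h] is at least its value at a. *)
Lemma cdf_antitone_threshold k a a' : 0 < a -> a <= a' ->
  mixture_prob k.+1 a' rho2 `]-oo, t]%classic <=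
  mixture_prob k.+1 a rho2 `]-oo, t]%classic.
Proof.
move=> a0 aa'; have a'0 := lt_le_trans a0 aa'.
have [a'a|a'a] := eqVneq a' a; first by rewrite a'a lexx.
case: a a0 aa' a'a => [r a0 aa' _|_ aa' a'a|a0 _ _]; last 2 first.
- by exfalso; move: a'a; rewrite -leye_eq aa'.
- by exfalso; move: a0; rewrite ltNge leNye.
set p := accept_prob k.+1 r%:E; set p' := accept_prob k.+1 a'.
have p0 : 0 <= p by rewrite ltW// accept_prob_gt0.
have p'0 : 0 <= p' by rewrite ltW// accept_prob_gt0.
have pp' : p <= p' by exact: accept_prob_le.
have mi b : measurable_fun setT (fun s : R => ind (s%:E <= b) : \bar R) by meas.
have ge b (q : \bar R) s : 0 <= q -> 0 <= q * ind (s%:E <= b).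
  by move=> q0; rewrite mule_ge0// ind_ge0.
have mh' := mh k; have h0' := h0 k.
rewrite -(lee_accept_prob k _ _ a'0) -(lee_accept_prob k _ _ a0) [leRHS]muleCA.
rewrite (cdfE _ a0) (cdfE _ a'0) -/p -/p'.
rewrite -ge0_integralTZl; [|by meas|by nneg|by []].
rewrite -ge0_integralTZl; [|by meas|by nneg|by []].
under eq_integral do rewrite muleCA.
under [leRHS]eq_integral do rewrite muleCA.
have I1 : \int[chi2_prob k.+1]_s (p' * ind (s%:E <= r%:E)) = p' * p.
  by rewrite ge0_integralTZl; [rewrite /p accept_probE|by meas|by nneg|by []].
have I2 : \int[chi2_prob k.+1]_s (p * ind (s%:E <= a')) = p' * p.
  by rewrite ge0_integralTZl; [rewrite /p' accept_probE muleC|by meas|by nneg|by []].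
have fin : p' * p < +oo.
  by rewrite -ge0_fin_numE ?mule_ge0// fin_numM// accept_prob_fin_num.
apply: (@neyman_pearson R _ (measurableTypeR R) (chi2_prob k.+1) (h k)
  (fun s => p' * ind (s%:E <= r%:E)) (fun s => p * ind (s%:E <= a')) (h k r)).
- exact: mh.
- by meas.
- by meas.
- exact: h0.
- by move=> s; exact: ge.
- by move=> s; exact: ge.
- exact: hy.
- by rewrite I2.
- by rewrite I1 I2.
- move=> s; rewrite lee_fin; have [sr|rs] := leP s r; [left|right].
    split; first exact: radial_mean_antitone.
    by rewrite indT mule1; apply: le_trans pp'; rewrite -[leRHS]mule1 lee_wpmul2l ?ind_le1.
  split; first by apply: radial_mean_antitone => //; exact: ltW.
  by rewrite indF mule0; exact: ge.
Qed.

(** In dimension k + m + 1 the indicator of s <= a is replaced by kap(s) = P(s + w <= a'), with w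
    chi-squared with m degrees of freedom. It takes values in [0, 1] and, by equality of the
    acceptance probabilities, has the same mass as the indicator, which is therefore the optimal
    test. *)
Lemma cdf_antitone_dim k m a a' : 0 < a -> 0 < a' ->
  accept_prob (k + m).+1 a' = accept_prob k.+1 a ->
  mixture_prob (k + m).+1 a' rho2 `]-oo, t]%classic <=
  mixture_prob k.+1 a rho2 `]-oo, t]%classic.
Proof.
move=> a0 a'0 pE.
pose kap (s : R) : \bar R := \int[chi2_prob0 m]_w ind ((s + w)%:E <= a').
have mk : measurable_fun setT kap by rewrite /kap; meas.
have k0 s : 0 <= kap s by apply: integral_ge0 => w _; exact: ind_ge0.
have k1 s : kap s <= 1.
  rewrite -[leRHS](integral_cstP (chi2_prob0 m)).
  apply: ge0_le_integralT; [by meas|exact: measurable_cst|by nneg|].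
  by move=> w; exact: ind_le1.
have mh' := mh k; have h0' := h0 k.
have I2 : \int[chi2_prob k.+1]_s kap s = accept_prob k.+1 a.
  rewrite -pE -[RHS]mule1 -[X in _ * X](integral_cstP (mixture_prob (k + m).+1 a' rho2)).
  rewrite (mixture_radial k m rho2 a'0 (measurable_cst 1) (fun=> lee01)).
  apply: eq_integral => s _; rewrite -/(kap s) -[LHS]mul1e; congr (_ * _).
  rewrite -[LHS](integral_cstP (betaK_prob k.+1)) /radial_mean.
  apply: eq_integral => b _.
  by rewrite /sym /smooth !integral_cstP !mule1 -EFinD -splitr.
have E1 : accept_prob k.+1 a *
    mixture_prob (k + m).+1 a' rho2 `]-oo, t]%classic =
    \int[chi2_prob k.+1]_s (h k s * kap s).
  rewrite -pE (mixture_below _ _ a'0 r01).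
  by rewrite (mixture_radial k m rho2 a'0 mf f0).
rewrite -(lee_accept_prob k _ _ a0); apply: (@eq_lee _ _ _ _ E1 (cdfE k a0)).
apply: (@neyman_pearson R _ (measurableTypeR R) (chi2_prob k.+1) (h k)
  (* For a = +oo the indicator is constantly 1 and dominates [kap] everywhere, so the cut 0 is
     valid. *)
  (fun s => ind (s%:E <= a)) kap (if a is r%:E then h k r else 0)).
- exact: mh.
- exact: measurable_ind_le.
- exact: mk.
- exact: h0.
- by move=> s; exact: ind_ge0.
- exact: k0.
- by case: a {a0 pE I2 E1} => [r||]; [exact: hy|rewrite lexx ltry|rewrite lexx ltry].
- by rewrite I2 -ge0_fin_numE ?accept_prob_fin_num// ltW// accept_prob_gt0.
- by rewrite I2 accept_probE.
- case: a a0 {pE I2 E1} => [r||] a0 s.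
  + rewrite lee_fin; have [sr|rs] := leP s r; [left|right].
      by split; [exact: radial_mean_antitone|rewrite indT].
    split; first by apply: radial_mean_antitone => //; exact: ltW.
    by rewrite indF.
  + by left; split; [exact: h0|rewrite leey indT].
  + by exfalso; move: a0; rewrite ltNge leNye.
Qed.

(** With s^2 = rho1 / rho2, passing from rho2 to rho1 replaces the test f by [smooth s c f], which
    has the same normal mass. As f takes its upper bound 1 on [-t, t] and its lower bound 1/2
    outside, while smoothing stays within these bounds, f is the optimal test. *)
Lemma cdf_nondecreasing_rho k a (rho1 : R) : 0 < a -> (0 <= rho1 <= rho2)%R ->
  mixture_prob k.+1 a rho1 `]-oo, t]%classic <=
  mixture_prob k.+1 a rho2 `]-oo, t]%classic.
Proof.
move=> a0 /andP[r10 r12]; case/andP: (r01) => r20 r21.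
have r101 : (0 <= rho1 <= 1)%R by rewrite r10 (le_trans r12).
have [rz|rn] := eqVneq rho2 0%R.
  have -> : rho1 = rho2; last exact: lexx.
  by apply/eqP; rewrite eq_le r12 rz r10.
have rp : (0 < rho2)%R by rewrite lt0r rn.
pose s := Num.sqrt (rho1 / rho2); pose c := Num.sqrt (1 - rho1 / rho2).
have q0 : (0 <= rho1 / rho2)%R by rewrite divr_ge0.
have q1 : (rho1 / rho2 <= 1)%R by rewrite ler_pdivrMr// mul1r.
have s2 : (s ^+ 2 = rho1 / rho2)%R by rewrite sqr_sqrtr.
have c2 : (c ^+ 2 = 1 - rho1 / rho2)%R by rewrite sqr_sqrtr// subr_ge0.
have s0' : (0 <= s)%R by exact: sqrtr_ge0.
have c0' : (0 <= c)%R by exact: sqrtr_ge0.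
have mf' : measurable_fun setT (smooth s c f) by exact: measurable_smooth.
have f0' x : 0 <= smooth s c f x by exact: smooth_ge0.
have f1' x : (1 / 2)%:E <= smooth s c f x <= 1.
  by apply: smooth_bounds => //; rewrite lee_fin; lra.
set G := section_prob k a.
have mG : measurable_fun setT G by exact: measurable_section_prob.
have G0 : forall x, 0 <= G x by exact: section_prob_ge0.
set gh := smooth (Num.sqrt rho2) (Num.sqrt (1 - rho2)) G.
have mgh : measurable_fun setT gh by exact: measurable_smooth.
have gh0 x : 0 <= gh x by exact: smooth_ge0.
have egh : even_antitone gh.
  apply: smooth_even_antitone => //; rewrite ?sqrtr_ge0//.
  exact: section_prob_even_antitone.
have E1 : accept_prob k.+1 a * mixture_prob k.+1 a rho1 `]-oo, t]%classic =
    \int[gauss]_x (gh x * smooth s c f x).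
  rewrite (mixture_below _ _ a0 r101) (mixture_density k rho1 a0 mf f0).
  under [RHS]eq_integral do rewrite muleC.
  rewrite -(mixture_ac k a0 r01 mf' f0') (mixture_density k rho2 a0 mf' f0').
  apply: eq_integral => x _; congr (_ * _).
  have -> : Num.sqrt rho1 = (s * Num.sqrt rho2)%R.
    by rewrite -sqrtrM// divfK.
  apply: smooth_rotation; rewrite ?sqrtr_ge0//.
  rewrite !sqr_sqrtr ?subr_ge0//; last exact: le_trans r12 r21.
  by field.
have E2 : accept_prob k.+1 a * mixture_prob k.+1 a rho2 `]-oo, t]%classic =
    \int[gauss]_x (gh x * f x).
  rewrite (mixture_below _ _ a0 r01) (mixture_ac k a0 r01 mf f0).
  by apply: eq_integral => x _; rewrite muleC.
have ghy x : 0 <= gh x < +oo.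
  rewrite gh0/=; apply: (@le_lt_trans _ _ 1); last exact: ltry.
  have G1 y : 0 <= G y <= 1 by rewrite G0 section_prob_le1.
  exact: (proj2 (andP (@smooth_bounds _ _ G 0 1 x mG (lexx _) G1))).
have I : \int[gauss]_x smooth s c f x = \int[gauss]_x f x.
  by apply: gauss_rotation => //; rewrite s2 c2; ring.
rewrite -(lee_accept_prob k _ _ a0); apply: (@eq_lee _ _ _ _ E1 E2).
apply: (@neyman_pearson R _ (measurableTypeR R) gauss gh f (smooth s c f) (gh t)).
- exact: mgh.
- exact: mf.
- exact: mf'.
- exact: gh0.
- exact: f0.
- exact: f0'.
- exact: ghy.
- rewrite I; apply: (@le_lt_trans _ _ 1); last exact: ltry.
  rewrite -[leRHS](integral_cstP gauss); apply: ge0_le_integralT.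
  + exact: mf.
  + exact: measurable_cst.
  + exact: f0.
  + by move=> x; case/andP: (f1 x).
- by rewrite I lexx.
- move=> x; rewrite [f x]sym_below//; case: (leP `|x|%R t) => xt; [left|right].
    split; last by case/andP: (f1' x).
    by apply: egh; rewrite [leRHS]ger0_norm.
  split; last by case/andP: (f1' x).
  by apply: egh; rewrite ger0_norm// ltW.
Qed.

End cdf_monotone.

(** * Single crossing *)

Section log_concavity.
Context {R : realType}.
Notation mu := (@lebesgue_measure R).
Implicit Types (k : nat) (a : \bar R) (v r x y z u : R).

Definition chi2_cdf k v : \bar R := \int[@chi2_prob R k.+1]_s ind (s <= v)%R.

Lemma chi2_cdf_ge0 k v : 0 <= chi2_cdf k v.
Proof. by rewrite /chi2_cdf; nneg. Qed.

Lemma chi2_cdf_le k v v' : (v <= v')%R -> chi2_cdf k v <= chi2_cdf k v'.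
Proof.
move=> vv'; apply: ge0_le_integralT; [by meas|by meas|by nneg|].
by move=> s; apply: ind_le => /le_trans; exact.
Qed.

Lemma chi2_cdf_fin_num k v : chi2_cdf k v \is a fin_num.
Proof.
rewrite ge0_fin_numE ?chi2_cdf_ge0//; apply: (@le_lt_trans _ _ 1); last exact: ltry.
rewrite -[leRHS](integral_cstP (@chi2_prob R k.+1)).
apply: ge0_le_integralT; [by meas|exact: measurable_cst|by nneg|].
by move=> s; exact: ind_le1.
Qed.

Lemma chi2_cdf0 k v : (v <= 0)%R -> chi2_cdf k v = 0.
Proof.
move=> v0; rewrite /chi2_cdf -[RHS](integral_cstP (@chi2_prob R k.+1)).
apply: eq_integral_chi2; [by meas|exact: measurable_cst|by nneg|by []|].
by move=> s s0; rewrite leNgt (le_lt_trans v0 s0).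
Qed.

Lemma gamma_weight_scale (p l x : R) : (0 < l)%R ->
  (gamma_weight p (l * x) * l =
   l `^ p * (expR (- (l - 1) * x / 2) * gamma_weight p x))%R.
Proof.
move=> l0; have [x0|x0] := leP x 0%R.
  by rewrite !gamma_weight0 ?mul0r ?mulr0// pmulr_rle0.
rewrite /gamma_weight mulr_gt0// x0 powRM ?ltW//.
have -> : (l `^ p = l `^ (p - 1) * l)%R.
  rewrite -{3}(powRr1 (ltW l0)) -powRD; last by rewrite (gt_eqF l0) implybT.
  by congr (_ `^ _)%R; ring.
have -> : (expR (- (l * x) / 2) = expR (- (l - 1) * x / 2) * expR (- x / 2))%R.
  by rewrite -expRD; congr expR; field.
by ring.
Qed.

Lemma chi2_cdf_scale k (l v : R) : (0 < l)%R ->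
  chi2_cdf k (l * v) = (l `^ (k.+1%:R / 2))%:E *
    \int[@chi2_prob R k.+1]_s ((expR (- (l - 1) * s / 2))%:E * ind (s <= v)%R).
Proof.
move=> l0; set p : R := (k.+1%:R / 2)%R.
have mw := @measurable_gamma_weight R p.
have w0 s : (0 <= gamma_weight p s)%R by exact: gamma_weight_ge0.
have me : measurable_fun setT (fun s : R => expR (- (l - 1) * s / 2)) by meas.
rewrite /chi2_cdf integral_chi2; [|by meas|by nneg].
rewrite integral_chi2; [|by meas|by nneg].
rewrite muleCA; congr (_ * _); rewrite -/p.
rewrite -[LHS](@integral_affine _ l 0)%R; [|by rewrite gt_eqF|by meas|by nneg].
rewrite gtr0_norm// -ge0_integralTZr; [|by meas|by nneg|by rewrite lee_fin ltW].
rewrite -ge0_integralTZl; [|by meas|by nneg|by rewrite lee_fin powR_ge0].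
apply: eq_integral => s _; rewrite addr0 ler_pM2l// -muleA -EFinM.
rewrite gamma_weight_scale// 2!EFinM muleCA; congr (_ * _).
by rewrite EFinM [LHS]muleCA muleA.
Qed.

(** By [chi2_cdf_scale], the ratio of the values at l v and v is, up to a constant, the mean of
    exp(-(l - 1) s / 2) given s <= v; for l >= 1 a decreasing function is averaged over a growing
    interval. *)
Lemma chi2_cdf_ratio k (l v v' : R) : (1 <= l)%R -> (v <= v')%R ->
  chi2_cdf k v * chi2_cdf k (l * v') <= chi2_cdf k (l * v) * chi2_cdf k v'.
Proof.
move=> l1 vv'; have l0 : (0 < l)%R by apply: lt_le_trans l1.
rewrite !chi2_cdf_scale//; set q : R := (l `^ _)%R.
have q0 : (0 <= q)%R by exact: powR_ge0.
rewrite muleCA -[leRHS]muleA; apply: lee_wpmul2l; first by rewrite lee_fin.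
pose h (s : R) := (expR (- (l - 1) * s / 2))%:E.
have mh : measurable_fun setT h by rewrite /h; meas.
have h0 s : 0 <= h s by rewrite /h; nneg.
have hl s s' : (s <= s')%R -> h s' <= h s.
  by move=> ss'; rewrite lee_fin ler_expR ler_pM2r//; nra.
have c0 := chi2_cdf_ge0 k.
rewrite -ge0_integralTZl; [|by meas|by nneg|exact: c0].
rewrite -ge0_integralTZr; [|by meas|by nneg|exact: c0].
under eq_integral do rewrite muleCA.
under [leRHS]eq_integral do rewrite -muleA.
apply: (@neyman_pearson R _ (measurableTypeR R) (chi2_prob k.+1) h
  (fun s => ind (s <= v)%R * chi2_cdf k v')
  (fun s => chi2_cdf k v * ind (s <= v')%R) (h v)).
- exact: mh.
- by meas.
- by meas.
- exact: h0.
- by nneg; exact: c0.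
- by nneg; exact: c0.
- by rewrite h0 ltry.
- rewrite ge0_integralTZl; [|by meas|by nneg|exact: c0].
  rewrite -/(chi2_cdf k v') -ge0_fin_numE ?mule_ge0//.
  by rewrite fin_numM// chi2_cdf_fin_num.
- rewrite ge0_integralTZl; [|by meas|by nneg|exact: c0].
  rewrite ge0_integralTZr; [|by meas|by nneg|exact: c0].
  exact: lexx.
- move=> s; have [sv|vs] := leP s v; [left|right].
    split; first exact: hl.
    by rewrite (le_trans sv vv') indT mule1 mul1e; exact: chi2_cdf_le.
  split; first by apply: hl; exact: ltW.
  by rewrite indF mul0e mule_ge0 ?ind_ge0.
Qed.

(** With l the square root of v' / v, the points v, l v, l^2 v = v' are in geometric progression,
    and [chi2_cdf_ratio] compares the two successive ratios. *)
Lemma chi2_cdf_log_concave k v v' : (0 <= v)%R -> (0 <= v')%R ->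
  chi2_cdf k v * chi2_cdf k v' <=
  chi2_cdf k (Num.sqrt (v * v')) * chi2_cdf k (Num.sqrt (v * v')).
Proof.
wlog vv' : v v' / (v <= v')%R.
  move=> H v0 v'0; have [vv'|v'v] := leP v v'; first exact: H.
  by rewrite muleC mulrC; apply: H => //; exact: ltW.
move=> v0 v'0; have [->|vn] := eqVneq v 0%R.
  by rewrite chi2_cdf0// mul0e mule_ge0// chi2_cdf_ge0.
have vp : (0 < v)%R by rewrite lt0r vn.
pose l := Num.sqrt (v' / v).
have l1 : (1 <= l)%R by rewrite -sqrtr1 ler_sqrt ?divr_ge0// ler_pdivlMr// mul1r.
have E1 : Num.sqrt (v * v') = (l * v)%R.
  transitivity (l * Num.sqrt (v ^+ 2))%R; last by rewrite sqrtr_sqr ger0_norm.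
  by rewrite -sqrtrM ?divr_ge0//; congr Num.sqrt; field.
have E2 : (l * (l * v) = v')%R.
  by rewrite mulrA -expr2 sqr_sqrtr ?divr_ge0// divfK.
rewrite E1 -{1}E2; apply: chi2_cdf_ratio => //.
by rewrite ler_peMl.
Qed.

Lemma section_probE k r x :
  section_prob k.+1 r%:E x = chi2_cdf k (r - x ^+ 2).
Proof.
by apply: eq_integral => w _; rewrite lee_fin lerBrDl.
Qed.

Lemma section_prob0E r x : section_prob 0 r%:E x = ind (x ^+ 2 <= r)%R.
Proof.
by rewrite /section_prob /= integral_diracT ?addr0 ?lee_fin//; meas.
Qed.

(** The geometric mean of r - x^2 and r - z^2 is at most their arithmetic mean, which is at most r -
    m^2 at the midpoint m. For k = 0 the function is the indicator of an interval. *)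
Lemma section_prob_log_concave k r x z :
  section_prob k r%:E x * section_prob k r%:E z <=
  section_prob k r%:E ((x + z) / 2) * section_prob k r%:E ((x + z) / 2).
Proof.
pose m := ((x + z) / 2)%R; rewrite -/m.
have mE : (m ^+ 2 <= (x ^+ 2 + z ^+ 2) / 2)%R.
  by have := sqr_ge0 (x - z); rewrite /m; nra.
case: k => [|k].
  rewrite !section_prob0E; have [xr|xr] := leP (x ^+ 2)%R r; last first.
    by rewrite indF mul0e mule_ge0 ?ind_ge0.
  have [zr|zr] := leP (z ^+ 2)%R r; last by rewrite indF mule0 mule_ge0 ?ind_ge0.
  by have -> : (m ^+ 2 <= r)%R by lra.
rewrite !section_probE; have c0 := chi2_cdf_ge0 k.
have [xr|xr] := leP (r - x ^+ 2)%R 0%R; first by rewrite (chi2_cdf0 _ xr) mul0e mule_ge0.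
have [zr|zr] := leP (r - z ^+ 2)%R 0%R; first by rewrite (chi2_cdf0 _ zr) mule0 mule_ge0.
apply: le_trans (chi2_cdf_log_concave _ (ltW xr) (ltW zr)) _.
suff H : (Num.sqrt ((r - x ^+ 2) * (r - z ^+ 2)) <= r - m ^+ 2)%R.
  by apply: lee_pmul => //; exact: chi2_cdf_le.
have rm : (0 <= r - m ^+ 2)%R by lra.
rewrite -[leRHS](ger0_norm rm) -sqrtr_sqr ler_wsqrtr//.
have := sqr_ge0 (x ^+ 2 - z ^+ 2); nra.
Qed.

Lemma section_prob_fin_num k a x : section_prob k a x \is a fin_num.
Proof.
rewrite ge0_fin_numE ?section_prob_ge0//.
by apply: (le_lt_trans (section_prob_le1 k a x)); exact: ltry.
Qed.

(* The infimum [i] of the tilted density [g u * exp (d u)] over [x, z] satisfies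
   [i ^ 2 >= kap * i], by midpoint log-concavity with one endpoint at [x] or [z]. *)
Lemma tilted_quasi_concave (g : R -> R) (d kap x y z : R) :
  (forall u v, `|u| <= `|v| -> g v <= g u)%R -> (forall u, 0 <= g u)%R ->
  (forall u v, g u * g v <= g ((u + v) / 2) ^+ 2)%R ->
  (0 < kap)%R -> (x <= y <= z)%R ->
  (kap <= g x * expR (d * x))%R -> (kap <= g z * expR (d * z))%R ->
  (kap <= g y * expR (d * y))%R.
Proof.
move=> ge g0 gl kp /andP[xy yz] kx kz.
pose f u := (g u * expR (d * u))%R.
have f0 u : (0 <= f u)%R by rewrite mulr_ge0 ?expR_ge0.
have fl u v : (f u * f v <= f ((u + v) / 2) ^+ 2)%R.
  rewrite /f exprMn -expRM_natl mulrACA -expRD.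
  have -> : (2%:R * (d * ((u + v) / 2)) = d * u + d * v)%R by field.
  by rewrite ler_pM2r ?expR_gt0.
have pos u : (kap <= f u)%R -> (0 < g u)%R.
  move=> ku; rewrite lt0r g0 andbT; apply/eqP => gu.
  by move: ku; rewrite /f gu mul0r leNgt kp.
have gx := pos _ kx; have gz := pos _ kz.
(* A positive lower bound on [x, z]: g is unimodal and the exponential is monotone, so each factor
   is at least the smaller of its end values. It makes the infimum positive, hence cancellable at
   the end. *)
pose l := (Num.min (g x) (g z) * Num.min (expR (d * x)) (expR (d * z)))%R.
have lp : (0 < l)%R by rewrite mulr_gt0// lt_min ?expR_gt0 ?gx ?gz.
have lf u : (x <= u <= z)%R -> (l <= f u)%R.
  move=> /andP[xu uz]; apply: ler_pM.
  - by rewrite le_min !g0.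
  - by rewrite le_min !expR_ge0.
  - rewrite ge_min; apply/orP; have [u0|u0] := leP 0%R u.
      by right; apply: ge; rewrite !ger0_norm//; lra.
    by left; apply: ge; rewrite !ltr0_norm//; lra.
  - rewrite ge_min !ler_expR; apply/orP; have [d0|d0] := leP 0%R d.
      by left; rewrite ler_wpM2l.
    by right; rewrite ler_wnM2l// ltW.
pose S := [set f u | u in [set u | (x <= u <= z)%R]].
have S0 : S !=set0 by exists (f x), x => //=; rewrite lexx (le_trans xy yz).
have Sl : lbound S l by move=> _ [u /= uxz <-]; exact: lf.
have il : (l <= inf S)%R by exact: lb_le_inf.
have ip : (0 < inf S)%R by exact: lt_le_trans il.
have iS u : (x <= u <= z)%R -> (inf S <= f u)%R.
  by move=> uxz; apply: ge_inf; [exists l|exists u].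
have key u : (x <= u <= z)%R -> (kap * inf S <= f u ^+ 2)%R.
  move=> /andP[xu uz]; have [c|c] := leP (u - x)%R (z - u)%R.
    have -> : u = ((x + (2 * u - x)) / 2)%R by field.
    apply: le_trans (fl _ _); apply: ler_pM => //; first exact: ltW.
      exact: ltW.
    by apply: iS; apply/andP; split; lra.
  have -> : u = ((z + (2 * u - z)) / 2)%R by field.
  apply: le_trans (fl _ _); apply: ler_pM => //; first exact: ltW.
    exact: ltW.
  by apply: iS; apply/andP; split; lra.
have : (Num.sqrt (kap * inf S) <= inf S)%R.
  apply: lb_le_inf => // _ [u /= uxz <-].
  by rewrite -(ger0_norm (f0 u)) -sqrtr_sqr ler_wsqrtr// key.
move=> H; apply: le_trans (iS y _); last by rewrite xy.
have : (kap * inf S <= inf S * inf S)%R.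
  rewrite -expr2 -[leLHS]sqr_sqrtr; last by rewrite mulr_ge0// ltW.
  by rewrite lerXn2r// nnegrE ?sqrtr_ge0// ltW.
by rewrite ler_pM2r.
Qed.

End log_concavity.

(** * Crossing for the truncated coordinate *)

Section single_crossing.
Context {R : realType}.
Notation mu := (@lebesgue_measure R).
Implicit Types (k : nat) (a : \bar R) (d r t x y z u : R).

Definition gauss_cdf t : \bar R := \int[gauss]_x ind (x <= t)%R.

Lemma gauss_cdfE t : gauss `]-oo, t]%classic = gauss_cdf t.
Proof. exact: cdf_integral. Qed.

Lemma gauss_ind_gt0 x y : (x < y)%R -> 0 < \int[gauss]_u ind (x < u < y)%R.
Proof.
move=> xy; have mb : measurable_fun setT (fun u : R => (x < u < y)%R).
  by apply: measurable_and; meas.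
rewrite integral_gauss; [|by apply: measurable_ind|by nneg].
have mp := @measurable_phi R; have mi := measurable_ind (R := R) mb.
apply: (integral_gt0 xy); [by meas|by nneg|] => u ->.
by rewrite mul1e lte_fin phi_gt0.
Qed.

Lemma gauss_cdf_ge0 t : 0 <= gauss_cdf t.
Proof. by rewrite /gauss_cdf; nneg. Qed.

Lemma gauss_cdf_le1 t : gauss_cdf t <= 1.
Proof.
rewrite -[leRHS](integral_cstP (@gauss R)).
apply: ge0_le_integralT; [by meas|exact: measurable_cst|by nneg|].
by move=> s; exact: ind_le1.
Qed.

Lemma gauss_cdf_fin_num t : gauss_cdf t \is a fin_num.
Proof.
rewrite ge0_fin_numE ?gauss_cdf_ge0//.
by apply: (le_lt_trans (gauss_cdf_le1 t)); exact: ltry.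
Qed.

Lemma gauss_cdf_lt x y : (x < y)%R -> gauss_cdf x < gauss_cdf y.
Proof.
move=> xy; have mb : measurable_fun setT (fun u : R => (x < u < y)%R).
  by apply: measurable_and; meas.
have mi := measurable_ind (R := R) mb.
apply: (@lt_le_trans _ _ (gauss_cdf x + \int[gauss]_u ind (x < u < y)%R)).
  by rewrite lteDl ?gauss_cdf_fin_num// gauss_ind_gt0.
rewrite /gauss_cdf -ge0_integralTD; [|by meas|by []|by nneg|by nneg].
apply: ge0_le_integralT; [by meas|by meas|by nneg|] => u.
have [ux|xu] := leP u x.
  by rewrite /= indF adde0 (le_trans ux (ltW xy)).
by rewrite indF add0e; apply: ind_le => /= /ltW.
Qed.

Lemma gauss_cdf_gt0 t : 0 < gauss_cdf t.
Proof.
by apply: le_lt_trans (gauss_cdf_ge0 (t - 1)) (gauss_cdf_lt _); rewrite ltrBlDr ltrDl.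
Qed.

(** Density of N(-d, 1) with respect to N(0, 1), so that Phi(t + d) is the tilted mass of ]-oo,
    t]. *)
Definition tilt d u : R := expR (- d * u - d ^+ 2 / 2).

Lemma gauss_cdf_tilt d t :
  gauss_cdf (t + d) = \int[gauss]_u ((tilt d u)%:E * ind (u <= t)%R).
Proof.
rewrite /gauss_cdf (@gauss_shift _ d); [|by meas|by nneg].
by apply: eq_integral => u _; rewrite lerD2r muleC.
Qed.

Lemma integral_tilt d : \int[gauss]_u (tilt d u)%:E = 1.
Proof.
rewrite -[RHS](integral_cstP (@gauss R)) [RHS](@gauss_shift _ d) //.
  by apply: eq_integral => u _; rewrite mul1e.
Qed.

Section crossing_L.
Variables (k : nat) (r : R).
Hypothesis r0 : (0 < r)%R.

Let G := section_prob k r%:E.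
Let p := @accept_prob R k.+1 r%:E.

Let mG : measurable_fun setT G. Proof. exact: measurable_section_prob. Qed.
Let G0 x : 0 <= G x. Proof. exact: section_prob_ge0. Qed.
Let Gf x : G x \is a fin_num. Proof. exact: section_prob_fin_num. Qed.
Let p0 : 0 < p. Proof. by apply: accept_prob_gt0; rewrite lte_fin. Qed.
Let pf : p \is a fin_num. Proof. exact: accept_prob_fin_num. Qed.

(** The distribution function of L times the acceptance probability. *)
Definition section_cdf x : \bar R := \int[gauss]_u (G u * ind (u <= x)%R).

Lemma section_prob_out u : (r < u ^+ 2)%R -> G u = 0.
Proof.
move=> ru; rewrite /G; case: (k) => [|j].
  by rewrite section_prob0E leNgt ru.
by rewrite section_probE chi2_cdf0// subr_le0 ltW.
Qed.

Let total : \int[gauss]_u G u = p.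
Proof. by rewrite /G integral_section_prob// lte_fin. Qed.

Lemma section_cdf_out_l x : (x < - Num.sqrt r)%R -> section_cdf x = 0.
Proof.
move=> xr; rewrite /section_cdf; apply: integral0_eq => u _.
have [ux|xu] := leP u x; last by rewrite mule0.
rewrite section_prob_out ?mul0e// -(sqr_sqrtr (ltW r0)).
have s0 := sqrtr_ge0 r; nra.
Qed.

Lemma section_cdf_out_r x : (Num.sqrt r <= x)%R -> section_cdf x = p.
Proof.
move=> xr; rewrite -total; apply: eq_integral => u _.
have [ux|xu] := leP u x; first by rewrite mule1.
rewrite section_prob_out ?mul0e// -(sqr_sqrtr (ltW r0)).
have s0 := sqrtr_ge0 r; nra.
Qed.

Lemma section_cdf_le x : section_cdf x <= p.
Proof.
rewrite -total; apply: ge0_le_integralT; [by meas|by meas|by nneg|] => u.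
by rewrite -[leRHS]mule1 lee_wpmul2l// ind_le1.
Qed.

(** Dividing by the exponential turns domination of the tilt into a lower bound on G(u) exp(d u), to
    which [tilted_quasi_concave] applies. *)
Lemma tilt_dominates_convex d x y z : (x <= y <= z)%R ->
  p * (tilt d x)%:E <= G x -> p * (tilt d z)%:E <= G z ->
  p * (tilt d y)%:E <= G y.
Proof.
pose kap : R := (fine p * expR (- (d ^+ 2 / 2)))%R.
have pg : (0 < fine p)%R by rewrite fine_gt0// p0 -ge0_fin_numE// ltW.
have E u : (p * (tilt d u)%:E <= G u) = (kap <= fine (G u) * expR (d * u))%R.
  rewrite -{1}(fineK pf) -{1}(fineK (Gf u)) -EFinM lee_fin.
  rewrite /tilt expRD mulNr [expR (- (d * u))]expRN mulrA mulrAC -/kap.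
  by rewrite ler_pdivrMr ?expR_gt0.
rewrite !E => xyz; apply: (tilted_quasi_concave (g := fun u => fine (G u))) => //.
- move=> u v uv; apply: fine_le; rewrite ?Gf//.
  exact: section_prob_even_antitone.
- by move=> u; rewrite fine_ge0.
- move=> u v; rewrite -lee_fin EFinM expr2 EFinM !fineK ?Gf//.
  exact: section_prob_log_concave.
- by rewrite mulr_gt0 ?expR_gt0.
Qed.

(** The set A where G dominates the tilted density l is an interval. It must meet ]-oo, x],
    otherwise l would have strictly more mass there than G. If A also meets [y,
    +oo[, it contains ]x, y] and the gain of G on ]x, y] is the larger one; if not, l dominates to
    the right of y and the equal total masses reverse the comparison on the left. *)
Lemma single_crossing_section d x y : (x <= y)%R ->
  p * gauss_cdf (x + d) <= section_cdf x -> p * gauss_cdf (y + d) <= section_cdf y.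
Proof.
move=> xy; pose l u := p * (tilt d u)%:E.
have ml : measurable_fun setT l by rewrite /l /tilt; meas.
have l0 u : 0 <= l u by rewrite mule_ge0 ?lee_fin ?expR_ge0// ltW.
have mt : measurable_fun setT (tilt d) by rewrite /tilt; meas.
have lE t : p * gauss_cdf (t + d) = \int[gauss]_u (l u * ind (u <= t)%R).
  rewrite gauss_cdf_tilt -ge0_integralTZl; [|by meas| |exact: ltW]; last first.
    by move=> u; rewrite mule_ge0 ?ind_ge0// lee_fin expR_ge0.
  by apply: eq_integral => u _; rewrite muleA.
have ltot : \int[gauss]_u l u = p.
  rewrite ge0_integralTZl; [by rewrite integral_tilt mule1|by meas| |exact: ltW].
  by move=> u; rewrite lee_fin expR_ge0.
rewrite !lE /section_cdf => Hx.
have split_ (f : R -> \bar R) t : measurable_fun setT f -> (forall u, 0 <= f u) ->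
    \int[gauss]_u f u =
    \int[gauss]_u (f u * ind (u <= t)%R) + \int[gauss]_u (f u * ind (t < u)%R).
  move=> mf f0; rewrite -ge0_integralTD; [|by meas|by meas|by nneg|by nneg].
  apply: eq_integral => u _.
  by case: leP => _; rewrite ?mule1 ?mule0 ?adde0 ?add0e.
have [[e ex le]|nA] := pselect (exists2 e, (e <= x)%R & l e <= G e); last first.
  (* Strictness comes from ]-oo, b], which lies outside the support of G and has positive tilted
     mass. *)
  exfalso; pose b := Num.min x (- Num.sqrt r - 1)%R.
  have bx : (b <= x)%R by rewrite ge_min lexx.
  have Gb u : (u <= b)%R -> G u = 0.
    rewrite le_min => /andP[_ ub]; apply: section_prob_out.
    rewrite -(sqr_sqrtr (ltW r0)); have s0 := sqrtr_ge0 r; nra.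
  have : \int[gauss]_u (G u * ind (u <= x)%R) + p * gauss_cdf (b + d) <=
      \int[gauss]_u (l u * ind (u <= x)%R).
    rewrite lE -ge0_integralTD; [|by meas|by meas|by nneg|by nneg].
    apply: ge0_le_integralT; [by meas|by meas|by nneg|] => u.
    have [ux|xu] := leP u x; last first.
      by rewrite [(u <= b)%R]leNgt (le_lt_trans bx xu) !mule0 adde0.
    rewrite !mule1; have [ub|bu] := leP u b; first by rewrite Gb// add0e mule1.
    rewrite mule0 adde0 ltW// ltNge; apply/negP => lG; apply: nA.
    by exists u.
  move=> /le_trans/(_ Hx); apply/negP; rewrite -ltNge lteDl.
    by rewrite mule_gt0// gauss_cdf_gt0.
  rewrite ge0_fin_numE; last by apply: integral_ge0 => u _; nneg.
  apply: (@le_lt_trans _ _ p); last by rewrite -ge0_fin_numE// ltW.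
  rewrite -total; apply: ge0_le_integralT; [by meas|by meas|by nneg|] => u.
  by rewrite -[leRHS]mule1 lee_wpmul2l// ind_le1.
have [[e' ye' le']|nB] := pselect (exists2 e, (y <= e)%R & l e <= G e).
  have I (f : R -> \bar R) : measurable_fun setT f -> (forall u, 0 <= f u) ->
      \int[gauss]_u (f u * ind (u <= y)%R) = \int[gauss]_u (f u * ind (u <= x)%R) +
      \int[gauss]_u (f u * ind (x < u)%R * ind (u <= y)%R).
    move=> mf f0; rewrite -ge0_integralTD; [|by meas|by meas|by nneg|by nneg].
    apply: eq_integral => u _; case: (leP u x) => ux.
      by rewrite (le_trans ux xy) !mule1 mule0 adde0.
    by rewrite mule0 add0e mule1.
  rewrite (I _ ml l0) (I _ mG G0); apply: leeD => //.
  apply: ge0_le_integralT; [by meas|by meas|by nneg|] => u.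
  case: (leP u x) => ux; first by rewrite !mule0 !mul0e.
  case: (leP u y) => uy; last by rewrite !mule0.
  rewrite !mule1; apply: (tilt_dominates_convex (x := e) (z := e')) => //.
  by rewrite (le_trans ex (ltW ux)) (le_trans uy ye').
have H : \int[gauss]_u (G u * ind (y < u)%R) <= \int[gauss]_u (l u * ind (y < u)%R).
  apply: ge0_le_integralT; [by meas|by meas|by nneg|] => u.
  have [uy|yu] := leP u y; first by rewrite !mule0.
  rewrite !mule1 ltW// ltNge; apply/negP => lG; apply: nB.
  by exists u => //; exact: ltW.
have fin : \int[gauss]_u (l u * ind (y < u)%R) \is a fin_num.
  rewrite ge0_fin_numE; last by apply: integral_ge0 => u _; nneg.
  apply: (@le_lt_trans _ _ p); last by rewrite -ge0_fin_numE// ltW.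
  rewrite -ltot; apply: ge0_le_integralT; [by meas|by meas|by nneg|] => u.
  by rewrite -[leRHS]mule1 lee_wpmul2l// ind_le1.
rewrite -(leeD2rE _ _ fin) -(split_ _ y ml l0) ltot -total (split_ _ y mG G0).
exact: leeD2l.
Qed.

End crossing_L.
End single_crossing.

(** * Crossing for the mixture *)

Section mixture_crossing.
Context {R : realType}.
Notation mu := (@lebesgue_measure R).
Implicit Types (k : nat) (a : \bar R) (d r t x y z u : R).

Definition mixture_cdf k a (rho2 t : R) : \bar R :=
  mixture_prob k.+1 a rho2 `]-oo, t]%classic.

Lemma accept_prob_y k : @accept_prob R k.+1 +oo = 1.
Proof.
rewrite accept_probE -[RHS](integral_cstP (@chi2_prob R k.+1)).
by apply: eq_integral => s _; rewrite leey indT.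
Qed.

Lemma section_prob_y k x : section_prob k +oo x = 1.
Proof.
rewrite -[RHS](integral_cstP (@chi2_prob0 R k)).
by apply: eq_integral => s _; rewrite leey indT.
Qed.

Lemma mixture_cdf_y k (rho2 t : R) : (0 <= rho2 <= 1)%R ->
  mixture_cdf k +oo rho2 t = gauss_cdf t.
Proof.
move=> /andP[r0 r1]; rewrite /mixture_cdf -[LHS]mul1e -(accept_prob_y k).
rewrite cdf_integral.
rewrite (mixture_density k rho2 (ltry 0%R) (measurable_below t) (below_ge0 t)).
have rc : (Num.sqrt rho2 ^+ 2 + Num.sqrt (1 - rho2) ^+ 2 = 1)%R.
  by rewrite !sqr_sqrtr ?subr_ge0//; ring.
rewrite /gauss_cdf -(@gauss_rotation _ _ _ (fun x => ind (x <= t)%R)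
  (sqrtr_ge0 _) (sqrtr_ge0 _) rc); [|by meas|by nneg].
by apply: eq_integral => x _; rewrite section_prob_y mule1.
Qed.

Lemma accept_prob_inj k a (x y : \bar R) : 0 < a ->
  accept_prob k.+1 a * x = accept_prob k.+1 a * y -> x = y.
Proof.
move=> a0 /eqP; rewrite eq_le !lee_accept_prob// => xy.
by apply/eqP; rewrite eq_le.
Qed.

Lemma mixture_cdf0 k a t : 0 < a -> mixture_cdf k a 0 t = gauss_cdf t.
Proof.
move=> a0; have E : accept_prob k.+1 a * mixture_cdf k a 0 t =
    accept_prob k.+1 a * gauss_cdf t.
  rewrite /mixture_cdf cdf_integral.
  rewrite (mixture_density k 0 a0 (measurable_below t) (below_ge0 t)).
  rewrite -integral_section_prob// -ge0_integralTZr; last 3 first.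
  - exact: measurable_section_prob.
  - by move=> x; exact: section_prob_ge0.
  - exact: gauss_cdf_ge0.
  apply: eq_integral => x _; rewrite muleC; congr (_ * _).
  rewrite /smooth sqrtr0 subr0 sqrtr1.
  by apply: eq_integral => e _; rewrite mul0r add0r mul1r.
exact: accept_prob_inj a0 E.
Qed.

Lemma gauss_cdf_sym t : gauss_cdf (- t) + gauss_cdf t = 1.
Proof.
have := @mixture_symmetric R 0 +oo 0 t (ltry 0%R).
rewrite -!/(mixture_cdf _ _ _ _) !mixture_cdf0 ?ltry//; apply.
by rewrite lexx ler01.
Qed.

Section crossing.
Variables (k : nat) (r rho2 : R).
Hypotheses (r0 : (0 < r)%R) (rho0 : (0 < rho2)%R) (rho1 : (rho2 <= 1)%R).

Let rho := Num.sqrt rho2.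
Let c := Num.sqrt (1 - rho2).
Let p := @accept_prob R k.+1 r%:E.

Let rp : (0 < rho)%R. Proof. by rewrite sqrtr_gt0. Qed.
Let c0 : (0 <= c)%R. Proof. exact: sqrtr_ge0. Qed.
Let rc : (rho ^+ 2 + c ^+ 2 = 1)%R.
Proof. by rewrite !sqr_sqrtr ?subr_ge0// ?(ltW rho0)//; ring. Qed.
Let r0' : 0 < r%:E. Proof. by rewrite lte_fin. Qed.
Let p0 : 0 <= p. Proof. by rewrite ltW// accept_prob_gt0. Qed.

Let affine_le e x t : (rho * x + c * e <= t)%R = (x <= (t - c * e) / rho)%R.
Proof. by rewrite ler_pdivlMr// lerBrDr mulrC. Qed.

Let mixtureE t : p * mixture_cdf k r%:E rho2 t =
  \int[gauss]_e section_cdf k r ((t - c * e) / rho).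
Proof.
rewrite /mixture_cdf cdf_integral.
rewrite (mixture_density k rho2 r0' (measurable_below t) (below_ge0 t)).
have mG := @measurable_section_prob R k r%:E.
have G0 := @section_prob_ge0 R k r%:E.
transitivity (\int[gauss]_x \int[gauss]_e
    (section_prob k r%:E x * ind (rho * x + c * e <= t)%R)).
  apply: eq_integral => x _; rewrite ge0_integralTZl; [|by meas|by nneg|by []].
  by rewrite muleC.
rewrite tonelli; [|by meas|by nneg].
by apply: eq_integral => e _; apply: eq_integral => x _; rewrite affine_le.
Qed.

(** The normal variable is also split as rho x + c e, so that both distribution functions are
    averages over the same noise e; the shift d becomes d / rho. *)
Let gaussE t d : p * gauss_cdf (t + d) =
  \int[gauss]_e (p * gauss_cdf ((t - c * e) / rho + d / rho)).
Proof.
have mg : measurable_fun setT (fun e => gauss_cdf ((t - c * e) / rho + d / rho)).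
  by rewrite /gauss_cdf; meas.
rewrite ge0_integralTZl; [|by []|by move=> e; exact: gauss_cdf_ge0|exact: p0].
congr (_ * _); rewrite /gauss_cdf.
rewrite -(@gauss_rotation _ rho c (fun x => ind (x <= t + d)%R) c0 (ltW rp) rc);
  [|by meas|by nneg].
rewrite tonelli; [|by meas|by nneg].
apply: eq_integral => e _; apply: eq_integral => x _; congr (ind _).
by rewrite affine_le; congr (_ <= _)%R; field; rewrite gt_eqF.
Qed.

Let mS : measurable_fun setT (section_cdf k r).
Proof.
rewrite /section_cdf; have mG := @measurable_section_prob R k r%:E.
have G0 := @section_prob_ge0 R k r%:E.
by meas.
Qed.

Let S0 x : 0 <= section_cdf k r x.
Proof.
have G0 := @section_prob_ge0 R k r%:E.
by rewrite /section_cdf; nneg.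
Qed.

(** Without noise W = L, which is bounded by the square root of r; this bounds nu(1) from above in
    the counterexample. *)
Lemma mixture_cdf_eq1 : rho2 = 1%R -> mixture_cdf k r%:E rho2 (Num.sqrt r) = 1.
Proof.
move=> re; apply: (accept_prob_inj (k := k) r0').
have r1 : rho = 1%R by rewrite /rho re sqrtr1.
have cz : c = 0%R by rewrite /c re subrr sqrtr0.
rewrite mule1; apply: etrans (mixtureE _) _.
rewrite -[RHS](integral_cstP (@gauss R)); apply: eq_integral => e _.
by rewrite r1 cz mul0r subr0 divr1 section_cdf_out_r.
Qed.

(** L is at least minus the square root of r, so W <= t forces an upper bound on the noise; this
    bounds nu(9/25) from below in the counterexample. *)
Lemma mixture_cdf_le_gauss t : (0 < c)%R ->
  mixture_cdf k r%:E rho2 t <= gauss_cdf ((t + rho * Num.sqrt r) / c).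
Proof.
move=> cp; rewrite -(lee_accept_prob k _ _ r0').
apply: (eq_lee (mixtureE t) (erefl _)).
rewrite /gauss_cdf -ge0_integralTZl; [|by meas|by nneg|exact: p0].
apply: ge0_le_integralT; [by meas|by meas|by move=> e; exact: S0|] => e.
have [le|lt] := leP e ((t + rho * Num.sqrt r) / c)%R.
  by rewrite mule1 section_cdf_le.
rewrite mule0 section_cdf_out_l//; move: lt.
by rewrite ltr_pdivrMr// ltr_pdivrMr// mulNr; nra.
Qed.

(** At fixed noise e the comparison is that of [single_crossing_section] at (t - c e) / rho, so it
    holds for e below some e0 and fails above. Moving t to t' shifts e by h, which reweights the
    noise by the decreasing factor [tilt h] and so favours the side where the comparison holds. *)
Lemma single_crossing_finite d t t' : (t <= t')%R ->
  gauss_cdf (t + d) <= mixture_cdf k r%:E rho2 t ->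
  gauss_cdf (t' + d) <= mixture_cdf k r%:E rho2 t'.
Proof.
move=> tt' H0.
have {H0} : p * gauss_cdf (t + d) <=
    \int[gauss]_e section_cdf k r ((t - c * e) / rho).
  by apply: eq_lee (erefl _) (esym (mixtureE t)) _; rewrite lee_accept_prob.
suff : p * gauss_cdf (t + d) <=
      \int[gauss]_e section_cdf k r ((t - c * e) / rho) ->
    p * gauss_cdf (t' + d) <= \int[gauss]_e section_cdf k r ((t' - c * e) / rho).
  move=> H /H {}H; rewrite -(lee_accept_prob k _ _ r0').
  exact: eq_lee (erefl _) (mixtureE t') H.
have [cz|cn] := eqVneq c 0%R.
  have E u : \int[gauss]_e section_cdf k r ((u - c * e) / rho) = section_cdf k r (u / rho).
    rewrite -[RHS](integral_cstP (@gauss R)); apply: eq_integral => e _.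
    by rewrite cz mul0r subr0.
  have E' u : (u + d = u / rho + d / rho)%R.
    have -> : rho = 1%R; last by field.
    move: rc; rewrite cz expr0n/= addr0 => /eqP.
    by rewrite sqrp_eq1 ?ltW// => /eqP.
  rewrite !E !E'; apply: single_crossing_section => //.
  by rewrite ler_pM2r ?invr_gt0.
have cp : (0 < c)%R by rewrite lt0r cn.
rewrite (gaussE t d) (gaussE t' d).
pose D1 e := section_cdf k r ((t - c * e) / rho).
pose D2 e := p * gauss_cdf ((t - c * e) / rho + d / rho).
pose h := ((t' - t) / c)%R.
have h0 : (0 <= h)%R by rewrite divr_ge0// subr_ge0.
have mD1 : measurable_fun setT D1 by rewrite /D1; meas.
have mD2 : measurable_fun setT D2 by rewrite /D2 /gauss_cdf; meas.
have D10 e : 0 <= D1 e by exact: S0.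
have D20 e : 0 <= D2 e by rewrite mule_ge0// gauss_cdf_ge0.
have chE e : (t' - c * (e + h) = t - c * e)%R by rewrite /h; field.
have sh (D : R -> \bar R) : measurable_fun setT D -> (forall e, 0 <= D e) ->
    \int[gauss]_e D ((t' - c * e) / rho)%R =
    \int[gauss]_e ((tilt h e)%:E * D ((t - c * e) / rho)%R).
  move=> mD D0; rewrite (@gauss_shift _ h); [|by meas|by nneg].
  by apply: eq_integral => e _; rewrite chE muleC.
have mgc : measurable_fun setT (fun u => p * gauss_cdf (u + d / rho)).
  by rewrite /gauss_cdf; meas.
rewrite (sh _ mS S0) (sh _ mgc); last by move=> e; rewrite mule_ge0// gauss_cdf_ge0.
move=> H.
have down e e' : (e' <= e)%R -> D2 e <= D1 e -> D2 e' <= D1 e'.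
  move=> ee'; apply: single_crossing_section => //.
  by rewrite ler_pM2r ?invr_gt0// lerB// ler_pM2l.
pose S := [set e | D2 e <= D1 e].
(* At this e the argument is the right end of the support, where the truncated distribution function
   is full; for large e it lies left of the support, whence the upper bound [Sb]. *)
have Sn : S !=set0.
  exists ((t - rho * Num.sqrt r) / c)%R; rewrite /S/= /D1 /D2.
  rewrite (_ : ((t - c * ((t - rho * Num.sqrt r) / c)) / rho = Num.sqrt r)%R).
    rewrite section_cdf_out_r//.
    by rewrite -[leRHS]mule1 lee_wpmul2l// gauss_cdf_le1.
  by field; rewrite !gt_eqF.
have Sb : has_ubound S.
  exists ((t + rho * (Num.sqrt r + 1)) / c)%R => e /= De.
  rewrite leNgt; apply/negP; rewrite ltr_pdivrMr// => le.
  move: De; rewrite /S/= /D1 /D2 section_cdf_out_l//; last first.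
    rewrite ltr_pdivrMr//; move: le rp; rewrite mulrDr mulr1 [(e * c)%R]mulrC => le rp1.
    by rewrite mulNr [(Num.sqrt r * _)%R]mulrC; lra.
  by apply/negP; rewrite -ltNge mule_gt0 ?gauss_cdf_gt0// accept_prob_gt0.
pose e0 := sup S.
have below_sup e : (e < e0)%R -> D2 e <= D1 e.
  move=> /(sup_gt Sn)[e' Se' ee'].
  exact: down (ltW ee') Se'.
have above_sup e : (e0 < e)%R -> D1 e <= D2 e.
  move=> ee0; rewrite ltW// ltNge; apply/negP => Se.
  by have := ub_le_sup Sb Se; rewrite leNgt ee0.
have tl e e' : (e <= e')%R -> (tilt h e')%:E <= (tilt h e)%:E.
  by move=> ee'; rewrite lee_fin ler_expR; nra.
have mt : measurable_fun setT (tilt h) by rewrite /tilt; meas.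
apply: (@neyman_pearson R _ (measurableTypeR R) gauss (fun e => (tilt h e)%:E)
  D1 D2 (tilt h e0)%:E).
- exact/measurable_EFinP.
- exact: mD1.
- exact: mD2.
- by move=> e; rewrite lee_fin expR_ge0.
- exact: D10.
- exact: D20.
- by rewrite lee_fin expR_ge0 ltry.
- rewrite -gaussE -ge0_fin_numE ?mule_ge0 ?gauss_cdf_ge0//.
  by rewrite fin_numM ?gauss_cdf_fin_num ?accept_prob_fin_num.
- exact: H.
- move=> e; have [ee0|ee0|->] := ltgtP e e0.
  + by left; split; [apply: tl; exact: ltW|exact: below_sup].
  + by right; split; [apply: tl; exact: ltW|exact: above_sup].
  + by case/orP: (le_total (D2 e0) (D1 e0)); [left|right].
Qed.

End crossing.

(** For rho = 0 or a = +oo the mixture is standard normal; as d >= 0 and Phi is strictly increasing,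
    the premise then forces d = 0. *)
Lemma single_crossing k a (rho2 d t t' : R) : 0 < a -> (0 <= rho2 <= 1)%R ->
  (0 <= d)%R -> (t <= t')%R ->
  gauss_cdf (t + d) <= mixture_cdf k a rho2 t ->
  gauss_cdf (t' + d) <= mixture_cdf k a rho2 t'.
Proof.
move=> a0 /andP[r0 r1] d0 tt'.
have trivial : gauss_cdf (t + d) <= gauss_cdf t -> gauss_cdf (t' + d) <= gauss_cdf t'.
  have [->|dn] := eqVneq d 0%R; first by rewrite !addr0.
  by rewrite leNgt gauss_cdf_lt// ltrDl lt0r dn.
have [rz|rn] := eqVneq rho2 0%R; first by rewrite rz !mixture_cdf0.
case: a a0 => [r r0'|_|a0].
- by apply: single_crossing_finite => //; rewrite lt0r rn.
- by rewrite !mixture_cdf_y ?r0.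
- by exfalso; move: a0; rewrite ltNge leNye.
Qed.

End mixture_crossing.

(** * Quantiles *)

Section quantile_theory.
Context {R : realType}.
Variable P : probability (measurableTypeR R) R.

(** The identity as a random variable of law P, to which the limits and right continuity of [cdf]
    apply. *)
Let idR : measurableTypeR R -> R := idfun.

#[local] HB.instance Definition _ :=
  @isMeasurableFun.Build _ _ _ _ idR (@measurable_id _ (measurableTypeR R) setT).

(** The Galois connection between quantile and distribution function: the limits at both infinities
    make the infimum one of a nonempty set bounded below, and right continuity makes it attained. *)
Lemma quantile_le (q x : R) : (0 < q < 1)%R ->
  (quantile P q <= x)%R = (q%:E <= P `]-oo, x]%classic).
Proof.
move=> /andP[q0 q1]; pose F := cdf (P := P) idR.
have FE y : P `]-oo, y]%classic = F y by [].
have Fle : {homo F : x y / (x <= y)%R >-> x <= y} by exact: cdf_nondecreasing.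
pose S := [set y : R | q%:E <= P `]-oo, y]%classic].
have Sn : S !=set0.
  have : \forall y \near +oo%R, q%:E < F y.
    have H : nbhs (1 : \bar R) [set y | q%:E < y].
      by apply: open_ereal_gt'; rewrite lte_fin.
    exact: (@cvg_cdfy1 _ _ _ P idR _ H).
  move=> /(@filter_ex _ _ (@proper_pinfty_nbhs R)) [y qy].
  by exists y; exact: ltW qy.
have [l lF] : exists l, F l < q%:E.
  have : \forall y \near -oo%R, F y < q%:E.
    have H : nbhs (0 : \bar R) [set y | y < q%:E].
      by apply: open_ereal_lt'; rewrite lte_fin.
    exact: (@cvg_cdfNy0 _ _ _ P idR _ H).
  by move=> /(@filter_ex _ _ (@proper_ninfty_nbhs R)).
have Sl : has_lbound S.
  exists l => y /= qy; rewrite leNgt; apply/negP => yl.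
  by move: (qy : q%:E <= F y); rewrite leNgt (le_lt_trans (Fle _ _ (ltW yl)) lF).
apply/idP/idP => [qx|qx]; last exact: ge_inf.
suff : q%:E <= F (quantile P q) by move=> /le_trans; apply; exact: Fle.
rewrite leNgt; apply/negP => Fq.
have : \forall y \near (quantile P q)^'+, F y < q%:E.
  have H : nbhs (F (quantile P q)) [set y | y < q%:E] by exact: open_ereal_lt'.
  exact: (@cdf_right_continuous _ _ _ P idR _ _ H).
move=> near_q.
have : \forall y \near (quantile P q)^'+, (quantile P q < y)%R /\ F y < q%:E.
  apply: filterS2 near_q (nbhs_right_gt (quantile P q)) => y h1 h2; split => //.
move=> /filter_ex[y [qy Fy]].
have [z Sz zy] := inf_lt Sn qy.
by move: (Sz : q%:E <= F z); rewrite leNgt (le_lt_trans (Fle _ _ (ltW zy)) Fy).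
Qed.

End quantile_theory.

Local Close Scope ereal_scope.

Section quantile_symmetry.
Context {R : realType}.
Variables F Q : R -> R.
Hypothesis QE : forall q x, 0 < q < 1 -> (Q q <= x) = (q <= F x).
Hypothesis F_sym : forall x, F (- x) + F x = 1.

(** Otherwise the point y halfway between -Q(q) and Q(1 - q) has F(-y) < q and F(y) < 1 - q, against
    F(-y) + F(y) = 1. *)
Lemma quantileN_le q : 0 < q < 1 -> Q (1 - q) <= - Q q.
Proof.
move=> q01; have q01' : 0 < 1 - q < 1 by lra.
rewrite leNgt; apply/negP => lt; pose y := (Q (1 - q) - Q q) / 2.
have : ~~ (q <= F (- y)) by rewrite -QE// -ltNge /y; lra.
have : ~~ (1 - q <= F y) by rewrite -QE// -ltNge /y; lra.
by rewrite -!ltNge; have := F_sym y; lra.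
Qed.

(* Symmetry of the law excludes atoms outside of 0. *)
Lemma cdf_quantile q : 0 < q < 1 -> F (Q q) = q.
Proof.
move=> q01; have q01' : 0 < 1 - q < 1 by lra.
have : 1 - q <= F (- Q q) by rewrite -QE// quantileN_le.
have : q <= F (Q q) by rewrite -QE.
by have := F_sym (Q q); lra.
Qed.

Lemma cdf_center : F 0 = 1 / 2.
Proof. by have := F_sym 0; rewrite oppr0; lra. Qed.

End quantile_symmetry.

(** * From crossing to quantiles *)

Section dispersion.
Context {R : realType}.
Variables F Phi Q Z : R -> R.
Hypothesis QE : forall q x, 0 < q < 1 -> (Q q <= x) = (q <= F x).
Hypothesis ZE : forall q x, 0 < q < 1 -> (Z q <= x) = (q <= Phi x).
Hypothesis F_sym : forall x, F (- x) + F x = 1.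
Hypothesis Phi_sym : forall x, Phi (- x) + Phi x = 1.
Hypothesis Phi_lt : forall x y, x < y -> Phi x < Phi y.
Hypothesis crossing : forall d x y, 0 <= d -> x <= y ->
  Phi (x + d) <= F x -> Phi (y + d) <= F y.

Let PhiZ := cdf_quantile ZE Phi_sym.
Let FQ := cdf_quantile QE F_sym.

(** Both functions equal 1/2 at 0, where the crossing property with d = 0 starts. *)
Lemma cdf_dominated x : 0 <= x -> Phi x <= F x.
Proof.
move=> x0; rewrite -[x]addr0 -[F _]/(F (x + 0)) [X in F X]addr0.
by apply: crossing x0 _ => //; rewrite addr0 !cdf_center.
Qed.

(** The median could be negative if F were flat around 0; domination by the strictly increasing Phi
    excludes this. *)
Lemma quantile_ge0 q : 1 / 2 <= q < 1 -> 0 <= Q q.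
Proof.
move=> q01; have q01' : 0 < q < 1 by lra.
rewrite leNgt; apply/negP => Q0.
have QN0 : 0 < - Q q by lra.
have := cdf_dominated (ltW QN0); have := Phi_lt QN0; have := FQ q01'.
by have := F_sym (Q q); rewrite (cdf_center Phi_sym); lra.
Qed.

Lemma quantile_dominated q : 1 / 2 <= q < 1 -> Q q <= Z q.
Proof.
move=> q01; have q01' : 0 < q < 1 by lra.
have Z0 : 0 <= Z q.
  rewrite leNgt; apply/negP => Z0; have := Phi_lt Z0.
  by rewrite PhiZ// (cdf_center Phi_sym); lra.
by rewrite QE// -{1}(PhiZ q01') cdf_dominated.
Qed.

(** A strict inequality would make F equal to q at both Q(q) and the larger point -Q(1 - q).
    Crossing from Q(q) with d = Z(q) - Q(q) puts F at that second point above a value of Phi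
    exceeding q. *)
Lemma quantile_sym q : 1 / 2 <= q < 1 -> Q (1 - q) = - Q q.
Proof.
move=> q01; have q01' : 0 < q < 1 by lra.
have q01'' : 0 < 1 - q < 1 by lra.
apply/eqP; rewrite eq_le (quantileN_le QE F_sym)// leNgt; apply/negP => lt.
have F1 : F (Q (1 - q)) = 1 - q by exact: FQ.
have d0 : 0 <= Z q - Q q by rewrite subr_ge0 quantile_dominated.
have lt' : Q q <= - Q (1 - q) by lra.
have := crossing d0 lt'; rewrite addrC subrK PhiZ// FQ// lexx => /(_ isT).
have : Z q < - Q (1 - q) + (Z q - Q q) by lra.
move=> /Phi_lt; rewrite PhiZ//.
by have := F_sym (Q (1 - q)); lra.
Qed.

(** With d = Z(q) - Q(q), Phi(Q(q) + d) = q = F(Q(q)). Crossing up to Q(q) + Z(p) - Z(q) gives F >=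
    Phi(Z(p)) = p there, so Q(p) is no larger. *)
Lemma quantile_dispersion q p : 1 / 2 <= q -> q <= p -> p < 1 ->
  Q q <= Q p /\ Q p - Q q <= Z p - Z q.
Proof.
move=> q1 qp p1.
have q01 : 0 < q < 1 by lra.
have p01 : 0 < p < 1 by lra.
split; first by rewrite QE// FQ.
have d0 : 0 <= Z q - Q q by rewrite subr_ge0 quantile_dominated//; lra.
have Zqp : Z q <= Z p by rewrite ZE// PhiZ.
have le : Q q <= Q q + (Z p - Z q) by lra.
have := crossing d0 le; rewrite addrC subrK PhiZ// FQ// lexx => /(_ isT).
rewrite [X in Phi X](_ : _ = Z p); last by ring.
by rewrite PhiZ// -QE//; lra.
Qed.

End dispersion.

(** * Quantiles of the mixture *)

Section nu_theory.
Context {R : realType}.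
Implicit Types (k : nat) (a : \bar R) (q p x r : R).

Lemma fin_num_mixture_cdf k a rho2 x : mixture_cdf k a rho2 x \is a fin_num.
Proof. exact: fin_num_measure. Qed.

Let F k a rho2 x := fine (mixture_cdf k a rho2 x).
Let Phi x : R := fine (gauss_cdf x).

Lemma nu_le k a rho2 q x : 0 < q < 1 ->
  (nu k.+1 a q rho2 <= x) = (q <= F k a rho2 x).
Proof.
move=> q01; rewrite -[RHS]lee_fin fineK ?fin_num_mixture_cdf//.
exact: (quantile_le (mixture_prob k.+1 a rho2) x q01).
Qed.

Lemma normal_quantile_le q x : 0 < q < 1 ->
  (normal_quantile q <= x) = (q <= Phi x).
Proof.
move=> q01; rewrite -[RHS]lee_fin fineK ?gauss_cdf_fin_num// -gauss_cdfE.
exact: (quantile_le gauss x q01).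
Qed.

Let Phi_sym x : Phi (- x) + Phi x = 1.
Proof. by rewrite -fineD ?gauss_cdf_fin_num// gauss_cdf_sym. Qed.

Let Phi_lt x y : x < y -> Phi x < Phi y.
Proof. by move=> xy; rewrite fine_lt ?gauss_cdf_fin_num// gauss_cdf_lt. Qed.

Lemma normal_quantile_gt0 q : 1 / 2 < q < 1 -> 0 < normal_quantile q.
Proof.
move=> q01; rewrite ltNge normal_quantile_le; last by lra.
by rewrite (cdf_center Phi_sym); lra.
Qed.

Let fine_leE (u v : \bar R) : u \is a fin_num -> v \is a fin_num ->
  (fine u <= fine v) = (u <= v)%E.
Proof. by move=> uf vf; rewrite -lee_fin !fineK. Qed.

Section fixed_parameters.
Variables (k : nat) (a : \bar R) (rho2 : R).
Hypotheses (a0 : (0 < a)%E) (rho01 : 0 <= rho2 <= 1).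

Let F_sym x : F k a rho2 (- x) + F k a rho2 x = 1.
Proof.
rewrite -fineD ?fin_num_mixture_cdf//.
by rewrite (mixture_symmetric k x a0 rho01).
Qed.

Let crossing d x y : 0 <= d -> x <= y ->
  Phi (x + d) <= F k a rho2 x -> Phi (y + d) <= F k a rho2 y.
Proof.
have fle u v := fine_leE (gauss_cdf_fin_num u) (fin_num_mixture_cdf k a rho2 v).
move=> d0 xy H; rewrite (fle (y + d) y); apply: (single_crossing a0 rho01 d0 xy).
by rewrite -(fle (x + d) x).
Qed.

Let QE q x := @nu_le k a rho2 q x.

Lemma nu_ge0 q : 1 / 2 <= q < 1 -> 0 <= nu k.+1 a q rho2.
Proof. exact: (quantile_ge0 QE F_sym Phi_sym Phi_lt crossing). Qed.

Lemma nu_le_normal q : 1 / 2 <= q < 1 -> nu k.+1 a q rho2 <= normal_quantile q.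
Proof.
exact: (quantile_dominated QE normal_quantile_le F_sym Phi_sym Phi_lt crossing).
Qed.

Lemma nu_sym q : 1 / 2 <= q < 1 -> nu k.+1 a (1 - q) rho2 = - nu k.+1 a q rho2.
Proof.
exact: (quantile_sym QE normal_quantile_le F_sym Phi_sym Phi_lt crossing).
Qed.

Lemma nu_dispersion q p : 1 / 2 <= q -> q <= p -> p < 1 ->
  nu k.+1 a q rho2 <= nu k.+1 a p rho2 /\
  nu k.+1 a p rho2 - nu k.+1 a q rho2 <= normal_quantile p - normal_quantile q.
Proof.
exact: (quantile_dispersion QE normal_quantile_le F_sym Phi_sym Phi_lt crossing).
Qed.

End fixed_parameters.

(** N(0, 1) is the mixture with rho = 0, so its quantiles inherit the results on [nu]. *)
Lemma normal_quantileE q : 0 < q < 1 -> normal_quantile q = nu 1 +oo%E q 0.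
Proof.
move=> q01; have E x : (normal_quantile q <= x) = (nu 1 +oo%E q 0 <= x).
  by rewrite nu_le// normal_quantile_le// /F mixture_cdf0// ltry.
by apply/eqP; rewrite eq_le E lexx -E lexx.
Qed.

Lemma normal_quantile_sym q : 1 / 2 <= q < 1 ->
  normal_quantile (1 - q) = - normal_quantile q.
Proof.
move=> q01; rewrite !normal_quantileE; [|by lra..].
by apply: nu_sym; rewrite ?ltry// lexx ler01.
Qed.

(** Comparing distribution functions on [0, +oo) is enough, because quantiles at levels at least 1/2
    are nonnegative. *)
Let nu_comparison k1 k2 a1 a2 rho1 rho2 q :
  (0 < a2)%E -> 0 <= rho2 <= 1 -> 1 / 2 <= q < 1 ->
  (forall x, 0 <= x ->
    (mixture_cdf k2 a2 rho2 x <= mixture_cdf k1 a1 rho1 x)%E) ->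
  nu k1.+1 a1 q rho1 <= nu k2.+1 a2 q rho2.
Proof.
move=> a20 r01 q01 H; have q01' : 0 < q < 1 by lra.
rewrite nu_le//; have : q <= F k2 a2 rho2 (nu k2.+1 a2 q rho2) by rewrite -nu_le.
move=> /le_trans; apply; apply: fine_le; [exact: fin_num_mixture_cdf..|].
exact/H/nu_ge0.
Qed.

Lemma nu_nondecreasing_threshold k a a' rho2 q : (0 < a)%E -> (a <= a')%E ->
  0 <= rho2 <= 1 -> 1 / 2 <= q < 1 ->
  nu k.+1 a q rho2 <= nu k.+1 a' q rho2.
Proof.
move=> a0 aa' r01 q01; have a0' := lt_le_trans a0 aa'.
apply: (nu_comparison a0' r01 q01) => x x0.
exact: (cdf_antitone_threshold r01 x0 k a0 aa').
Qed.

Lemma nu_nondecreasing_dim k m a a' rho2 q : (0 < a)%E -> (0 < a')%E ->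
  accept_prob (k + m).+1 a' = accept_prob k.+1 a ->
  0 <= rho2 <= 1 -> 1 / 2 <= q < 1 ->
  nu k.+1 a q rho2 <= nu (k + m).+1 a' q rho2.
Proof.
move=> a0 a0' aa' r01 q01; apply: (nu_comparison a0' r01 q01) => x x0.
exact: (cdf_antitone_dim r01 x0 a0 a0' aa').
Qed.

Lemma nu_nonincreasing_rho k a rho1 rho2 q : (0 < a)%E ->
  0 <= rho1 <= rho2 -> rho2 <= 1 -> 1 / 2 <= q < 1 ->
  nu k.+1 a q rho2 <= nu k.+1 a q rho1.
Proof.
move=> a0 r01 r1 q01; have r01' : 0 <= rho1 <= 1 by lra.
have r01'' : 0 <= rho2 <= 1 by lra.
apply: (nu_comparison a0 r01' q01) => x x0.
exact: (cdf_nondecreasing_rho r01'' x0 k a0 r01).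
Qed.

End nu_theory.

(** * Sample sizes *)

Section size_ratio_theory.
Context {R : realType}.
Implicit Types (k : nat) (a : \bar R) (alpha gamma tau Vt V : R).

(** Sample sizes are squares, hence compare like their numerators only once the smaller numerator is
    known to be nonnegative. *)
Lemma scaled_sqr_le (N tau x y : R) : 0 < N -> 0 < tau -> 0 <= x -> x <= y ->
  (x / tau) ^+ 2 / N <= (y / tau) ^+ 2 / N.
Proof.
move=> N0 tau0 x0 xy; have y0 := le_trans x0 xy.
by rewrite ler_pM2r ?invr_gt0// ler_sqr ?nnegrE ?divr_ge0 ?(ltW tau0)// ler_pM2r ?invr_gt0.
Qed.

Definition numerator K a alpha gamma Vt V (R2 : R) : R :=
  nu K a (1 - alpha) (V * R2 / Vt) * Num.sqrt Vt
  - nu K a (1 - gamma) R2 * Num.sqrt V.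

Lemma size_ratio_le K K' a a' alpha gamma tau Vt V (R2 R2' x y : R) :
  0 < N_cr alpha gamma tau Vt V -> 0 < tau ->
  numerator K a alpha gamma Vt V R2 = x ->
  numerator K' a' alpha gamma Vt V R2' = y ->
  0 <= x -> x <= y ->
  size_ratio K a alpha gamma tau Vt V R2
    <= size_ratio K' a' alpha gamma tau Vt V R2'.
Proof. by move=> N0 tau0 <- <-; exact: scaled_sqr_le. Qed.

Lemma size_ratio_le1 K a alpha gamma tau Vt V (R2 x y : R) :
  0 < N_cr alpha gamma tau Vt V -> 0 < tau ->
  numerator K a alpha gamma Vt V R2 = x ->
  normal_quantile (1 - alpha) * Num.sqrt Vt
    - normal_quantile (1 - gamma) * Num.sqrt V = y ->
  0 <= x -> x <= y ->
  size_ratio K a alpha gamma tau Vt V R2 <= 1.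
Proof.
move=> N0 tau0 <- yE x0 xy; rewrite -[leRHS](divff (lt0r_neq0 N0)).
move: xy; rewrite -yE; exact: scaled_sqr_le.
Qed.

Lemma shrunk_R2_ge0_le1 Vt V (R2 : R) : 0 < V <= Vt -> 0 <= R2 <= 1 ->
  0 <= V * R2 / Vt <= 1.
Proof.
move=> /andP[V0 VVt] /andP[r0 r1]; have Vt0 := lt_le_trans V0 VVt.
have VR : 0 <= V * R2 by rewrite mulr_ge0// ltW.
by rewrite divr_ge0 ?(ltW Vt0)//= ler_pdivrMr// mul1r; nra.
Qed.

Section high_power.
Variables (alpha gamma tau Vt V : R).
Hypotheses (alpha01 : 0 < alpha <= 1 / 2) (tau0 : 0 < tau) (VVt : 0 < V <= Vt)
  (gamma01 : 1 / 2 <= gamma < 1) (N0 : 0 < N_cr alpha gamma tau Vt V).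

Let alpha01' : 1 / 2 <= 1 - alpha < 1. Proof. by move: alpha01; lra. Qed.

Let sum k a (R2 : R) :=
  nu k.+1 a (1 - alpha) (V * R2 / Vt) * Num.sqrt Vt
  + nu k.+1 a gamma R2 * Num.sqrt V.

Let numeratorE k a (R2 : R) : (0 < a)%E -> 0 <= R2 <= 1 ->
  numerator k.+1 a alpha gamma Vt V R2 = sum k a R2.
Proof.
by move=> a0 r01; congr (_ + _); rewrite -mulNr (nu_sym k a0 r01 gamma01) opprK.
Qed.

Let sum_ge0 k a (R2 : R) : (0 < a)%E -> 0 <= R2 <= 1 -> 0 <= sum k a R2.
Proof.
move=> a0 r01; have s01 := shrunk_R2_ge0_le1 VVt r01.
exact: addr_ge0 (mulr_ge0 (nu_ge0 k a0 s01 alpha01') (sqrtr_ge0 _))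
  (mulr_ge0 (nu_ge0 k a0 r01 gamma01) (sqrtr_ge0 _)).
Qed.

Let sum_le (x x' y y' : R) : x <= x' -> y <= y' ->
  x * Num.sqrt Vt + y * Num.sqrt V <= x' * Num.sqrt Vt + y' * Num.sqrt V.
Proof. by move=> xx' yy'; rewrite lerD// ler_wpM2r ?sqrtr_ge0. Qed.

Lemma size_ratio_high_power_le1 k a (R2 : R) : (0 < a)%E -> 0 <= R2 <= 1 ->
  size_ratio k.+1 a alpha gamma tau Vt V R2 <= 1.
Proof.
move=> a0 r01; have s01 := shrunk_R2_ge0_le1 VVt r01.
have zE : normal_quantile (1 - alpha) * Num.sqrt Vt
    - normal_quantile (1 - gamma) * Num.sqrt V =
    normal_quantile (1 - alpha) * Num.sqrt Vt + normal_quantile gamma * Num.sqrt V.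
  by congr (_ + _); rewrite -mulNr (normal_quantile_sym gamma01) opprK.
apply: (size_ratio_le1 N0 tau0 (numeratorE k a0 r01) zE (sum_ge0 k a0 r01)).
exact: sum_le (nu_le_normal k a0 s01 alpha01') (nu_le_normal k a0 r01 gamma01).
Qed.

Lemma size_ratio_nondecreasing_dim k m a a' (R2 : R) : (0 < a)%E -> (0 < a')%E ->
  accept_prob (k + m).+1 a' = accept_prob k.+1 a -> 0 <= R2 <= 1 ->
  size_ratio k.+1 a alpha gamma tau Vt V R2
    <= size_ratio (k + m).+1 a' alpha gamma tau Vt V R2.
Proof.
move=> a0 a0' aa' r01; have s01 := shrunk_R2_ge0_le1 VVt r01.
apply: (size_ratio_le N0 tau0 (numeratorE k a0 r01) (numeratorE (k + m) a0' r01)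
  (sum_ge0 k a0 r01)).
exact: sum_le (nu_nondecreasing_dim a0 a0' aa' s01 alpha01')
  (nu_nondecreasing_dim a0 a0' aa' r01 gamma01).
Qed.

Lemma size_ratio_nondecreasing_threshold k a a' (R2 : R) :
  (0 < a)%E -> (a <= a')%E -> 0 <= R2 <= 1 ->
  size_ratio k.+1 a alpha gamma tau Vt V R2
    <= size_ratio k.+1 a' alpha gamma tau Vt V R2.
Proof.
move=> a0 aa' r01; have s01 := shrunk_R2_ge0_le1 VVt r01.
have a0' := lt_le_trans a0 aa'.
apply: (size_ratio_le N0 tau0 (numeratorE k a0 r01) (numeratorE k a0' r01)
  (sum_ge0 k a0 r01)).
exact: sum_le (nu_nondecreasing_threshold k a0 aa' s01 alpha01')
  (nu_nondecreasing_threshold k a0 aa' r01 gamma01).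
Qed.

Lemma size_ratio_nonincreasing_R2 k a (R2 R2' : R) : (0 < a)%E -> 0 <= R2 ->
  R2 <= R2' <= 1 ->
  size_ratio k.+1 a alpha gamma tau Vt V R2'
    <= size_ratio k.+1 a alpha gamma tau Vt V R2.
Proof.
move=> a0 r0 /andP[rr' r1].
have r01 : 0 <= R2 <= 1 by rewrite r0 (le_trans rr').
have r01' : 0 <= R2' <= 1 by rewrite r1 (le_trans r0).
have r0r' : 0 <= R2 <= R2' by rewrite r0.
have /andP[s0 s1] := shrunk_R2_ge0_le1 VVt r01.
have /andP[s0' s1'] := shrunk_R2_ge0_le1 VVt r01'.
have ss' : 0 <= V * R2 / Vt <= V * R2' / Vt.
  case/andP: VVt => V0 le; have Vt0 := lt_le_trans V0 le.
  by rewrite s0 ler_pM2r ?invr_gt0// ler_pM2l.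
apply: (size_ratio_le N0 tau0 (numeratorE k a0 r01') (numeratorE k a0 r01)
  (sum_ge0 k a0 r01')).
exact: sum_le (nu_nonincreasing_rho k a0 ss' s1' alpha01')
  (nu_nonincreasing_rho k a0 r0r' r1 gamma01).
Qed.

End high_power.

(** Here tilde R^2 = R^2, and both numerators are V^(1/2) times a difference of quantiles at the
    levels 1 - gamma <= 1 - alpha, which exceed 1/2 or equal it: exactly the setting of
    [nu_dispersion]. *)
Lemma size_ratio_equal_variances_le1 k a alpha gamma tau V (R2 : R) :
  (0 < a)%E -> 0 < alpha -> alpha <= gamma -> gamma < 1 / 2 -> 0 < tau -> 0 < V ->
  0 <= R2 <= 1 -> 0 < N_cr alpha gamma tau V V ->
  size_ratio k.+1 a alpha gamma tau V V R2 <= 1.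
Proof.
move=> a0 al0 ag g2 tau0 V0 r01 N0.
have q1 : 1 / 2 <= 1 - gamma by lra.
have qp : 1 - gamma <= 1 - alpha by lra.
have p1 : 1 - alpha < 1 by lra.
have [le1 le2] := nu_dispersion k a0 r01 q1 qp p1.
have NE : numerator k.+1 a alpha gamma V V R2 =
    (nu k.+1 a (1 - alpha) R2 - nu k.+1 a (1 - gamma) R2) * Num.sqrt V.
  by rewrite /numerator (mulrC V) mulfK ?gt_eqF// mulrBl.
have d0 : 0 <= nu k.+1 a (1 - alpha) R2 - nu k.+1 a (1 - gamma) R2.
  by rewrite subr_ge0.
apply: (size_ratio_le1 N0 tau0 NE (esym (mulrBl _ _ _))).
  exact: mulr_ge0 d0 (sqrtr_ge0 V).
exact: ler_wpM2r (sqrtr_ge0 V) _ _ le2.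
Qed.

(* Let z be the upper quartile of N(0, 1), K = 1, R^2 = 1, alpha = gamma = 1/4,
   V^(1/2) = 3, tilde V^(1/2) = 5 and a^(1/2) = z / 4, so that tilde R^2 = 9/25.
   As |L| <= a^(1/2), the 3/4-quantiles satisfy nu(1) <= z / 4 and
   nu(9/25) >= 4/5 z - 3/5 (z / 4) = 13/20 z, whence
   5 nu(9/25) - 3 nu(1) >= 5/2 z > 5 z - 3 z. *)
Lemma size_ratio_gt1 : exists (K : nat) a alpha gamma tau Vt V R2,
  [/\ admissible K a alpha gamma tau Vt V R2, V < Vt, gamma < 1 / 2 &
      1 < size_ratio K a alpha gamma tau Vt V R2].
Proof.
have sqrtE (x y : R) : 0 <= x -> y = x ^+ 2 -> Num.sqrt y = x.
  by move=> x0 ->; rewrite sqrtr_sqr ger0_norm.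
have s9 : Num.sqrt 9 = 3 :> R by apply: sqrtE; [lra|ring].
have s25 : Num.sqrt 25 = 5 :> R by apply: sqrtE; [lra|ring].
have c45 : Num.sqrt (1 - 9 / 25) = 4 / 5 :> R by apply: sqrtE; [lra|field].
have c35 : Num.sqrt (9 / 25) = 3 / 5 :> R by apply: sqrtE; [lra|field].
have q34 : 0 < (3 / 4 : R) < 1 by lra.
have q14 : 1 - 1 / 4 = 3 / 4 :> R by lra.
have p0 : 0 < (9 / 25 : R) by lra.
have pc : 0 < (4 / 5 : R) by lra.
have [z zE z0] : exists2 z : R, normal_quantile (3 / 4) = z & 0 < z.
  by exists (normal_quantile (3 / 4)) => //; apply: normal_quantile_gt0; lra.
have [r r0 sr] : exists2 r : R, 0 < r & Num.sqrt r = z / 4.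
  exists ((z / 4) ^+ 2); first by rewrite exprn_gt0// divr_gt0.
  by apply: sqrtE; [lra|].
have NE : N_cr (1 / 4) (1 / 4) 1 25 9 = (2 * z) ^+ 2.
  by rewrite /N_cr q14 zE s9 s25; field.
have [x xE x_le] : exists2 x : R, nu 1 r%:E (3 / 4) 1 = x & x <= z / 4.
  exists (nu 1 r%:E (3 / 4) 1) => //.
  by rewrite nu_le// -sr mixture_cdf_eq1//=; lra.
have [y yE y_ge] : exists2 y : R, nu 1 r%:E (3 / 4) (9 / 25) = y & 13 / 20 * z <= y.
  exists (nu 1 r%:E (3 / 4) (9 / 25)) => //.
  have := @nu_le R 0 r%:E (9 / 25) (3 / 4) (nu 1 r%:E (3 / 4) (9 / 25)) q34.
  rewrite lexx; move: (nu _ _ _ _) => v /esym Fv.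
  suff : z <= (v + 3 / 5 * (z / 4)) / (4 / 5) by lra.
  rewrite -zE normal_quantile_le// zE; apply: (le_trans Fv).
  apply: fine_le; [exact: fin_num_mixture_cdf|exact: gauss_cdf_fin_num|].
  have := @mixture_cdf_le_gauss R 0 r (9 / 25) r0 p0 v.
  by rewrite c45 c35 sr; exact.
have DE : numerator 1 r%:E (1 / 4) (1 / 4) 25 9 1 = y * 5 - x * 3.
  by rewrite /numerator q14 s9 s25 mulr1 yE xE.
have N0 : 0 < N_cr (1 / 4) (1 / 4) 1 25 9 :> R.
  by rewrite NE exprn_gt0// mulr_gt0.
have gt1 : 1 < size_ratio 1 r%:E (1 / 4) (1 / 4) 1 25 9 1.
  rewrite /size_ratio /N_rr -/(numerator _ _ _ _ _ _ _) DE NE divr1.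
  clear -z0 x_le y_ge; rewrite ltr_pdivlMr ?exprn_gt0 ?mulr_gt0// mul1r.
  by rewrite ltr_sqr ?nnegrE; lra.
exists 1%N, r%:E, (1 / 4), (1 / 4), 1, 25, 9, 1; clear -r0 N0 gt1.
split; [|lra|lra|exact: gt1].
split; [by rewrite lte_fin|lra|split; lra|lra|].
by split; [lra|exact: lexx|exact: N0].
Qed.

End size_ratio_theory.

Theorem theorem5 (R : realType) :
  (forall (K : nat) (a : \bar R) (alpha gamma tau Vt V R2 : R),
    admissible K a alpha gamma tau Vt V R2 ->
    (Vt = V -> size_ratio K a alpha gamma tau Vt V R2 <= 1) /\
    (1 / 2 <= gamma ->
      [/\ size_ratio K a alpha gamma tau Vt V R2 <= 1,
          (forall (K' : nat) (a' : \bar R),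
            (K <= K')%N -> (0 < a')%E -> accept_prob K' a' = accept_prob K a ->
            size_ratio K a alpha gamma tau Vt V R2
              <= size_ratio K' a' alpha gamma tau Vt V R2),
          (forall a' : \bar R, (a <= a')%E ->
            size_ratio K a alpha gamma tau Vt V R2
              <= size_ratio K a' alpha gamma tau Vt V R2) &
          (forall R2' : R, R2 <= R2' <= 1 ->
            size_ratio K a alpha gamma tau Vt V R2'
              <= size_ratio K a alpha gamma tau Vt V R2)])) /\
  (exists (K : nat) (a : \bar R) (alpha gamma tau Vt V R2 : R),
    [/\ admissible K a alpha gamma tau Vt V R2, V < Vt, gamma < 1 / 2 &
        1 < size_ratio K a alpha gamma tau Vt V R2]).
Proof.
split; last exact: size_ratio_gt1.
move=> K a alpha gamma tau Vt V R2 [[K0 a0] al01 [tau0 VVt] r01 [g01 ag N0]].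
have [k Kk] : exists k, K = k.+1 by exists K.-1; rewrite prednK.
rewrite {}Kk; split=> [VE|g2].
  rewrite {}VE in VVt N0 *; have V0 : 0 < V by lra.
  (* For gamma >= 1/2 the numerator is a sum and the bound for general variances applies; for gamma
     < 1/2 it is a genuine difference, and dispersion is what controls it. *)
  have [g2|g2] := leP (1 / 2) gamma.
    have g : 1 / 2 <= gamma < 1 by lra.
    exact: size_ratio_high_power_le1 al01 tau0 VVt g N0 k a R2 a0 r01.
  have al0 : 0 < alpha by lra.
  exact: size_ratio_equal_variances_le1 a0 al0 ag g2 tau0 V0 r01 N0.
have g : 1 / 2 <= gamma < 1 by lra.
split.
- exact: size_ratio_high_power_le1 al01 tau0 VVt g N0 k a R2 a0 r01.
- move=> K' a' KK' a0'; rewrite -(subnKC KK') => aa'.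
  exact: (size_ratio_nondecreasing_dim al01 tau0 VVt g N0 a0 a0' aa' r01).
- move=> a' aa'.
  exact: (size_ratio_nondecreasing_threshold al01 tau0 VVt g N0 k a0 aa' r01).
- move=> R2' rr'; have r0 : 0 <= R2 by lra.
  exact: (size_ratio_nonincreasing_R2 al01 tau0 VVt g N0 k a0 r0 rr').
Qed.
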